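(* For every pair of integers $n\ge 7$ and $1\le k\le n-2$, let $g_{n,k}(t)={}_2F_1\left(1,\frac{n-4}{2};\frac k2;t^2\right)$ and define \[ V_{n,k}(x,y)=(|x|^2+|y|^2)^{\frac{4-n}{2}}\,g_{n,k}\!\left(\frac{|y|}{\sqrt{|x|^2+|y|^2}}\right),\qquad (x,y)\in\mathbb{R}^{n-k}\times\mathbb{R}^k . \] Then $V_{n,k}$ is a subsolution of the linearized one-phase equation at the cone $U_{n,k}$.
   Context: Points of $\mathbb{R}^n=\mathbb{R}^{n-k}\times\mathbb{R}^k$ are written $(x,y)$, $\rho=\sqrt{|x|^2+|y|^2}$, $t=|y|/\rho$; ${}_2F_1$ is Gauss' hypergeometric function. Let $f_{n,k}(t)={}_2F_1(\frac{n-1}{2},-\frac12;\frac k2;t^2)$ and let $t_{n,k}$ be its unique zero in $(0,1)$. The one-phase cone $U_{n,k}$ is $U_{n,k}=c_{n,k}\,\rho\, f_{n,k}(t)$ on $\{t<t_{n,k}\}$ and $0$ elsewhere, with $c_{n,k}>0$ chosen so that $|\nabla U_{n,k}|=1$ on the free boundary; thus $\{U_{n,k}>0\}=\{|y|<t_{n,k}\rho\}$. The linearized equation at $U=U_{n,k}$ is \[ \Delta\varphi=0\ \text{ in }\{U>0\},\qquad \partial_\nu\varphi+H\varphi=0\ \text{ on }\partial\{U>0\}\setminus\{0\}, \] where $\nu$ is the unit normal pointing into $\{U>0\}$ and $H$ is the mean curvature of the free boundary, explicitly $\rho H=\frac{(n-2)t_{n,k}-(k-1)t_{n,k}^{-1}}{\sqrt{1-t_{n,k}^2}}$.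 A function $\varphi$ that is harmonic in $\{U>0\}$ and smooth up to $\partial\{U>0\}\setminus\{0\}$ is called a subsolution of the linearized equation if $\partial_\nu\varphi+H\varphi\le 0$ on $\partial\{U>0\}\setminus\{0\}$. *)

(* Defs.v *)
From HB Require Import structures.
From mathcomp Require Import all_boot all_order all_algebra.
From mathcomp Require Import all_classical all_reals all_analysis.

Set Implicit Arguments.
Unset Strict Implicit.
Unset Printing Implicit Defensive.

Import Order.TTheory GRing.Theory Num.Theory.
Import numFieldNormedType.Exports.

Local Open Scope classical_set_scope.
Local Open Scope ring_scope.

Section Hypergeometric.
Variable R : realType.

Definition pochhammer (a : R) (m : nat) : R := \prod_(i < m) (a + i%:R).

(* Gauss' series 2F1(a, b; c; z); only meaningful for |z| < 1 and c not a
   nonpositive integer. *)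
Definition hyp2F1 (a b c z : R) : R :=
  limn (series (fun m : nat =>
    pochhammer a m * pochhammer b m / (pochhammer c m * m`!%:R) * z ^+ m)).

End Hypergeometric.

Section Calculus.
Variables (R : realType) (d : nat).
Implicit Types (phi psi U : 'rV[R]_d -> R) (O W : set 'rV[R]_d)
               (p q u v nu : 'rV[R]_d).

(* The library norm `|_| on 'rV[R]_d is the sup norm, with the same topology. *)
Definition enorm (m : nat) (v : 'rV[R]_m) : R :=
  Num.sqrt (\sum_(i < m) v ord0 i ^+ 2).

Definition grad phi p : 'rV[R]_d :=
  \row_(i < d) 'D_(delta_mx ord0 i : 'rV[R]_d) phi p.

Definition laplacian phi p : R :=
  \sum_(i < d) 'D_(delta_mx ord0 i : 'rV[R]_d)
    (fun q => 'D_(delta_mx ord0 i : 'rV[R]_d) phi q) p.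

Definition iter_derive (vs : seq 'rV[R]_d) phi : 'rV[R]_d -> R :=
  foldr (fun v psi => fun p => 'D_v psi p) phi vs.

(* C^N on the open set O: all iterated directional derivatives of order at most
   N exist and are continuous at every point of O. *)
Definition Ck_on (N : nat) O phi : Prop :=
  forall vs : seq 'rV[R]_d, (size vs <= N)%N -> forall p, O p ->
    {for p, continuous (iter_derive vs phi)} /\
    ((size vs < N)%N -> forall v, derivable (iter_derive vs phi) p v).

Definition smooth_on O phi : Prop := forall N : nat, Ck_on N O phi.

Definition harmonic_on O phi : Prop :=
  Ck_on 2 O phi /\ forall p, O p -> laplacian phi p = 0.

Definition boundary O : set 'rV[R]_d := closure O `\` interior O.

Definition punctured_boundary O : set 'rV[R]_d := boundary O `\ (0 : 'rV[R]_d).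

(* Near each point of G, phi coincides on closure O with a smooth function. *)
Definition smooth_up_to O (G : set 'rV[R]_d) phi : Prop :=
  forall p, G p -> exists (W : set 'rV[R]_d) (psi : 'rV[R]_d -> R),
    [/\ open W, W p, smooth_on W psi &
        forall q, W q -> closure O q -> psi q = phi q].

(* O is locally the superlevel set {psi > 0} of a smooth psi with nonvanishing
   gradient at p, and nu is that gradient normalised. *)
Definition inner_unit_normal O p nu : Prop :=
  exists (W : set 'rV[R]_d) (psi : 'rV[R]_d -> R),
    [/\ [/\ open W, W p & smooth_on W psi],
        psi p = 0,
        forall q, W q -> (O q <-> 0 < psi q),
        grad psi p != 0 &
        nu = (enorm (grad psi p))^-1 *: grad psi p].

(* One-sided: phi need only be meaningful on closure O, into which nu points. *)
Definition is_normal_derivative phi p nu (l : R) : Prop :=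
  (h^-1 * (phi (p + h *: nu) - phi p)) @[h --> (0 : R)^'+] --> l.

Definition linearized_subsolution O (H : 'rV[R]_d -> R) phi : Prop :=
  [/\ harmonic_on O phi,
      smooth_up_to O (punctured_boundary O) phi &
      forall p, punctured_boundary O p ->
        (exists nu, inner_unit_normal O p nu) /\
        forall nu, inner_unit_normal O p nu ->
          exists2 l : R, is_normal_derivative phi p nu l & l + H p * phi p <= 0].

End Calculus.

Section Cone.
Variables (R : realType) (n k : nat).

(* R^n = R^(n-k) x R^k, with (x, y) encoded as the row vector row_mx x y. *)
Local Notation E := ('rV[R]_(n - k + k)).

Definition xnorm (p : E) : R := enorm (lsubmx p).
Definition ynorm (p : E) : R := enorm (rsubmx p).
Definition rho (p : E) : R := Num.sqrt (xnorm p ^+ 2 + ynorm p ^+ 2).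
Definition tvar (p : E) : R := ynorm p / rho p.

Definition f_nk (t : R) : R :=
  hyp2F1 ((n%:R - 1) / 2) (- (1 / 2)) (k%:R / 2) (t ^+ 2).

Definition g_nk (t : R) : R :=
  hyp2F1 1 ((n%:R - 4) / 2) (k%:R / 2) (t ^+ 2).

Definition is_zero_nk (t : R) : Prop := 0 < t < 1 /\ f_nk t = 0.

(* At the origin rho p = 0 = tvar p, so the value there is 0. *)
Definition U_nk (t c : R) (p : E) : R :=
  if tvar p < t then c * rho p * f_nk (tvar p) else 0.

Definition positivity_set (U : E -> R) : set E := [set p | 0 < U p].

(* |grad U| = 1 on the free boundary minus the origin, as the trace from the
   positivity set. *)
Definition is_normalization_nk (t c : R) : Prop :=
  0 < c /\
  forall p, punctured_boundary (positivity_set (U_nk t c)) p ->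
    enorm (grad (U_nk t c) q)
      @[q --> within (positivity_set (U_nk t c)) (nbhs p)] --> (1 : R).

Definition mean_curvature_nk (t : R) (p : E) : R :=
  ((n%:R - 2) * t - (k%:R - 1) * t^-1) / Num.sqrt (1 - t ^+ 2) / rho p.

Definition V_nk (p : E) : R :=
  (xnorm p ^+ 2 + ynorm p ^+ 2) `^ ((4 - n%:R) / 2) *
  g_nk (ynorm p / Num.sqrt (xnorm p ^+ 2 + ynorm p ^+ 2)).

End Cone.

Arguments f_nk {R} n k t.
Arguments g_nk {R} n k t.
Arguments is_zero_nk {R} n k t.
Arguments U_nk {R} n k t c p.
Arguments is_normalization_nk {R} n k t c.
Arguments mean_curvature_nk {R} n k t p.
Arguments V_nk {R} n k p.

(* Main.v *)
(** Write s = t^2, b = (n - 4)/2, c = k/2, G = 2F1(1, b; c; .), F = f_{n,k} as a function of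
    s. In polar form, harmonicity of V is the hypergeometric equation of G. The normal of the
    cone is the gradient of t^2 (|x|^2 + |y|^2) - |y|^2, and the first-order equation
    s (1 - s) G' = (c - 1) - (c - 1 - b s) G turns the boundary inequality into
    G(s0) (2 s0 - 1) <= k - 2, where s0 is the zero of F.

    Upper bounds for s0 come from a Sturm comparison: if the operator L annihilating F
    satisfies L Phi >= 0 on (0, sigma), Phi(sigma) = 0 and Phi'(sigma) < 0, then
    F(sigma) <= 0, so s0 <= sigma. With Phi = (1 - s)^(-1/2) (1 - s / sigma) this gives
    s0 <= 2k / (n + k - 1) for k <= n - 3, which is enough if 3k <= n - 1 (if k = 1, with the
    first terms of the series of G). Otherwise, for n <= 43 the inequality is checked at that point by summing the series of G, and for
    larger n the comparison is repeated with Phi = log (x / x1), where x = (c - 1) / G and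
    x1 = 2k / (n + k - 1) - 1/2. For k = n - 2, G is dominated by a multiple of
    (1 - s)^(-1/2), and Phi = (tau - s)^(-1/2) (sigma - s) with tau slightly above 1 bounds
    s0; n = 7, 8, 9 are checked numerically. *)

Require Import Defs.
From mathcomp Require Import all_boot all_order all_algebra.
From mathcomp Require Import all_classical all_reals all_analysis.
From mathcomp Require Import ring lra zify.
From Stdlib Require BinNat Nnat.

Set Implicit Arguments.
Unset Strict Implicit.
Unset Printing Implicit Defensive.

Import Order.TTheory GRing.Theory Num.Theory.
Import numFieldNormedType.Exports.

Local Open Scope classical_set_scope.
Local Open Scope ring_scope.

(** * Power series converging in the open unit disc *)

Section PowerSeries.
Variable R : realType.
Implicit Types (a b : R^nat) (z : R).

(** Where 2 s > 1 both G and 2 s - 1 increase, so for k >= 2 it is enough to have an upper bound of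
    s0 at which the inequality holds; for k = 1 the right side is -1 and a lower bound of G is
    needed as well. The obstacle is size: with k / n fixed in (1/3, 1) and n large, 2k / (n + k - 1)
    lies beyond k / n, the terms of the series of G grow at first, and G is exponentially large at
    that point, so the linear bound cannot serve for all n. The logarithmic test function avoids
    evaluating G there: if the inequality fails at s0, then G(s0) > K = (c - 1) / x1, and Phi = log
    (K / G) vanishes where G reaches K, before s0. The equations of F and G share the first-order
    coefficient c - (b + 2) s, so in L Phi the terms linear in G' cancel through the equation of G,
    and only (G' / G)^2, a constant and Phi remain. For k = n - 2 the linear test fails because its
    residual contains (a - c)(a - c - 1) with a = b + 3/2, which is then -1/4. *)

Definition unit_radius a := forall z, `|z| < 1 -> cvgn (pseries a z).

Definition psum a z : R := limn (pseries a z).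

Definition coef_shift a : R^nat := fun n => if n is m.+1 then a m else 0.

Lemma geometric_sum_le (r : R) n : 0 <= r < 1 ->
  \sum_(0 <= k < n) r ^+ k <= (1 - r)^-1.
Proof.
move=> /andP[r0 r1]; have r1' : 0 < 1 - r by rewrite subr_gt0.
suff -> : \sum_(0 <= k < n) r ^+ k = (1 - r ^+ n) / (1 - r).
  by rewrite ler_piMl ?invr_ge0 ?(ltW r1')// lerBlDr lerDl exprn_ge0.
elim: n => [|n IH]; first by rewrite big_nil expr0 subrr mul0r.
by rewrite big_nat_recr//= IH exprS; field; rewrite gt_eqF.
Qed.

(** From index [N] on the norms are dominated by a geometric series; with the earlier terms dropped,
    the partial sums of the norms are monotone and bounded. *)
Lemma ratio_test (u : R^nat) (r : R) (N : nat) : 0 <= r < 1 ->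
  (forall m, (N <= m)%N -> `|u m.+1| <= r * `|u m|) -> cvgn (series u).
Proof.
move=> r01 hu; have /andP[r0 r1] := r01.
have hb m : `|u (m + N)%N| <= `|u N| * r ^+ m.
  elim: m => [|m IH]; first by rewrite add0n expr0 mulr1.
  rewrite addSn (le_trans (hu _ (leq_addl _ _)))// exprS mulrCA.
  by rewrite ler_wpM2l.
apply: normed_cvg; rewrite -(is_cvg_series_restrict N).
apply: nondecreasing_is_cvgn.
  move=> m n mn /=; case: (leqP N m) => Nm.
    by rewrite (big_cat_nat Nm mn) /= lerDl sumr_ge0.
  by rewrite [leLHS]big_geq ?(ltnW Nm)// sumr_ge0.
exists (`|u N| * (1 - r)^-1) => _ [n _ <-] /=.
rewrite -{1}(add0n N) big_addn.
apply: (@le_trans _ _ (\sum_(0 <= k < n - N) `|u N| * r ^+ k)).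
  by apply: ler_sum => k _; exact: hb.
by rewrite -mulr_sumr ler_wpM2l// geometric_sum_le.
Qed.

Lemma unit_radius_ratio a :
  (forall r : R, 1 < r -> exists N : nat, forall m, (N <= m)%N ->
     `|a m.+1| <= r * `|a m|) -> unit_radius a.
Proof.
move=> ha z z1.
(* 2 / (1 + |z|) exceeds 1, while its product with |z| stays below 1. *)
have [N hN] := ha (2 / (1 + `|z|)) ltac:(by rewrite ltr_pdivlMr; have := normr_ge0 z; lra).
have z0 := normr_ge0 z.
apply: (@ratio_test _ (2 * `|z| / (1 + `|z|)) N).
  apply/andP; split; first by rewrite divr_ge0 ?mulr_ge0//; lra.
  by rewrite ltr_pdivrMr; lra.
move=> m /hN; rewrite !normrM !normrX exprS => h.
have -> : 2 * `|z| / (1 + `|z|) * (`|a m| * `|z| ^+ m) =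
  (2 / (1 + `|z|) * `|a m|) * (`|z| * `|z| ^+ m) by ring.
by rewrite ler_wpM2r// mulr_ge0// exprn_ge0.
Qed.

(** Take r with r^2 = (1 + |z|) / 2 >= |z|, so that |z|^n <= r^n r^n. One factor absorbs n + 1,
    because (n + 1) r^n is at most the geometric sum 1 / (1 - r); the other leaves a series that
    converges absolutely at r < 1. *)
Lemma unit_radius_diffs a : unit_radius a -> unit_radius (pseries_diffs a).
Proof.
move=> ha z z1; have z0 := normr_ge0 z.
pose r : R := Num.sqrt ((1 + `|z|) / 2).
have r2 : r ^+ 2 = (1 + `|z|) / 2 by rewrite sqr_sqrtr//; lra.
have r0 : 0 < r by rewrite sqrtr_gt0; lra.
have r1 : r < 1 by rewrite -(@ltr_pXn2r _ 2)// ?nnegrE ?(ltW r0)// r2 expr1n; lra.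
have hn : cvgn (pseries (fun i => `|a i|) r).
  apply: (@is_cvg_pseries_inside_norm _ _ ((1 + r) / 2)); first apply: ha.
    by rewrite ger0_norm; lra.
  by rewrite !ger0_norm; lra.
have nr n : n.+1%:R * r ^+ n <= (1 - r)^-1.
  apply: le_trans (geometric_sum_le n.+1 (_ : 0 <= r < 1)); last by rewrite (ltW r0).
  rewrite -[n.+1 in leLHS]subn0 mulr_natl -sumr_const_nat.
  rewrite big_nat [leRHS]big_nat; apply: ler_sum => i; rewrite ltnS => /= ile.
  by rewrite ler_wiXn2l// ltW.
apply: normed_cvg.
pose C := (1 - r)^-1 * r^-1.
apply: (@series_le_cvg _ _ (fun n => C * (`|a n.+1| * r ^+ n.+1))).
- by move=> n /=.
- move=> n; rewrite /C !mulr_ge0// ?invr_ge0 ?subr_ge0 ?exprn_ge0 ?(ltW r0) ?(ltW r1)//.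
- move=> n /=; rewrite /pseries_diffs !normrM normrX normr_nat /C.
  have zr : `|z| ^+ n <= r ^+ n * r ^+ n.
    by rewrite -exprMn -expr2 lerXn2r ?nnegrE// ?exprn_ge0 ?ltW//r2; lra.
  have -> : (1 - r)^-1 / r * (`|a n.+1| * r ^+ n.+1) =
     (1 - r)^-1 * (`|a n.+1| * r ^+ n) by rewrite exprS; field; rewrite !gt_eqF// subr_gt0.
  have an := normr_ge0 (a n.+1).
  rewrite -mulrA mulrCA [leRHS]mulrCA ler_wpM2l//.
  apply: (@le_trans _ _ (n.+1%:R * (r ^+ n * r ^+ n))); first by rewrite ler_wpM2l.
  by rewrite mulrA ler_wpM2r// exprn_ge0// ltW.
have -> : (fun n => C * (`|a n.+1| * r ^+ n.+1)) =
   C *: (fun n => `|a n.+1| * r ^+ n.+1) by [].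
apply: is_cvg_seriesZ.
have -> : series (fun n => `|a n.+1| * r ^+ n.+1) =
  (fun n => pseries (fun i => `|a i|) r (n + 1)%N - `|a 0%N|).
  apply/funext => n; rewrite /pseries /series /= addn1 big_nat_recl//= expr0 mulr1.
  by rewrite addrAC subrr add0r.
apply: is_cvgB; last exact: is_cvg_cst.
by move: hn => /cvg_ex[l hl]; apply/cvg_ex; exists l; rewrite cvg_shiftn.
Qed.

Lemma psum_derive a z : unit_radius a -> `|z| < 1 ->
  is_derive z (1 : R) (psum a) (psum (pseries_diffs a) z).
Proof.
move=> ha z1; have hd := unit_radius_diffs ha.
have k1 : `|(1 + `|z|) / 2| < 1 :> R by rewrite ger0_norm; have := normr_ge0 z; lra.
apply: (@pseries_snd_diffs _ a ((1 + `|z|) / 2)).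
- exact: ha.
- exact: hd.
- exact: (unit_radius_diffs hd).
- by rewrite [ltRHS]ger0_norm; have := normr_ge0 z; lra.
Qed.

Lemma psumD a b z : unit_radius a -> unit_radius b -> `|z| < 1 ->
  psum a z + psum b z = psum (fun n => a n + b n) z.
Proof.
move=> ha hb z1; rewrite /psum -lim_seriesD; [|exact: ha|exact: hb].
by congr (limn (series _)); apply/funext => n /=; rewrite mulrDl.
Qed.

Lemma psumZ k a z : unit_radius a -> `|z| < 1 ->
  k * psum a z = psum (fun n => k * a n) z.
Proof.
move=> ha z1; rewrite /psum -[_ * _]/(_ *: _) -lim_seriesZ; last exact: ha.
by congr (limn (series _)); apply/funext => n /=; rewrite -mulrA.
Qed.

Lemma unit_radiusD a b : unit_radius a -> unit_radius b ->
  unit_radius (fun n => a n + b n).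
Proof.
move=> ha hb z z1; rewrite /pseries.
have -> : (fun i => (a i + b i) * z ^+ i) =
  (fun i => a i * z ^+ i) + (fun i => b i * z ^+ i).
  by apply/funext => i; rewrite mulrDl.
by apply: is_cvg_seriesD; [exact: ha|exact: hb].
Qed.

Lemma unit_radiusZ k a : unit_radius a -> unit_radius (fun n => k * a n).
Proof.
move=> ha z z1; rewrite /pseries.
have -> : (fun i => k * a i * z ^+ i) = k *: (fun i => a i * z ^+ i).
  by apply/funext => i; rewrite -mulrA.
by apply: is_cvg_seriesZ; exact: ha.
Qed.

Lemma cvg_pseries_shift a z : unit_radius a -> `|z| < 1 ->
  pseries (coef_shift a) z @ \oo --> z * psum a z.
Proof.
move=> ha z1; rewrite -cvg_shiftS.
rewrite (_ : [sequence _]_n = (fun n => z * pseries a z n)).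
  by apply: cvgM; [exact: cvg_cst|exact: ha].
apply/funext => n; rewrite /pseries /series /= big_nat_recl//= mul0r add0r.
by rewrite mulr_sumr; apply: eq_bigr => i _; rewrite exprS mulrCA.
Qed.

Lemma unit_radius_shift a : unit_radius a -> unit_radius (coef_shift a).
Proof. by move=> ha z z1; exact: cvgP (cvg_pseries_shift ha z1). Qed.

Lemma psum_shift a z : unit_radius a -> `|z| < 1 ->
  z * psum a z = psum (coef_shift a) z.
Proof. by move=> ha z1; apply/esym/cvg_lim => //; exact: cvg_pseries_shift. Qed.

Lemma psum_ext a b z : (forall n, a n = b n) -> psum a z = psum b z.
Proof. by move=> /funext ->. Qed.

Lemma psum_const k z : psum (fun n => if n is 0%N then k else 0) z = k.
Proof.
rewrite /psum; apply/cvg_lim => //; rewrite -cvg_shiftS /=.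
apply: cvg_near_cst; near=> n; rewrite /pseries /series /= big_nat_recl//= expr0.
by rewrite mulr1 big1 ?addr0// => i _; rewrite mul0r.
Unshelve. all: by end_near. Qed.

Lemma psum0 a : psum a 0 = a 0%N.
Proof.
rewrite /psum; apply/cvg_lim => //; rewrite -cvg_shiftS /=.
apply: cvg_near_cst; near=> n; rewrite /pseries /series /= big_nat_recl//= expr0.
by rewrite mulr1 big1 ?addr0// => i _; rewrite expr0n mulr0.
Unshelve. all: by end_near. Qed.

Lemma psum_ge_partial a z N : unit_radius a -> 0 <= z < 1 ->
  (forall m, (N <= m)%N -> 0 <= a m) -> \sum_(0 <= i < N) a i * z ^+ i <= psum a z.
Proof.
move=> ha /andP[z0 z1] a0.
apply: limr_ge; first by apply: ha; rewrite ger0_norm.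
near=> n; rewrite /pseries /series /= (@big_cat_nat _ _ _ N 0 n) //=; last first.
  by near: n; exact: nbhs_infty_ge.
rewrite lerDl big_nat sumr_ge0// => i /andP[Ni _].
by rewrite mulr_ge0 ?exprn_ge0// a0.
Unshelve. all: by end_near. Qed.

Lemma psum_le_tail a z N r : unit_radius a -> 0 <= z < 1 -> 0 <= r < 1 ->
  (forall m, 0 <= a m) -> (forall m, (N <= m)%N -> a m.+1 * z <= r * a m) ->
  psum a z <= \sum_(0 <= i < N) a i * z ^+ i + a N * z ^+ N / (1 - r).
Proof.
move=> ha /andP[z0 z1] r01 a0 har; have /andP[r0 r1] := r01.
apply: limr_le; first by apply: ha; rewrite ger0_norm.
near=> n; rewrite /pseries /series /= (@big_cat_nat _ _ _ N 0 n) //=; last first.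
  by near: n; exact: nbhs_infty_ge.
rewrite lerD2l -{1}(add0n N) big_addn.
apply: (@le_trans _ _ (\sum_(0 <= k < n - N) a N * z ^+ N * r ^+ k)).
  apply: ler_sum => k _; elim: k => [|k IH]; first by rewrite add0n expr0 mulr1.
  rewrite addSn !exprS mulrA [leRHS]mulrCA.
  apply: (@le_trans _ _ (r * a (k + N)%N * z ^+ (k + N))).
    by rewrite ler_wpM2r ?exprn_ge0// har// leq_addl.
  by rewrite -mulrA ler_wpM2l.
by rewrite -mulr_sumr ler_wpM2l ?mulr_ge0 ?exprn_ge0// geometric_sum_le.
Unshelve. all: by end_near. Qed.

(** Carries the convergence condition along with the value, so that the coefficients of a
    differential expression are built by composing the three lemmas below. *)
Definition has_psum a z (S : R) := unit_radius a /\ S = psum a z.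

Lemma has_psumD a b z S T : `|z| < 1 -> has_psum a z S -> has_psum b z T ->
  has_psum (fun n => a n + b n) z (S + T).
Proof.
by move=> z1 [ha ->] [hb ->]; split; [exact: unit_radiusD|exact: psumD].
Qed.

Lemma has_psumZ k a z S : `|z| < 1 -> has_psum a z S ->
  has_psum (fun n => k * a n) z (k * S).
Proof. by move=> z1 [ha ->]; split; [exact: unit_radiusZ|exact: psumZ]. Qed.

Lemma has_psum_shift a z S : `|z| < 1 -> has_psum a z S ->
  has_psum (coef_shift a) z (z * S).
Proof.
by move=> z1 [ha ->]; split; [exact: unit_radius_shift|exact: psum_shift].
Qed.

End PowerSeries.

(** * Coefficients of the hypergeometric series *)

Section HypergeometricCoefficients.
Variable R : realType.
Implicit Types (a b c z : R).

Definition hyp_coef a b c (m : nat) : R :=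
  pochhammer a m * pochhammer b m / (pochhammer c m * m`!%:R).

Lemma hyp2F1E a b c z : hyp2F1 a b c z = psum (hyp_coef a b c) z.
Proof. by []. Qed.

Lemma pochhammerS a m : pochhammer a m.+1 = pochhammer a m * (a + m%:R).
Proof. by rewrite /pochhammer big_ord_recr. Qed.

Lemma pochhammer_gt0 a m : 0 < a -> 0 < pochhammer a m.
Proof.
by move=> a0; rewrite /pochhammer prodr_gt0// => i _; rewrite ltr_wpDr.
Qed.

Lemma hyp_coef0 a b c : hyp_coef a b c 0 = 1.
Proof. by rewrite /hyp_coef /pochhammer !big_ord0 fact0 !mul1r invr1. Qed.

Lemma hyp_coefS a b c m : 0 < c ->
  hyp_coef a b c m.+1 * ((c + m%:R) * m.+1%:R) =
  hyp_coef a b c m * ((a + m%:R) * (b + m%:R)).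
Proof.
move=> c0; rewrite /hyp_coef !pochhammerS factS natrM.
have := pochhammer_gt0 m c0 => p0; have cm : 0 < c + m%:R by rewrite ltr_wpDr.
by field; rewrite !gt_eqF ?ltr0n ?fact_gt0.
Qed.

Lemma hyp_coef_gt0 a b c m : 0 < a -> 0 < b -> 0 < c -> 0 < hyp_coef a b c m.
Proof.
by move=> a0 b0 c0; rewrite /hyp_coef divr_gt0 ?mulr_gt0 ?pochhammer_gt0// ltr0n fact_gt0.
Qed.

Lemma hyp_unit_radius a b c : 0 < c -> unit_radius (hyp_coef a b c).
Proof.
move=> c0; apply: unit_radius_ratio => r r1.
(* For m >= 1, (|a| + m)(|b| + m) <= m^2 + K m, which is at most r m^2 once m >= K / (r - 1). *)
pose K := `|a| + `|b| + `|a| * `|b|.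
pose N := (Num.bound (K / (r - 1))).+1.
have K0 : 0 <= K by rewrite /K !addr_ge0// mulr_ge0.
exists N => m Nm.
have hm : K / (r - 1) <= m%:R.
  apply: (@le_trans _ _ N%:R); last by rewrite ler_nat.
  apply: ltW; apply: (@lt_le_trans _ _ (Num.bound (K / (r - 1)))%:R).
    by apply: archi_boundP; rewrite divr_ge0// subr_ge0 ltW.
  by rewrite ler_nat.
have m0 : 0 <= m%:R :> R by [].
have cm : 0 < c + m%:R by rewrite ltr_wpDr.
have m1 : 1 <= m%:R :> R by rewrite ler1n (leq_trans _ Nm).
have d0 : 0 < (c + m%:R) * m.+1%:R by rewrite mulr_gt0.
rewrite -(ler_pM2r d0) -[in leLHS](ger0_norm (ltW d0)) -normrM hyp_coefS//.
move: (hyp_coef a b c m) => h; rewrite !normrM.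
rewrite [r * _]mulrC -[leRHS]mulrA ler_wpM2l//.
have hK : K <= m%:R * (r - 1) by rewrite -ler_pdivrMr// subr_gt0.
have ha : `|a + m%:R| <= `|a| + m%:R by rewrite (le_trans (ler_normD _ _))// normr_nat.
have hb : `|b + m%:R| <= `|b| + m%:R by rewrite (le_trans (ler_normD _ _))// normr_nat.
apply: (@le_trans _ _ ((`|a| + m%:R) * (`|b| + m%:R))).
  by rewrite ler_pM.
rewrite -natr1; have := normr_ge0 a; have := normr_ge0 b; rewrite /K in hK K0.
move: (`|a|) (`|b|) (m%:R : R) hK m1 => A B M hK m1 B0 A0 {ha hb hm m0 cm d0 Nm K0}.
have {}hK : (A + B + A * B) * M <= M * (r - 1) * M by rewrite ler_wpM2r//; lra.
have hB := mulr_ge0 A0 B0.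
have : A * B <= A * B * M by rewrite ler_peMr.
have : 0 <= c * r * (M + 1) by rewrite !mulr_ge0//; lra.
have : 0 <= r * M by rewrite mulr_ge0//; lra.
nra.
Qed.

End HypergeometricCoefficients.

Arguments hyp_unit_radius {R} a b {c} _.

(** * Differential equations and signs of the hypergeometric functions F and G *)

Section HypergeometricEquation.
Variable R : realType.
Implicit Types (a b c z : R).

Definition hyp_d a b c z : R := psum (pseries_diffs (hyp_coef a b c)) z.
Definition hyp_dd a b c z : R :=
  psum (pseries_diffs (pseries_diffs (hyp_coef a b c))) z.

Lemma is_derive_hyp a b c z : 0 < c -> `|z| < 1 ->
  is_derive z (1 : R) (hyp2F1 a b c) (hyp_d a b c z).
Proof. by move=> c0 z1; apply: psum_derive => //; exact: hyp_unit_radius. Qed.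

Lemma is_derive_hyp_d a b c z : 0 < c -> `|z| < 1 ->
  is_derive z (1 : R) (hyp_d a b c) (hyp_dd a b c z).
Proof.
by move=> c0 z1; apply: psum_derive => //; apply/unit_radius_diffs/hyp_unit_radius.
Qed.

Lemma hyp_at0 a b c : hyp2F1 a b c 0 = 1.
Proof. by rewrite hyp2F1E psum0 hyp_coef0. Qed.

(** The difference of the two sides is assembled as a single power series, and [hyp_coefS] makes
    each of its coefficients vanish. *)
Lemma hyp_ode a b c z : 0 < c -> `|z| < 1 ->
  z * (1 - z) * hyp_dd a b c z + (c - (a + b + 1) * z) * hyp_d a b c z
    = a * b * hyp2F1 a b c z.
Proof.
move=> c0 z1; apply/eqP; rewrite -subr_eq0; apply/eqP.
have h0 : has_psum (hyp_coef a b c) z (hyp2F1 a b c z).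
  by split => //; exact: hyp_unit_radius.
have h1 : has_psum (pseries_diffs (hyp_coef a b c)) z (hyp_d a b c z).
  by split => //; exact/unit_radius_diffs/hyp_unit_radius.
have h2 : has_psum (pseries_diffs (pseries_diffs (hyp_coef a b c))) z (hyp_dd a b c z).
  by split => //; exact/unit_radius_diffs/unit_radius_diffs/hyp_unit_radius.
have [_] := has_psumD z1 (has_psum_shift z1 h2)
  (has_psumD z1 (has_psumZ (-1) z1 (has_psum_shift z1 (has_psum_shift z1 h2)))
  (has_psumD z1 (has_psumZ c z1 h1)
  (has_psumD z1 (has_psumZ (- (a + b + 1)) z1 (has_psum_shift z1 h1))
   (has_psumZ (- (a * b)) z1 h0)))).
set S := (X in X = psum _ _) => hS; transitivity S; first by rewrite /S; ring.
rewrite hS -[RHS](psum_const 0 z); apply: psum_ext => {S hS}.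
have E m : hyp_coef a b c m.+1 * ((c + m%:R) * m.+1%:R) =
    hyp_coef a b c m * ((a + m%:R) * (b + m%:R)) by exact: hyp_coefS.
case=> [|[|m]]; rewrite /coef_shift /pseries_diffs.
- have := E 0%N; rewrite !addr0 !mulr1 => e; lra.
- by have := E 1%N => e; lra.
- by have := E m.+2; lra.
Qed.

(** For a = 1 the factor m + 1 cancels from the coefficient recurrence, which becomes that of a
    first-order equation; the inhomogeneous term c - 1 comes from the constant coefficient. *)
Lemma hyp1_ode b c z : 0 < c -> `|z| < 1 ->
  z * (1 - z) * hyp_d 1 b c z = (c - 1) - (c - 1 - b * z) * hyp2F1 1 b c z.
Proof.
move=> c0 z1; apply/eqP; rewrite -subr_eq opprK; apply/eqP.
have h0 : has_psum (hyp_coef 1 b c) z (hyp2F1 1 b c z).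
  by split => //; exact: hyp_unit_radius.
have h1 : has_psum (pseries_diffs (hyp_coef 1 b c)) z (hyp_d 1 b c z).
  by split => //; exact/unit_radius_diffs/hyp_unit_radius.
have [_] := has_psumD z1 (has_psum_shift z1 h1)
  (has_psumD z1 (has_psumZ (-1) z1 (has_psum_shift z1 (has_psum_shift z1 h1)))
  (has_psumD z1 (has_psumZ (c - 1) z1 h0)
  (has_psumZ (- b) z1 (has_psum_shift z1 h0)))).
set S := (X in X = psum _ _) => hS; transitivity S; first by rewrite /S; ring.
rewrite hS -[RHS](psum_const (c - 1) z); apply: psum_ext => {S hS}.
have E m : hyp_coef 1 b c m.+1 * (c + m%:R) = hyp_coef 1 b c m * (b + m%:R).
  have /eqP := hyp_coefS 1 b m c0; rewrite mulrA [1 + _]addrC natr1 [(m.+1%:R) * _]mulrC mulrA.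
  by rewrite (inj_eq (mulIf _)) ?pnatr_eq0// => /eqP.
case=> [|[|m]]; rewrite /coef_shift /pseries_diffs.
- by rewrite hyp_coef0; ring.
- by have := E 0%N; rewrite !addr0 => e; lra.
- by have := E m.+1; lra.
Qed.

Lemma hyp_gt0 a b c z : 0 < a -> 0 < b -> 0 < c -> 0 <= z < 1 -> 1 <= hyp2F1 a b c z.
Proof.
move=> a0 b0 c0 z01; rewrite hyp2F1E.
have := @psum_ge_partial _ _ z 1 (hyp_unit_radius a b c0) z01
  (fun m _ => ltW (hyp_coef_gt0 m a0 b0 c0)).
by rewrite big_nat1 hyp_coef0 expr0 mulr1.
Qed.

Lemma hyp_d_gt0 a b c z : 0 < a -> 0 < b -> 0 < c -> 0 <= z < 1 -> 0 < hyp_d a b c z.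
Proof.
move=> a0 b0 c0 z01.
have h := @psum_ge_partial _ _ z 1 (unit_radius_diffs (hyp_unit_radius a b c0)) z01.
apply: lt_le_trans (h _).
  by rewrite big_nat1 expr0 mulr1 /pseries_diffs mulr_gt0// hyp_coef_gt0.
by move=> m _; rewrite /pseries_diffs mulr_ge0// ltW// hyp_coef_gt0.
Qed.

(** Among the factors -1/2 + m only the one with m = 0 is negative. Hence F decreases, and its
    partial sums bound it from above. *)
Lemma hyp_coef_half_lt0 a c m : 0 < a -> 0 < c -> hyp_coef a (- (1 / 2)) c m.+1 < 0.
Proof.
move=> a0 c0; elim: m => [|m IH].
  have := hyp_coefS a (- (1 / 2)) 0 c0.
  by rewrite hyp_coef0 !addr0 => e; nra.
have := hyp_coefS a (- (1 / 2)) m.+1 c0.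
have m0 : 1 <= m.+1%:R :> R by rewrite ler1n.
have p1 : 0 < (a + m.+1%:R) * (- (1 / 2) + m.+1%:R) by rewrite mulr_gt0//; lra.
have p2 : 0 < (c + m.+1%:R) * m.+2%:R by rewrite mulr_gt0//; lra.
move=> e; rewrite -(pmulr_llt0 _ p2) e pmulr_llt0//.
Qed.

Lemma hyp_d_half_lt0 a c z : 0 < a -> 0 < c -> 0 <= z < 1 ->
  hyp_d a (- (1 / 2)) c z < 0.
Proof.
move=> a0 c0 z01; rewrite -oppr_gt0 -mulN1r /hyp_d psumZ; last 2 first.
- exact/unit_radius_diffs/hyp_unit_radius.
- by rewrite ger0_norm; move/andP: z01 => [].
have h := @psum_ge_partial _ (fun n => -1 * pseries_diffs (hyp_coef a (- (1 / 2)) c) n) z 1 _ z01.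
apply: lt_le_trans (h _ _).
- rewrite big_nat1 expr0 mulr1 /pseries_diffs mulN1r oppr_gt0 pmulr_rlt0//.
  exact: hyp_coef_half_lt0.
- exact/unit_radiusZ/unit_radius_diffs/hyp_unit_radius.
- move=> m _; rewrite /pseries_diffs mulN1r oppr_ge0 mulr_ge0_le0//.
  exact/ltW/hyp_coef_half_lt0.
Qed.

End HypergeometricEquation.

(** * Derivative rules and comparison principles in one variable *)

Section Comparison.
Variable R : realType.

Lemma is_derive_eq_val (f : R -> R) (x d d' : R) : is_derive x (1 : R) f d -> d = d' ->
  is_derive x (1 : R) f d'.
Proof. by move=> + <-. Qed.

Lemma is_derive_ext (f g : R -> R) (x d : R) : is_derive x (1 : R) f d -> f =1 g ->
  is_derive x (1 : R) g d.
Proof. by move=> + /funext <-. Qed.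

Lemma is_derive_continuous (f : R -> R) (x d : R) : is_derive x (1 : R) f d ->
  {for x, continuous f}.
Proof. by case=> h _; apply/differentiable_continuous/derivable1_diffP. Qed.

Lemma is_derive_mul (f g : R -> R) (x d e : R) : is_derive x (1 : R) f d ->
  is_derive x (1 : R) g e -> is_derive x (1 : R) (fun y => f y * g y) (d * g x + f x * e).
Proof.
move=> hf hg; apply: is_derive_eq_val (is_deriveM hf hg) _.
by rewrite -![_ *: _]/(_ * _); ring.
Qed.

Lemma is_derive_add (f g : R -> R) (x d e : R) : is_derive x (1 : R) f d ->
  is_derive x (1 : R) g e -> is_derive x (1 : R) (fun y => f y + g y) (d + e).
Proof. by move=> hf hg; exact: is_deriveD. Qed.

Lemma is_derive_sub (f g : R -> R) (x d e : R) : is_derive x (1 : R) f d ->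
  is_derive x (1 : R) g e -> is_derive x (1 : R) (fun y => f y - g y) (d - e).
Proof. by move=> hf hg; exact: is_deriveB. Qed.

Lemma is_derive_inv (f : R -> R) (x d : R) : is_derive x (1 : R) f d -> f x != 0 ->
  is_derive x (1 : R) (fun y => (f y)^-1) (- d / f x ^+ 2).
Proof.
move=> hf f0; apply: is_derive_eq_val (is_deriveV f0 hf) _.
by rewrite -[_ *: _]/(_ * _) mulNr mulrC -mulNr.
Qed.

Lemma is_derive_compose (f g : R -> R) (x d e : R) : is_derive x (1 : R) g e ->
  is_derive (g x) (1 : R) f d -> is_derive x (1 : R) (fun y => f (g y)) (d * e).
Proof. by move=> hg hf; exact: (@is_derive1_comp _ f g x d e hf hg). Qed.

Lemma is_derive_const (k x : R) : is_derive x (1 : R) (fun _ : R => k) 0.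
Proof. exact: is_derive_cst. Qed.

Lemma is_derive_ident (x : R) : is_derive x (1 : R) (fun y : R => y) 1.
Proof. exact: is_derive_id. Qed.

Lemma nondecreasing_derive (f f1 : R -> R) (a b : R) : a <= b ->
  (forall s : R, a <= s <= b -> is_derive s (1 : R) f (f1 s)) ->
  (forall s : R, a < s < b -> 0 <= f1 s) -> f a <= f b.
Proof.
move=> ab hf h0.
have [e|c0] := eqVneq a b; first by rewrite e.
have [|||c cab e] := @MVT _ f f1 a b.
- by rewrite lt_neqAle c0.
- by move=> s; rewrite in_itv /= => /andP[h1 h2]; apply: hf; rewrite !ltW.
- by apply: derivable_within_continuous => s; rewrite in_itv /= => /hf[].
by rewrite -subr_ge0 e mulr_ge0 ?subr_ge0// h0.
Qed.

Lemma weight_derive (c f s : R) : 0 < s < 1 ->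
  is_derive s (1 : R) (fun y : R => y `^ c * (1 - y) `^ f)
    (s `^ c * (1 - s) `^ f * (c / s - f / (1 - s))).
Proof.
move=> /andP[s0 s1]; have u0 : 0 < 1 - s by rewrite subr_gt0.
have h1 : is_derive s (1 : R) (fun y : R => y `^ c) (c * s `^ (c - 1)).
  exact: is_derive1_powR.
have h2 : is_derive (1 - s) (1 : R) (fun y : R => y `^ f) (f * (1 - s) `^ (f - 1)).
  exact: is_derive1_powR.
have h3 := is_derive_compose (is_derive_sub (is_derive_const 1 s) (is_derive_ident s)) h2.
apply: is_derive_eq_val (is_derive_mul h1 h3) _.
have pw (y p : R) : 0 < y -> y `^ (p - 1) = y `^ p / y.
  by move=> y0; rewrite powRB ?powRr1 ?(ltW y0)// (gt_eqF y0) implybT.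
rewrite !pw//.
by field; rewrite !gt_eqF.
Qed.

(* The integrating factor is s^c (1 - s)^(e - c), which vanishes at 0. *)
Lemma weighted_sign (W W1 : R -> R) (c e s1 : R) : 0 < c -> 0 < s1 < 1 ->
  (forall s : R, 0 <= s <= s1 -> is_derive s (1 : R) W (W1 s)) ->
  (forall s : R, 0 < s < s1 -> 0 <= s * (1 - s) * W1 s + (c - e * s) * W s) ->
  0 <= W s1.
Proof.
move=> c0 /andP[s0 s1lt] hW hp.
pose E (s : R) := s `^ c * (1 - s) `^ (e - c).
pose f (s : R) := E s * W s.
pose f1 (s : R) := E s * W1 s + W s * (E s * (c / s - (e - c) / (1 - s))).
have df (s : R) : 0 < s <= s1 -> is_derive s (1 : R) f (f1 s).
  move=> /andP[h1 h2]; have h3 : 0 < s < 1 by rewrite h1 (le_lt_trans h2).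
  apply: is_derive_eq_val (is_derive_mul (weight_derive c (e - c) h3) (hW s _)) _.
    by rewrite ltW.
  by rewrite /f1 /E; ring.
have E0 (s : R) : 0 <= E s by rewrite mulr_ge0// powR_ge0.
have f10 (s : R) : 0 < s < s1 -> 0 <= f1 s.
  move=> /andP[h1 h2]; have u0 : 0 < 1 - s by rewrite subr_gt0 (lt_trans h2).
  have -> : f1 s = E s * (s * (1 - s) * W1 s + (c - e * s) * W s) / (s * (1 - s)).
    by rewrite /f1; field; rewrite !gt_eqF.
  have := hp s; rewrite h1 h2 => /(_ isT) h.
  by apply: divr_ge0; [exact: mulr_ge0|apply: mulr_ge0; exact: ltW].
(* [W 0] has no prescribed sign and the derivative of [f] is known only for s > 0; since c > 0, the
   factor s^c forces the limit 0. *)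
have lim0 : f s @[s --> 0^'+] --> 0.
  suff : f s @[s --> 0^'+] --> 0 * ((1 - 0) `^ (e - c) * W 0) by rewrite mul0r.
  rewrite (_ : f = (fun s => s `^ c * ((1 - s) `^ (e - c) * W s))); last first.
    by apply/funext => s; rewrite /f /E mulrA.
  apply: cvgM; first exact: powR_cvg0.
  apply: cvg_at_right_filter; apply: cvgM; last first.
    by have := is_derive_continuous (hW 0 _); apply; rewrite lexx ltW.
  have h2 : is_derive (1 - 0 : R) (1 : R) (fun y : R => y `^ (e - c)) ((e - c) * (1 - 0) `^ (e - c - 1)).
    by apply: is_derive1_powR; rewrite subr0.
  exact: is_derive_continuous
    (is_derive_compose (is_derive_sub (is_derive_const 1 0) (is_derive_ident 0)) h2).
have fs1 : 0 <= f s1.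
  apply: (cvgr_to_le lim0).
  near=> s; have s0' : 0 < s by near: s; exact: nbhs_right_gt.
  have ss1 : s < s1 by near: s; exact: nbhs_right_lt.
  apply: (@nondecreasing_derive f f1) => [|y /andP[y1 y2]|y /andP[y1 y2]].
  - exact: ltW.
  - by apply: df; rewrite (lt_le_trans s0').
  - by apply: f10; rewrite (lt_trans s0').
have Es1 : 0 < E s1 by rewrite mulr_gt0// powR_gt0// subr_gt0.
by rewrite -(pmulr_rge0 _ Es1).
Unshelve. all: by end_near. Qed.

(** At the last point z before s where f >= 0, f vanishes and is negative just after, against f'(z)
    > 0. The derivative is thus controlled only at the zeros of f. *)
Lemma barrier (f f1 : R -> R) (a s1 : R) : a < s1 ->
  (forall s : R, a <= s < s1 -> is_derive s (1 : R) f (f1 s)) -> 0 <= f a ->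
  (forall s : R, a <= s < s1 -> f s = 0 -> 0 < f1 s) ->
  forall s : R, a <= s < s1 -> 0 <= f s.
Proof.
move=> as1 hf fa hz s /andP[as_ ss1]; rewrite leNgt; apply/negP => fs.
pose A := [set y | a <= y <= s /\ 0 <= f y].
have Aa : A a by split => //; rewrite lexx.
have hs : has_sup A by split; [exists a|exists s => y [/andP[]]].
pose z := sup A.
have az : a <= z by exact: ub_le_sup hs.2 _ Aa.
have zs : z <= s by apply: ge_sup => [|y [/andP[]]//]; exists a.
have cz y : a <= y <= s -> {for y, continuous f}.
  move=> /andP[h1 h2]; apply: is_derive_continuous (hf y _).
  by rewrite h1 (le_lt_trans h2).
have fz0 : 0 <= f z.
  rewrite leNgt; apply/negP => fz.
  have := cz z; rewrite az zs => /(_ isT) /cvgr_lt /(_ _ fz).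
  move=> /nbhs_ballP[e /= e0 he].
  have [y [/andP[ay ys] fy] yz] := sup_adherent e0 hs.
  have yz' : y <= z by apply: ub_le_sup hs.2 _ _; split => //; rewrite ay ys.
  have : f y < 0 by apply: he; rewrite /ball /= ger0_norm ?subr_ge0// ltrBlDr -ltrBlDl.
  by rewrite ltNge fy.
have zs' : z < s by rewrite lt_neqAle zs andbT; apply: contraTneq fz0 => ->; rewrite -ltNge.
have neg y : z < y <= s -> f y < 0.
  move=> /andP[zy ys]; rewrite ltNge; apply/negP => fy.
  have : y <= z by apply: ub_le_sup hs.2 _ _; split => //; rewrite ys (le_trans az (ltW zy)).
  by rewrite leNgt zy.
have z1 : a <= z < s1 by rewrite az (lt_trans zs').
have dz := hf z z1.
have fz : f z = 0.
  apply/eqP; rewrite eq_le fz0 andbT leNgt; apply/negP => fz.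
  have := is_derive_continuous dz => /cvgr_gt /(_ _ fz) /nbhs_ballP[e /= e0 he].
  pose y := Num.min s (z + e / 2).
  have zy : z < y by rewrite /y lt_min zs' ltrDl divr_gt0.
  have ys : y <= s by rewrite /y ge_min lexx.
  have ye : y <= z + e / 2 by rewrite /y ge_min lexx orbT.
  have := neg y; rewrite zy ys => /(_ isT); rewrite ltNge; apply/negP/negPn/ltW.
  by apply: he; rewrite /ball /= distrC ger0_norm ?subr_ge0 1?ltW//; lra.
have := hz z z1 fz; case: dz => dz dzE; rewrite -dzE => pos.
have /cvgr_gt /(_ _ pos) : (h^-1 *: (f (h *: (1 : R) + z) - f z)) @[h --> 0^'] --> 'D_1 f z.
  exact: dz.
move=> /nbhs_ballP[e /= e0 he].
pose h := Num.min (s - z) (e / 2).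
have h0 : 0 < h by rewrite /h lt_min subr_gt0 zs' divr_gt0.
have hs' : h <= s - z by rewrite /h ge_min lexx.
have he' : h <= e / 2 by rewrite /h ge_min lexx orbT.
have := he h; rewrite /ball /= sub0r normrN gtr0_norm// => /(_ _ _).
rewrite fz subr0 -[_ *: _]/(_ * _) -[h *: _]/(h * 1) mulr1 pmulr_rgt0 ?invr_gt0//.
move=> /(_ _ (lt0r_neq0 h0)) fh.
have : f (h + z) < 0 by apply: neg; apply/andP; split; lra.
by rewrite ltNge ltW// fh//; lra.
Qed.

End Comparison.

(** * Upper bounds for the zero of F *)

Section FirstZero.
Variable R : realType.
Implicit Types (a b c s tau sigma : R).

Local Notation F a c := (hyp2F1 a (- (1 / 2)) c).

Lemma itv01_norm s : 0 <= s < 1 -> `|s| < 1.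
Proof. by move=> /andP[s0 s1]; rewrite ger0_norm. Qed.

Lemma hyp_half_decr a c s s' : 0 < a -> 0 < c -> 0 <= s < s' -> s' < 1 ->
  F a c s' < F a c s.
Proof.
move=> a0 c0 /andP[s0 ss'] s1.
have [|||z /itvP zi e] := @MVT _ (F a c) (hyp_d a (- (1 / 2)) c) s s'.
- by [].
- move=> x /itvP xi; apply: is_derive_hyp => //; apply: itv01_norm.
  by rewrite (le_trans s0) ?xi// (lt_trans _ s1)// xi.
- apply: derivable_within_continuous => x /itvP xi.
  have n1 : `|x| < 1.
    apply: itv01_norm.
    by rewrite (le_trans s0) ?xi// (le_lt_trans _ s1)// xi.
  by have [] := is_derive_hyp a (- (1 / 2)) c0 n1.
rewrite -subr_lt0 e nmulr_rlt0 ?subr_gt0//; apply: hyp_d_half_lt0 => //.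
by rewrite (le_trans s0) ?xi// ?zi// (lt_trans _ s1)// zi.
Qed.

(** If F(s1) > 0, then F > 0 on [0, s1] by monotonicity. The Wronskian W = F Phi' - Phi F' satisfies
    s (1 - s) W' + (c - (a + 1/2) s) W = F L Phi >= 0 because L F = 0, so W(s1) >= 0 by
    [weighted_sign]; yet W(s1) = F(s1) Phi'(s1) < 0. *)
Lemma hyp_zero_comparison a c s1 (Phi Phi1 Phi2 : R -> R) :
  0 < a -> 0 < c -> 0 < s1 < 1 ->
  (forall s, 0 <= s <= s1 -> is_derive s (1 : R) Phi (Phi1 s)) ->
  (forall s, 0 <= s <= s1 -> is_derive s (1 : R) Phi1 (Phi2 s)) ->
  (forall s, 0 < s < s1 ->
     0 <= s * (1 - s) * Phi2 s + (c - (a + 1 / 2) * s) * Phi1 s + a / 2 * Phi s) ->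
  Phi s1 = 0 -> Phi1 s1 < 0 -> F a c s1 <= 0.
Proof.
move=> a0 c0 s01 h1 h2 hL e1 e2; rewrite leNgt; apply/negP => Fp.
have /andP[s0 s1lt] := s01.
pose F1 := hyp_d a (- (1 / 2)) c.
pose W s := F a c s * Phi1 s - Phi s * F1 s.
have n1 s : 0 <= s <= s1 -> `|s| < 1.
  by move=> /andP[u1 u2]; rewrite itv01_norm// u1 (le_lt_trans u2).
have dW s : 0 <= s <= s1 -> is_derive s (1 : R) W
  ((F1 s * Phi1 s + F a c s * Phi2 s) -
   (Phi1 s * F1 s + Phi s * hyp_dd a (- (1 / 2)) c s)).
  move=> hs; apply: is_derive_sub; apply: is_derive_mul.
  - exact/is_derive_hyp/n1.
  - exact: h2.
  - exact: h1.
  - exact/is_derive_hyp_d/n1.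
have := weighted_sign (c := c) (e := a + 1 / 2) c0 s01 dW.
rewrite /W e1 mul0r subr0 => h.
suff : 0 <= F a c s1 * Phi1 s1 by rewrite pmulr_rge0// leNgt e2.
apply: h => s /andP[u1 u2].
have s01' : 0 <= s <= s1 by rewrite !ltW.
have := hyp_ode a (- (1 / 2)) c0 (n1 s s01'); have := hL s.
rewrite u1 u2 => /(_ isT).
have Fs : 0 < F a c s.
  by apply: lt_trans Fp _; apply: hyp_half_decr => //; rewrite ltW.
rewrite -/F1; move: (hyp_dd _ _ _ _) (F1 s) (F a c s) Fs (Phi1 s) (Phi2 s) (Phi s).
move=> y2 y1 y0 y00 p1 p2 p0 hp hy.
rewrite (_ : _ + _ = y0 * (s * (1 - s) * p2 + (c - (a + 1 / 2) * s) * p1 + a / 2 * p0)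
  - p0 * (s * (1 - s) * y2 + (c - (a + - (1 / 2) + 1) * s) * y1 - a * - (1 / 2) * y0)); last by field.
by rewrite hy subrr mulr0 subr0 mulr_ge0// ltW.
Qed.

(* The test function is (tau - s)^(-1/2) (sigma - s). *)
Lemma hyp_half_le0 a c tau sigma : 0 < a -> 0 < c -> 0 < sigma < 1 -> 1 <= tau ->
  (forall s, 0 < s < sigma ->
     0 <= s * (1 - s) * (3 * (sigma - s) - 4 * (tau - s)) +
          (c - (a + 1 / 2) * s) * (2 * (sigma - s) * (tau - s) - 4 * (tau - s) ^+ 2)
          + 2 * a * (sigma - s) * (tau - s) ^+ 2) ->
  F a c sigma <= 0.
Proof.
move=> a0 c0 s01 tau1 hp; have /andP[s0 s1] := s01.
pose v s := (tau - s) `^ (- (1 / 2)).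
pose Phi s := v s * (sigma - s).
pose Phi1 s := v s * ((sigma - s) / (2 * (tau - s)) - 1).
pose Phi2 s := v s * (3 * (sigma - s) / (4 * (tau - s) ^+ 2) - (tau - s)^-1).
have w0 s : 0 <= s <= sigma -> 0 < tau - s by move=> /andP[]; lra.
have dl (k s : R) : is_derive s (1 : R) (fun y => k - y) (0 - 1).
  exact: is_derive_sub (is_derive_const _ _) (is_derive_ident _).
have dv s : 0 <= s <= sigma -> is_derive s (1 : R) v (v s / (2 * (tau - s))).
  move=> /w0 ws; have h : is_derive (tau - s) (1 : R) (fun y : R => y `^ (- (1 / 2)))
    (- (1 / 2) * (tau - s) `^ (- (1 / 2) - 1)) by exact: is_derive1_powR.
  apply: is_derive_eq_val (is_derive_compose (dl tau s) h) _.
  rewrite powRB ?(gt_eqF ws) ?implybT// powRr1 ?(ltW ws)// -/(v s).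
  by field; rewrite gt_eqF.
have d1 s : 0 <= s <= sigma -> is_derive s (1 : R) Phi (Phi1 s).
  move=> hs; apply: is_derive_eq_val (is_derive_mul (dv s hs) (dl sigma s)) _.
  by rewrite /Phi1; field; rewrite gt_eqF// w0.
have d2 s : 0 <= s <= sigma -> is_derive s (1 : R) Phi1 (Phi2 s).
  move=> hs; have ws := w0 s hs.
  have ws' : 2 * (tau - s) != 0 by rewrite gt_eqF// mulr_gt0.
  have h := is_derive_mul (dl sigma s)
    (is_derive_inv (is_derive_mul (is_derive_const 2 s) (dl tau s)) ws').
  apply: is_derive_eq_val (is_derive_mul (dv s hs) (is_derive_sub h (is_derive_const 1 s))) _.
  by rewrite /Phi2; field; rewrite gt_eqF.
apply: (hyp_zero_comparison a0 c0 s01 d1 d2).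
- move=> s /andP[u1 u2]; have hs : 0 <= s <= sigma by rewrite !ltW.
  have ws := w0 s hs; have v0 : 0 <= v s by exact: powR_ge0.
  have := hp s; rewrite u1 u2 => /(_ isT) /= h.
  (* The polynomial in the hypothesis is L Phi multiplied by 4 (tau - s)^(5/2). *)
  have -> : s * (1 - s) * Phi2 s + (c - (a + 1 / 2) * s) * Phi1 s + a / 2 * Phi s =
    v s / (4 * (tau - s) ^+ 2) * (s * (1 - s) * (3 * (sigma - s) - 4 * (tau - s)) +
    (c - (a + 1 / 2) * s) * (2 * (sigma - s) * (tau - s) - 4 * (tau - s) ^+ 2)
    + 2 * a * (sigma - s) * (tau - s) ^+ 2).
    by rewrite /Phi2 /Phi1 /Phi; field; rewrite gt_eqF.
  by rewrite mulr_ge0// divr_ge0// mulr_ge0// sqr_ge0.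
- by rewrite /Phi subrr mulr0.
- rewrite /Phi1 subrr mul0r sub0r mulrN1 oppr_lt0 powR_gt0//.
  by apply: w0; rewrite lexx ltW.
Qed.

Lemma hyp_zero_le a c s0 sigma : 0 < a -> 0 < c -> 0 < s0 < 1 -> F a c s0 = 0 ->
  0 < sigma < 1 -> F a c sigma <= 0 -> s0 <= sigma.
Proof.
move=> a0 c0 /andP[h0 h1] e /andP[g0 g1] Fs; rewrite leNgt; apply/negP => lt.
have := @hyp_half_decr a c sigma s0 a0 c0; rewrite lt ltW// => /(_ isT h1).
by rewrite e ltNge Fs.
Qed.

(** The value of [sg] makes the constant term of the bracket vanish. The remaining coefficient of s,
    multiplied by a + c, is 2 (a - c)(a - c - 1), nonnegative because c + 1 <= a. *)
Lemma test_linear_ge0 a c sg s : 0 < a + c -> sg * (a + c) = 2 * c -> c + 1 <= a ->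
  0 <= s <= 1 ->
  0 <= s * (1 - s) * (3 * (sg - s) - 4 * (1 - s)) +
    (c - (a + 1 / 2) * s) * (2 * (sg - s) * (1 - s) - 4 * (1 - s) ^+ 2) +
    2 * a * (sg - s) * (1 - s) ^+ 2.
Proof.
move=> ac esg ca /andP[s0 s1].
have -> : s * (1 - s) * (3 * (sg - s) - 4 * (1 - s)) +
    (c - (a + 1 / 2) * s) * (2 * (sg - s) * (1 - s) - 4 * (1 - s) ^+ 2) +
    2 * a * (sg - s) * (1 - s) ^+ 2 =
  (1 - s) * (s * (2 * a - 2 + 2 * c - sg * (4 * a - 2)) + 2 * (sg * (a + c) - 2 * c)).
  by field.
rewrite esg subrr mulr0 addr0 mulr_ge0 ?subr_ge0// mulr_ge0//.
rewrite -(pmulr_lge0 _ ac) mulrBl mulrAC esg.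
have : 0 <= (a - c) * (a - c - 1) by rewrite mulr_ge0//; lra.
by lra.
Qed.

Lemma hyp_zero_bound a c s0 : 0 < c -> c + 1 <= a -> 0 < s0 < 1 -> F a c s0 = 0 ->
  s0 <= 2 * c / (a + c).
Proof.
move=> c0 ca s01 e; have a0 : 0 < a by lra.
have ac : 0 < a + c by lra.
set sg := 2 * c / (a + c).
have esg : sg * (a + c) = 2 * c by rewrite /sg divfK// gt_eqF.
have sg01 : 0 < sg < 1.
  by rewrite /sg divr_gt0 ?mulr_gt0//= ltr_pdivrMr//; lra.
apply: (hyp_zero_le a0 c0 s01 e sg01).
apply: (@hyp_half_le0 a c 1 sg a0 c0 sg01 (lexx _)) => s /andP[u1 u2].
have /andP[v1 v2] := sg01.
apply: (@test_linear_ge0 a c sg s) => //; lra.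
Qed.

(** This is the polynomial of [hyp_half_le0] at a = b + 3/2, c = b + 1, tau = 1 + e, sigma = 1 - dl,
    s = 1 - u. The two relations eliminate b and leave a quadratic in u. *)
Lemma last_quadratic_ge0 b e dl u : 0 < e <= 1 / 36 -> 3 / 2 * e <= dl <= 157 / 100 * e ->
  e * b = 1 / 12 -> dl * b = (1 + dl) / 8 -> 0 < u ->
  0 <= (1 - u) * (1 - (1 - u)) * (3 * (1 - dl - (1 - u)) - 4 * (1 + e - (1 - u))) +
  (b + 1 - (b + 3 / 2 + 1 / 2) * (1 - u)) *
  (2 * (1 - dl - (1 - u)) * (1 + e - (1 - u)) - 4 * (1 + e - (1 - u)) ^+ 2) +
  2 * (b + 3 / 2) * (1 - dl - (1 - u)) * (1 + e - (1 - u)) ^+ 2.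
Proof.
move=> /andP[e0 e36] /andP[dle dle'] eb db u0.
set A := 1 / 3 - 9 / 2 * dl - 2 * e.
set B := 13 / 12 * e - dl - 43 / 4 * e * dl - 5 * e ^+ 2.
set C := 4 * e ^+ 2 + 11 / 6 * e * dl - 3 * dl * e ^+ 2.
have -> : (1 - u) * (1 - (1 - u)) * (3 * (1 - dl - (1 - u)) - 4 * (1 + e - (1 - u))) +
  (b + 1 - (b + 3 / 2 + 1 / 2) * (1 - u)) *
  (2 * (1 - dl - (1 - u)) * (1 + e - (1 - u)) - 4 * (1 + e - (1 - u)) ^+ 2) +
  2 * (b + 3 / 2) * (1 - dl - (1 - u)) * (1 + e - (1 - u)) ^+ 2 =
  A * u ^+ 2 + B * u + C
   - (u ^+ 2 * (4 * (dl * b - (1 + dl) / 8) + 2 * (e * b - 1 / 12))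
      + u * (2 * e * (e * b - 1 / 12) + 6 * e * (dl * b - (1 + dl) / 8))
      + 2 * dl * e * (e * b - 1 / 12)).
  by rewrite /A /B /C; field.
rewrite eb db !subrr !mulr0 !addr0 !mulr0 !addr0 subr0.
(* These bounds suffice: 8/100 u^2 - 11/10 e u + 66/10 e^2 has negative discriminant. *)
have hA : 8 / 100 <= A by rewrite /A; lra.
have hB : - (11 / 10) * e <= B by rewrite /B; nra.
have hC : 66 / 10 * e ^+ 2 <= C by rewrite /C; nra.
have : 8 / 100 * u ^+ 2 <= A * u ^+ 2 by rewrite ler_wpM2r// sqr_ge0.
have : - (11 / 10) * e * u <= B * u by rewrite ler_wpM2r// ltW.
have : 0 <= 8 / 100 * u ^+ 2 - 11 / 10 * e * u + 66 / 10 * e ^+ 2.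
  by have := sqr_ge0 (u - 55 / 8 * e); nra.
by move: (A * _) (B * _) => X Y; lra.
Qed.

Lemma hyp_zero_bound_last b s0 : 3 <= b -> 0 < s0 < 1 ->
  F (b + 3 / 2) (b + 1) s0 = 0 -> (8 * b - 1)^-1 <= 1 - s0.
Proof.
move=> b3 s01 e0; have a0 : 0 < b + 3 / 2 by lra.
have c0 : 0 < b + 1 by lra.
(* 1 / (8 b - 1) is the lower bound on u = 1 - s0 from which [core_last] derives 1 + 4 u^2 <= 8 b u;
   e = tau - 1 is the slight shift of the singularity past 1. *)
set dl := (8 * b - 1)^-1; pose e := (12 * b)^-1.
have edl : dl * (8 * b - 1) = 1 by rewrite mulVf// gt_eqF//; lra.
have ee : e * (12 * b) = 1 by rewrite mulVf// gt_eqF//; lra.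
have e00 : 0 < e by rewrite invr_gt0; lra.
have d00 : 0 < dl by rewrite invr_gt0; lra.
have e36 : e <= 1 / 36 by nra.
have d23 : dl <= 1 / 23 by nra.
have de : 3 * e = dl * (2 - 3 * e) by nra.
have dle : 3 / 2 * e <= dl by nra.
have dle' : dl <= 157 / 100 * e by nra.
suff : s0 <= 1 - dl by lra.
have sg01 : 0 < 1 - dl < 1 by apply/andP; split; lra.
apply: (hyp_zero_le a0 c0 s01 e0 sg01).
apply: (@hyp_half_le0 _ _ (1 + e) (1 - dl) a0 c0 sg01); first lra.
move=> s /andP[u1 u2].
have -> : s = 1 - (1 - s) by ring.
have u0 : 0 < 1 - s by lra.
move: (1 - s) u0 => u u0; apply: last_quadratic_ge0 => //; lra.
Qed.

End FirstZero.

(** * Numerical inequalities for the logarithmic test function *)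

Section LogBarrier.
Variable R : realType.
Implicit Types (b c s x q l z X w t : R).

Lemma ln_le_subr1 (y : R) : 0 < y -> ln y <= y - 1.
Proof.
by move=> y0; have := @le_ln1Dx R (y - 1); rewrite addrCA subrr addr0; apply; lra.
Qed.

(** This is log y >= 2 (y - 1) / (y + 1) at y = (k + 1) / k; the difference of the two sides has
    derivative (y - 1)^2 / (y (y + 1)^2). *)
Lemma ln_succ_ge (k : R) : 0 < k -> 2 / (2 * k + 1) <= ln (k + 1) - ln k.
Proof.
move=> k0; pose f (y : R) := ln y + 4 / (y + 1).
have d (y : R) : 1 <= y -> is_derive y (1 : R) f (y^-1 - 4 / (y + 1) ^+ 2).
  move=> h; have y0 : 0 < y by lra.
  have y10 : y + 1 != 0 by rewrite gt_eqF//; lra.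
  have h1 := is_derive_inv (is_derive_add (is_derive_ident y) (is_derive_const 1 y)) y10.
  apply: is_derive_eq_val
    (is_derive_add (is_derive1_ln y0) (is_derive_mul (is_derive_const 4 y) h1)) _.
  by field; rewrite y10 gt_eqF.
have y1 : 1 <= (k + 1) / k by rewrite ler_pdivlMr// mul1r lerDl.
have : f 1 <= f ((k + 1) / k).
  apply: (nondecreasing_derive y1) => s /andP[h _]; first exact: d.
  have s0 : 0 < s by lra.
  have -> : s^-1 - 4 / (s + 1) ^+ 2 = (s - 1) ^+ 2 / (s * (s + 1) ^+ 2).
    by field; rewrite !gt_eqF//; lra.
  by rewrite divr_ge0 ?sqr_ge0// mulr_ge0 ?sqr_ge0// ltW.
rewrite /f ln1 ln_div ?posrE//; last by lra.
have -> : 2 / (2 * k + 1) = 2 - 4 / ((k + 1) / k + 1) :> R.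
  by field; rewrite !gt_eqF//; lra.
have -> : 4 / (1 + 1) = 2 :> R by field.
by rewrite add0r; move: (4 / _) (ln _) (ln _) => *; lra.
Qed.

Lemma ln2_ge : 69 / 100 <= ln 2 :> R.
Proof.
(* Writing 2 = 8 / 4 and telescoping, 2/9 + 2/11 + 2/13 + 2/15 > 69/100. *)
have -> : ln 2 = ln (4 + 1 + 1 + 1 + 1) - ln 4 :> R.
  by rewrite -ln_div ?posrE//; congr ln; field.
have p4 : 0 < 4 :> R by [].
have p5 : 0 < 4 + 1 :> R by lra.
have p6 : 0 < 4 + 1 + 1 :> R by lra.
have p7 : 0 < 4 + 1 + 1 + 1 :> R by lra.
have := ln_succ_ge p4; have := ln_succ_ge p5; have := ln_succ_ge p6; have := ln_succ_ge p7.
have -> : 2 * 4 + 1 = 9 :> R by ring.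
have -> : 2 * (4 + 1) + 1 = 11 :> R by ring.
have -> : 2 * (4 + 1 + 1) + 1 = 13 :> R by ring.
have -> : 2 * (4 + 1 + 1 + 1) + 1 = 15 :> R by ring.
by move: (ln (4 + 1 + 1 + 1 + 1)) (ln (4 + 1 + 1 + 1)) (ln (4 + 1 + 1)) (ln (4 + 1)) (ln 4) => *; lra.
Qed.

Lemma ln4_ge : 138 / 100 <= ln 4 :> R.
Proof.
have -> : 4 = 2 * 2 :> R by ring.
by rewrite lnM ?posrE//; have := ln2_ge; lra.
Qed.

(** From log (4 / y) <= 4 / y - 1 and log 4 >= 138/100. It replaces the logarithm in the barrier by
    a rational function. *)
Lemma log_gap_le (y : R) : 0 < y -> 2 - ln y <= 4 / y - 38 / 100.
Proof.
move=> y0; have := @ln_le_subr1 (4 / y); rewrite divr_gt0// => /(_ isT).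
rewrite ln_div ?posrE//; have := ln4_ge; lra.
Qed.

(** Here t = 2 s - 1, and 5 (1 - t^2) is b s (1 - s) at b = 20. The difference of the sides lies
    above the chord between its values [E0] at t = 0 and [E1] at t = 78/100; the identity [e]
    displays the nonnegative excess. *)
Lemma barrier_right_small t w : 0 <= t <= 78 / 100 -> 0 < w ->
  234 / 1000 * (4 - 38 / 100 * (t + w)) * w ^+ 2 < 5 * (1 - t ^+ 2) * (t + w).
Proof.
move=> /andP[t0 t1] w0.
have h1 : 0 <= t * (78 / 100 - t) * (t + 78 / 100) by rewrite !mulr_ge0//; lra.
have h2 : 0 <= w * (t * (78 / 100 - t)) by rewrite !mulr_ge0//; lra.
have E0 : 0 < 5 * w - 936 / 1000 * w ^+ 2 + (234 / 1000) * (38 / 100) * w ^+ 3.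
  have -> : 5 * w - 936 / 1000 * w ^+ 2 + (234 / 1000) * (38 / 100) * w ^+ 3 =
    w * (5 - 936 / 1000 * w + (234 / 1000) * (38 / 100) * w ^+ 2) by ring.
  by apply: mulr_gt0 w0 _; have := sqr_ge0 (w - 100 / 19); lra.
have E1 : 0 < 5 * (1 - (78 / 100) ^+ 2) * (78 / 100 + w)
  - 234 / 1000 * (4 - 38 / 100 * (78 / 100 + w)) * w ^+ 2.
  have : 0 <= w * (w - 51 / 10) ^+ 2 by rewrite mulr_ge0 ?sqr_ge0// ltW.
  by have := sqr_ge0 (w - 44 / 10); lra.
have h3 : 0 <= (78 / 100 - t) * (5 * w - 936 / 1000 * w ^+ 2 + (234 / 1000) * (38 / 100) * w ^+ 3).
  by apply: mulr_ge0 (ltW E0); lra.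
have h4 : 0 <= t * (5 * (1 - (78 / 100) ^+ 2) * (78 / 100 + w)
  - 234 / 1000 * (4 - 38 / 100 * (78 / 100 + w)) * w ^+ 2).
  exact: mulr_ge0 t0 (ltW E1).
rewrite -subr_gt0.
have [t00|tp] : t = 0 \/ 0 < t by case: (ltgtP t 0) => h; [lra|right|left].
  by rewrite t00; lra.
have h4' : 0 < t * (5 * (1 - (78 / 100) ^+ 2) * (78 / 100 + w)
  - 234 / 1000 * (4 - 38 / 100 * (78 / 100 + w)) * w ^+ 2).
  exact: mulr_gt0 tp E1.
have e : 78 / 100 * (5 * (1 - t ^+ 2) * (t + w) -
    234 / 1000 * (4 - 38 / 100 * (t + w)) * w ^+ 2) =
  (78 / 100 - t) * (5 * w - 936 / 1000 * w ^+ 2 + (234 / 1000) * (38 / 100) * w ^+ 3)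
  + t * (5 * (1 - (78 / 100) ^+ 2) * (78 / 100 + w)
     - 234 / 1000 * (4 - 38 / 100 * (78 / 100 + w)) * w ^+ 2)
  + 39 / 10 * (t * (78 / 100 - t) * (t + 78 / 100)) + 39 / 10 * (w * (t * (78 / 100 - t))).
  by field.
have p78 : 0 < 78 / 100 :> R by lra.
rewrite -(pmulr_rgt0 _ p78) e.
apply: ltr_wpDr; first by apply: mulr_ge0 h2; lra.
apply: ltr_wpDr; first by apply: mulr_ge0 h1; lra.
exact: ltr_wpDl h3 h4'.
Qed.

Lemma barrier_right_large X : 0 < X ->
  (4 - 38 / 100 * X) * (263 / 1000 * (X - 78 / 100) ^+ 2 + 342 / 1000 * (X - 78 / 100))
  < X * (X + 1) / 2.
Proof.
move=> X0; have : 0 <= X * (X - 3) ^+ 2 by rewrite mulr_ge0 ?sqr_ge0// ltW.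
by have := sqr_ge0 (X - 385 / 100); lra.
Qed.

Lemma barrier_left_gap c z X l : 0 < z <= 1 -> z <= X -> 0 <= l <= 2 ->
  l * X <= 4 * z - 38 / 100 * X -> 616 / 100 + 95 / 10 * z <= c - 1 ->
  468 / 1000 * l * (1 + X) ^+ 2 < c - 1 - X / 2.
Proof.
move=> /andP[z0 z1] zX /andP[l0 l2] lX hc.
have X0 : 0 < X by lra.
have h : l * X * X <= (4 * z - 38 / 100 * X) * X by rewrite ler_wpM2r// ltW.
have hz : z * z <= z by rewrite ler_piMl// ltW.
have hl : 0 <= l * X by rewrite mulr_ge0// ltW.
by have := sqr_ge0 (X - 100 / 19 * z); lra.
Qed.

End LogBarrier.

(** * Sign of the derivative of the barrier at its zeros *)

Section LogBarrierAlgebra.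
Variable R : realType.
Implicit Types (b c s x q l w X : R).

(** The range s >= 1/2, split at s = 89/100, that is 2 s - 1 = 78/100. Below the split the bound on
    b s (1 - s) alone is contradictory; above it, it bounds b (1 - s) by 263/1000 l w^2, and the
    bound coming from q finishes. *)
Lemma barrier_right b s X l w : 20 <= b -> 1 / 2 <= s < 1 -> 0 < X -> 0 < l -> 0 < w ->
  X = 2 * s - 1 + w -> l * X <= 4 - 38 / 100 * X ->
  b * (s * (1 - s)) <= 234 / 1000 * (l * w ^+ 2) ->
  (X + 1) / 2 - b * (1 - s) <= 342 / 1000 * (l * w) -> False.
Proof.
move=> b20 /andP[sh s1] X0 l0 w0 eX lX hy hq.
have u0 : 0 < 1 - s by clear -s1; lra.
have lw2 : 0 <= l * w ^+ 2 by rewrite mulr_ge0 ?sqr_ge0// ltW.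
have s0 : 0 < s by clear -sh; lra.
have P0 : 0 <= (b - 20) * (s * (1 - s)).
  by rewrite mulr_ge0 ?mulr_ge0 ?(ltW s0) ?(ltW u0) ?subr_ge0.
have s89 : 89 / 100 < s.
  rewrite ltNge; apply/negP => hs.
  have t01 : 0 <= 2 * s - 1 <= 78 / 100 by clear -hs sh; apply/andP; split; lra.
  have h := barrier_right_small t01 w0; rewrite -eX in h.
  have h1 : 5 * (1 - (2 * s - 1) ^+ 2) <= 234 / 1000 * (l * w ^+ 2).
    by apply: le_trans hy; clear -P0; lra.
  have h2 : 5 * (1 - (2 * s - 1) ^+ 2) * X <= 234 / 1000 * (l * w ^+ 2) * X.
    by rewrite ler_pM2r.
  have h3 : l * X * w ^+ 2 <= (4 - 38 / 100 * X) * w ^+ 2 by rewrite ler_wpM2r ?sqr_ge0.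
  by clear -h h2 h3; lra.
have hbu : b * (1 - s) <= 263 / 1000 * (l * w ^+ 2).
  have h1 : 0 <= (s - 89 / 100) * (b * (1 - s)).
    by apply: mulr_ge0; [|apply: mulr_ge0]; clear -s89 b20 u0; lra.
  by clear -h1 hy lw2; lra.
have hw : w <= X - 78 / 100 by clear -eX s89; lra.
have h2 : l * w ^+ 2 <= l * (X - 78 / 100) ^+ 2.
  by rewrite ler_pM2l// lerXn2r ?nnegrE ?(ltW w0)// (le_trans (ltW w0)).
have h3 : l * w <= l * (X - 78 / 100) by rewrite ler_pM2l.
pose k := 263 / 1000 * (X - 78 / 100) ^+ 2 + 342 / 1000 * (X - 78 / 100).
have h4 : (X + 1) / 2 <= l * k by rewrite /k; clear -h2 h3 hq hbu; lra.
have k0 : 0 <= k.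
  by have := sqr_ge0 (X - 78 / 100); rewrite /k; clear -hw w0; lra.
have h5 : (X + 1) / 2 * X <= l * k * X by rewrite ler_pM2r.
have h6 : l * X * k <= (4 - 38 / 100 * X) * k by rewrite ler_wpM2r.
by have := barrier_right_large X0; rewrite -/k; clear -h5 h6; lra.
Qed.

(** For s < 1/2, b s <= 2 b s (1 - s) <= 468/1000 l (1 + 2 x)^2, which [barrier_left_gap] places
    below c - 1 - x, against the last hypothesis, which expresses q > 0. The needed lower bound of c
    - 1 comes from the equation of [x1] and b >= 20. *)
Lemma barrier_left b c s x x1 l w : 20 <= b -> 0 < s < 1 / 2 -> 0 < 2 * x1 <= 1 ->
  x1 <= x -> 0 < l <= 2 -> 0 < w -> w <= 1 + 2 * x ->
  2 * x1 * (2 * c + 2 * b + 3) = 6 * c - 2 * b - 3 ->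
  l * (2 * x) <= 4 * (2 * x1) - 38 / 100 * (2 * x) ->
  b * (s * (1 - s)) <= 234 / 1000 * (l * w ^+ 2) -> c - 1 - x < b * s -> False.
Proof.
move=> b20 /andP[s0 sh] z01 x1x /andP[l0 l2] w0 hw ex1 lX hy hq.
have hc : 616 / 100 + 95 / 10 * (2 * x1) <= c - 1.
  have /andP[z0 z1] := z01.
  have zpos : 0 < 6 - 2 * (2 * x1) by clear -z1; lra.
  have h1 : 43 * (1 + 2 * x1) <= c * (6 - 2 * (2 * x1)).
    have : 0 <= (1 + 2 * x1) * (2 * b - 40) by apply: mulr_ge0; clear -z0 b20; lra.
    by clear -ex1; lra.
  rewrite -(ler_pM2r zpos); have := sqr_ge0 x1.
  by clear -h1 z0; lra.
have l02 : 0 <= l <= 2 by rewrite l2 ltW.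
have zX : 2 * x1 <= 2 * x by rewrite ler_pM2l.
have h := barrier_left_gap z01 zX l02 lX hc.
have hw2 : l * w ^+ 2 <= l * (1 + 2 * x) ^+ 2.
  by rewrite ler_pM2l// lerXn2r ?nnegrE ?(ltW w0)// (le_trans (ltW w0)).
have h3 : 0 <= b * s * (1 - 2 * s).
  by apply: mulr_ge0; [apply: mulr_ge0|]; clear -s0 sh b20; lra.
by clear -h hw2 h3 hy hq; lra.
Qed.

(** The conclusion says that the barrier increases at its zeros. Put y = b s (1 - s), w = 2 x + 1 -
    2 s, l = 2 - L. The negation gives q w >= 117/80 y, where 117/80 is (2 b - (2 b + 3)/4) / b at b
    = 20, and the zero condition gives q^2 <= y l / 2. Hence q is bounded by a multiple of l w and y
    by a multiple of l w^2; 342/1000 and 234/1000 are 40/117 and (40/117)(80/117) rounded up. *)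
Lemma barrier_algebra b c (x1 x s q L : R) : 20 <= b -> 0 < c <= b + 1 / 2 ->
  2 * x1 * (2 * c + 2 * b + 3) = 6 * c - 2 * b - 3 -> 0 < x1 -> x1 <= x ->
  0 < s < 1 -> q = x - (c - 1) + b * s -> 0 < q -> L = ln (x / x1) ->
  q ^+ 2 = s * (1 - s) * (b - (2 * b + 3) / 4 * L) ->
  q * (2 * x + 1 - 2 * s) < (2 * b - (2 * b + 3) / 4) * (s * (1 - s)).
Proof.
move=> b20 /andP[c0 cb] ex1 x10 x1x /andP[s0 s1] eq q0 eL eT; rewrite ltNge; apply/negP => hw.
have x0 : 0 < x by exact: lt_le_trans x1x.
have xi1 : 1 <= x / x1 by rewrite ler_pdivlMr// mul1r.
have L0 : 0 <= L by rewrite eL ln_ge0.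
have P0 : 0 < s * (1 - s) by rewrite mulr_gt0// subr_gt0.
have b0 : 0 < b by clear -b20; lra.
have x1h : 2 * x1 <= 1.
  have cpos : 0 < 2 * c + 2 * b + 3 by clear -c0 b0; lra.
  by rewrite -(ler_pM2r cpos) ex1; clear -cb; lra.
have [l el] : exists l, l = 2 - L by exists (2 - L).
have lX : l * (2 * x) <= 4 * (2 * x1) - 38 / 100 * (2 * x).
  have := log_gap_le (lt_le_trans ltr01 xi1); rewrite -eL -el invf_div.
  have -> : 4 * (2 * x1) - 38 / 100 * (2 * x) = (4 * (x1 / x) - 38 / 100) * (2 * x).
    by field; rewrite gt_eqF.
  by rewrite ler_pM2r ?mulr_gt0.
have [y ey] : exists y, y = b * (s * (1 - s)) by exists (b * (s * (1 - s))).
have y0 : 0 < y by rewrite ey mulr_gt0.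
have hq2 : q ^+ 2 <= y / 2 * l.
  have : 0 <= s * (1 - s) * L by rewrite mulr_ge0// ltW.
  rewrite eT ey el; move: (s * (1 - s)) P0 => P P0 PL.
  by clear -P0 PL; lra.
have l0 : 0 < l.
  have : 0 < y / 2 * l by apply: lt_le_trans hq2; rewrite exprn_gt0.
  by rewrite pmulr_rgt0// divr_gt0.
have l2 : l <= 2 by rewrite el; clear -L0; lra.
have [w ew] : exists w, w = 2 * x + 1 - 2 * s by exists (2 * x + 1 - 2 * s).
have hqw : 117 / 80 * y <= q * w.
  have h : 0 <= (b - 20) * (s * (1 - s)) by rewrite mulr_ge0 ?subr_ge0// ltW.
  rewrite -ew in hw; apply: le_trans hw; rewrite ey.
  by move: h; move: (s * (1 - s)) => P h; clear -h; lra.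
have w0 : 0 < w.
  have : 0 < q * w.
    by apply: lt_le_trans hqw; apply: mulr_gt0 y0; rewrite divr_gt0.
  by rewrite pmulr_rgt0.
have hq : q <= 342 / 1000 * (l * w).
  rewrite -(ler_pM2l q0) -expr2.
  have h1 : 117 / 80 * y * l <= q * w * l by rewrite ler_pM2r.
  have h2 : 0 <= q * (l * w) by rewrite !mulr_ge0// ltW.
  by clear -h1 h2 hq2; lra.
have hy : y <= 234 / 1000 * (l * w ^+ 2).
  have h1 : q * w <= 342 / 1000 * (l * w) * w by rewrite ler_pM2r.
  have h2 : 0 <= l * w ^+ 2 by rewrite mulr_ge0 ?sqr_ge0// ltW.
  by clear -h1 h2 hqw; lra.
rewrite ey in hy.
have [sh|sh] := lerP (1 / 2) s.
- apply: (@barrier_right b s (2 * x) l w) => //.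
  + by rewrite sh.
  + by rewrite mulr_gt0.
  + by rewrite ew; ring.
  + by clear -lX x1h; lra.
  + by clear -hq eq cb; lra.
- apply: (@barrier_left b c s x x1 l w) => //.
  + by rewrite s0.
  + by rewrite x1h mulr_gt0.
  + by rewrite l0.
  + by rewrite ew; clear -s0; lra.
  + by clear -eq q0; lra.
Qed.

End LogBarrierAlgebra.

(** * The inequality for b >= 20, that is n >= 44 *)

Section CoreLarge.
Variable R : realType.
Implicit Types (b c s : R).

Local Notation F b c := (hyp2F1 (b + 3 / 2) (- (1 / 2)) c).
Local Notation G b c := (hyp2F1 1 b c).

Lemma hyp1_le b c s s' : 0 < b -> 0 < c -> 0 <= s <= s' -> s' < 1 -> G b c s <= G b c s'.
Proof.
move=> b0 c0 /andP[s0 ss'] s1.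
apply: (@nondecreasing_derive R _ (hyp_d 1 b c)) => // y /andP[y1 y2].
  by apply: is_derive_hyp => //; apply: itv01_norm; apply/andP; split; lra.
by apply/ltW/hyp_d_gt0 => //; apply/andP; split; lra.
Qed.

(* With Phi = log (x / x1), x = (c - 1) / G and q = s (1 - s) G' / G, the function
   barrier_fun is s (1 - s) times the hypergeometric operator of F applied to Phi. *)
Lemma core_log b c s0 : 20 <= b -> c <= b + 1 / 2 -> 2 * b + 3 < 6 * c ->
  0 < s0 < 1 -> F b c s0 = 0 -> G b c s0 * (2 * s0 - 1) <= 2 * c - 2.
Proof.
move=> b20 cb hc s01 Fs0.
have b0 : 0 < b by lra.
have c0 : 0 < c by lra.
have a0 : 0 < b + 3 / 2 by lra.
have c1 : 0 < c - 1 by lra.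
have /andP[s00 s01'] := s01.
rewrite leNgt; apply/negP => hlt.
(* sigma - 1/2 for the bound sigma = 2 c / (b + 3/2 + c) given by [hyp_zero_bound]. *)
pose x1 := (6 * c - 2 * b - 3) / (2 * (2 * c + 2 * b + 3)).
have den0 : 0 < 2 * c + 2 * b + 3 by lra.
have ex1 : 2 * x1 * (2 * c + 2 * b + 3) = 6 * c - 2 * b - 3.
  by rewrite /x1; field; rewrite gt_eqF.
have x10 : 0 < x1 by rewrite /x1 divr_gt0 ?mulr_gt0//; lra.
have hs0 : s0 - 1 / 2 <= x1.
  have := @hyp_zero_bound R (b + 3 / 2) c s0 c0; rewrite Fs0 => /(_ _ s01 erefl) h.
  have {}h : s0 <= 2 * c / (b + 3 / 2 + c) by apply: h; lra.
  have p0 : 0 < b + 3 / 2 + c by clear -b0 c0; lra.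
  rewrite ler_pdivlMr// in h; rewrite -(ler_pM2r den0).
  by clear -h ex1; lra.
have Gge1 s : 0 <= s < 1 -> 1 <= G b c s by move=> h; apply: hyp_gt0.
have G0 s : 0 <= s < 1 -> 0 < G b c s by move=> /Gge1; lra.
pose K := (c - 1) / x1.
(* 16 = 4^2 lets the bound on log 4 give Phi(0) = log K > 2. *)
have K16 : 16 <= K.
  by rewrite /K ler_pdivlMr// -(ler_pM2r den0); nra.
have KG : K < G b c s0.
  rewrite /K ltr_pdivrMr//; have h0 := G0 s0; rewrite ltW// s01' in h0.
  have {}h0 := h0 isT.
  have : G b c s0 * (s0 - 1 / 2) <= G b c s0 * x1 by apply: (ler_wpM2l (ltW h0)).
  by lra.
(* The assumed failure at [s0] forces G(s0) > K, so G takes the value K at some [s1] before [s0];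
   [Phi] vanishes there, and F(s1) <= 0 is the contradiction aimed at. *)
have [s1 s1i Gs1] : exists2 s1, s1 \in `[0, s0] & G b c s1 = K.
  apply: IVT; first exact: ltW.
    apply: derivable_within_continuous => y; rewrite in_itv /= => /andP[y1 y2].
    have y01 : `|y| < 1 by apply: itv01_norm; rewrite y1 (le_lt_trans y2).
    by have [] := is_derive_hyp 1 b c0 y01.
  rewrite hyp_at0 ge_min le_max (ltW KG) orbT andbT.
  by apply/orP; left; lra.
move: s1i; rewrite in_itv /= => /andP[s1ge s1le].
have s1gt : 0 < s1.
  rewrite lt_neqAle s1ge andbT; apply/eqP => e.
  by move: Gs1; rewrite -e hyp_at0; lra.
have s1lt : s1 < s0.
  rewrite lt_neqAle s1le andbT; apply/eqP => e.
  by move: KG; rewrite -Gs1 e ltxx.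
have s1l1 : s1 < 1 by lra.
have Fs1 : 0 < F b c s1.
  by rewrite -Fs0; apply: hyp_half_decr => //; rewrite s1ge.
pose g s := hyp_d 1 b c s / G b c s.
pose x s := (c - 1) / G b c s.
pose Phi s := ln K - ln (G b c s).
pose q s := x s - (c - 1) + b * s.
(* [kap] is half the first parameter b + 3/2 of F; the next function [T] is the one called
   [barrier_fun] above. *)
pose kap := (2 * b + 3) / 4.
pose T s := q s * q s - b * (s * (1 - s)) + kap * (s * (1 - s)) * Phi s.
have dG s : 0 <= s < 1 -> is_derive s (1 : R) (G b c) (hyp_d 1 b c s).
  by move=> h; apply: is_derive_hyp => //; exact: itv01_norm.
have dPhi s : 0 <= s < 1 -> is_derive s (1 : R) Phi (- g s).
  move=> h; have h1 := is_derive_compose (dG s h) (is_derive1_ln (G0 s h)).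
  apply: is_derive_eq_val (is_derive_sub (is_derive_const _ s) h1) _.
  by rewrite sub0r mulrC.
have qE s : 0 <= s < 1 -> s * (1 - s) * g s = q s.
  move=> h; have e := hyp1_ode b c0 (itv01_norm h); have h0 := G0 s h.
  rewrite /g mulrA e /q /x; field; rewrite gt_eqF//.
have q0 s : 0 < s < 1 -> 0 < q s.
  move=> /andP[h1 h2]; have h : 0 <= s < 1 by rewrite ltW.
  rewrite -qE//; apply: mulr_gt0; first by rewrite mulr_gt0 ?subr_gt0.
  by apply: divr_gt0; [exact: hyp_d_gt0|exact: G0].
have dx s : 0 <= s < 1 -> is_derive s (1 : R) x (- (x s * g s)).
  move=> h; have h0 := G0 s h; have h0' : G b c s != 0 by rewrite gt_eqF.
  apply: is_derive_eq_val (is_derive_mul (is_derive_const _ s) (is_derive_inv (dG s h) h0')) _.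
  by rewrite /x /g; field.
have dq s : 0 <= s < 1 -> is_derive s (1 : R) q (b - x s * g s).
  move=> h; apply: is_derive_eq_val (is_derive_add
   (is_derive_sub (dx s h) (is_derive_const (c - 1) s))
   (is_derive_mul (is_derive_const b s) (is_derive_ident s))) _.
  by ring.
pose T1 s := 2 * q s * (b - x s * g s) - b * (1 - 2 * s) + kap * (1 - 2 * s) * Phi s
   - kap * (s * (1 - s)) * g s.
have dP s : is_derive s (1 : R) (fun y => y * (1 - y)) (1 - 2 * s).
  apply: is_derive_eq_val (is_derive_mul (is_derive_ident s)
    (is_derive_sub (is_derive_const 1 s) (is_derive_ident s))) _.
  by ring.
have dT s : 0 <= s < 1 -> is_derive s (1 : R) T (T1 s).
  move=> h; apply: is_derive_eq_val (is_derive_add (is_derive_sub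
    (is_derive_mul (dq s h) (dq s h)) (is_derive_mul (is_derive_const b s) (dP s)))
    (is_derive_mul (is_derive_mul (is_derive_const kap s) (dP s)) (dPhi s h))) _.
  by rewrite /T1; ring.
have Phi_x s : 0 <= s < 1 -> Phi s = ln (x s / x1).
  move=> h; have h0 := G0 s h; rewrite /Phi -ln_div ?posrE//; last by rewrite (lt_le_trans _ K16).
  by congr ln; rewrite /K /x; field; rewrite !gt_eqF.
have xge s : 0 <= s <= s1 -> x1 <= x s.
  move=> /andP[h1 h2]; have h : 0 <= s < 1 by rewrite h1 (le_lt_trans h2).
  rewrite /x ler_pdivlMr ?G0//; have : G b c s <= K by rewrite -Gs1 hyp1_le// h1.
  by rewrite /K ler_pdivlMr// mulrC.
have T1pos s : 0 < s <= s1 -> T s = 0 -> 0 < T1 s.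
  move=> /andP[h1 h2] Ts; have h3 : s < 1 by exact: le_lt_trans h2 s1l1.
  have h : 0 <= s < 1 by rewrite ltW.
  have P0 : 0 < s * (1 - s) by rewrite mulr_gt0// subr_gt0.
  have qs : 0 < q s by apply: q0; rewrite h1.
  have := @barrier_algebra R b c x1 (x s) s (q s) (Phi s) b20.
  rewrite c0 cb h1 h3 => /(_ isT ex1 x10 (xge s _) isT erefl qs (Phi_x s h)) hb.
  have {}hb : q s * (2 * x s + 1 - 2 * s) < (2 * b - (2 * b + 3) / 4) * (s * (1 - s)).
    apply: hb; first by rewrite ltW.
    by move: Ts; rewrite /T /kap; move: (s * (1 - s)) (q s) (Phi s) => P Q L; clear; lra.
  rewrite -(pmulr_rgt0 _ P0).
  (* The last two terms vanish, by T = 0 and by [qE]; the first is positive by [barrier_algebra]. *)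
  have -> : s * (1 - s) * T1 s =
    q s * ((2 * b - kap) * (s * (1 - s)) - q s * (2 * x s + 1 - 2 * s))
    + (1 - 2 * s) * T s
    + (2 * q s * x s + kap * (s * (1 - s))) * (q s - s * (1 - s) * g s).
    by rewrite /T1 /T; ring.
  by rewrite Ts mulr0 addr0 qE// subrr mulr0 addr0 mulr_gt0// subr_gt0.
have Tge s : 0 < s < s1 -> 0 <= T s.
  move=> /andP[h1 h2].
  have Phi0 : 2 < Phi 0.
    rewrite /Phi hyp_at0 ln1 subr0.
    have h16 : ln 16 <= ln K by rewrite ler_ln ?posrE// (lt_le_trans _ K16).
    apply: lt_le_trans h16; have -> : 16 = 4 * 4 :> R by ring.
    by rewrite lnM ?posrE//; have := ln4_ge R; clear; lra.
  have := is_derive_continuous (dPhi 0 _); rewrite lexx ltr01 => /(_ isT).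
  move=> /cvgr_gt /(_ _ Phi0) /nbhs_ballP[e /= e0 he].
  (* Where Phi > 2, kap Phi exceeds 2 kap = b + 3/2 > b, so T >= 0 directly; this supplies the
     starting point [a] of [barrier]. *)
  have near0 y : 0 < y < e -> y < 1 -> 0 <= T y.
    move=> /andP[y1 y2] y3; have : 2 < Phi y.
      by apply: he; rewrite /ball /= sub0r normrN gtr0_norm.
    move=> hP; rewrite /T /kap; have P0 : 0 < y * (1 - y) by rewrite mulr_gt0// subr_gt0.
    have := sqr_ge0 (q y); rewrite expr2.
    have : 0 <= y * (1 - y) * ((2 * b + 3) / 4 * (Phi y - 2)).
      by apply: mulr_ge0 (ltW P0) _; apply: mulr_ge0; clear -b0 hP; lra.
    by move: (y * (1 - y)) P0 (q y * q y) (Phi y) hP => P P0 Q L hP; clear -P0; lra.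
  have [se|se] := ltrP s e; first by apply: near0; [rewrite h1|clear -h2 s1l1; lra].
  pose a := Num.min (e / 2) (s / 2).
  have ap : 0 < a by rewrite /a lt_min !divr_gt0.
  have ae : a <= e / 2 by rewrite /a ge_min lexx.
  have as_ : a <= s / 2 by rewrite /a ge_min lexx orbT.
  apply: (@barrier R T T1 a s1).
  - by clear -as_ h1 h2; lra.
  - by move=> y /andP[y1 y2]; apply: dT; clear -y1 y2 ap s1l1; apply/andP; split; lra.
  - by apply: near0; clear -ap ae as_ e0 h1 h2 s1l1; [apply/andP; split|]; lra.
  - by move=> y /andP[y1 y2]; apply: T1pos; clear -y1 y2 ap; apply/andP; split; lra.
  - by clear -as_ h1 h2; apply/andP; split; lra.
pose g1 s := (hyp_dd 1 b c s * G b c s - hyp_d 1 b c s * hyp_d 1 b c s) / G b c s ^+ 2.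
have : F b c s1 <= 0.
  apply: (@hyp_zero_comparison R (b + 3 / 2) c s1 Phi (fun s => - g s) (fun s => - g1 s)) => //.
  - by rewrite s1gt.
  - by move=> s /andP[h1 h2]; apply: dPhi; clear -h1 h2 s1l1; apply/andP; split; lra.
  - move=> s /andP[h1 h2]; have h : 0 <= s < 1 by clear -h1 h2 s1l1; apply/andP; split; lra.
    have h0 := G0 s h; have h0' : G b c s != 0 by rewrite gt_eqF.
    have h3 := is_derive_mul (is_derive_hyp_d 1 b c0 (itv01_norm h)) (is_derive_inv (dG s h) h0').
    have := is_derive_sub (is_derive_const 0 s) h3.
    have -> : (fun y : R => 0 - hyp_d 1 b c y / G b c y) = (fun y => - g y).
      by apply/funext => y; rewrite sub0r.
    by move=> h4; apply: is_derive_eq_val h4 _; rewrite /g1; field.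
  - move=> s /andP[h1 h2]; have h : 0 <= s < 1 by clear -h1 h2 s1l1; apply/andP; split; lra.
    have P0 : 0 < s * (1 - s) by rewrite mulr_gt0// subr_gt0 (lt_trans h2).
    have h0 := G0 s h; have h0' : G b c s != 0 by rewrite gt_eqF.
    have := Tge s; rewrite h1 h2 => /(_ isT) hT.
    rewrite -(pmulr_rge0 _ P0).
    have ode := hyp_ode 1 b c0 (itv01_norm h).
    have eg1 : s * (1 - s) * g1 s = b - (c - (b + 2) * s) * g s - s * (1 - s) * g s * g s.
      apply: (mulIf h0'); rewrite /g1 /g.
      move: ode; move: (hyp_dd _ _ _ _) (hyp_d _ _ _ _) (G b c s) h0' => y2 y1 y0 y00 ode.
      rewrite [LHS](_ : _ = s * (1 - s) * y2 - s * (1 - s) * y1 * y1 / y0); last by field.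
      rewrite [RHS](_ : _ = b * y0 - (c - (b + 2) * s) * y1 - s * (1 - s) * y1 * y1 / y0); last by field.
      by have -> : s * (1 - s) * y2 = b * y0 - (c - (b + 2) * s) * y1 by clear -ode; lra.
    rewrite [leRHS](_ : _ = T s); first by [].
    have -> : s * (1 - s) * - g1 s = - (s * (1 - s) * g1 s) by ring.
    by rewrite eg1 /T -qE// /kap; field.
  - by rewrite /Phi Gs1 subrr.
  - have h : 0 <= s1 < 1 by rewrite s1ge.
    by rewrite oppr_lt0; apply: divr_gt0; [exact: hyp_d_gt0|exact: G0].
by rewrite leNgt Fs1.
Qed.

End CoreLarge.

(** * The cases k = n - 2 and k = 1 *)

Section CoreSmallCases.
Variable R : realType.
Implicit Types (b c s : R).

Local Notation F b c := (hyp2F1 (b + 3 / 2) (- (1 / 2)) c).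
Local Notation G b c := (hyp2F1 1 b c).

(* For c = b + 1, the multiple b / sqrt ((2 b - 1) (1 - s)) of (1 - s)^(-1/2) is a
   supersolution of the first-order equation of G. *)
Lemma hyp1_le_invsqrt b s : 1 <= b -> 0 < s < 1 ->
  exists v m : R, [/\ 0 < v, 0 < m, m ^+ 2 = 2 * b - 1, v ^+ 2 * (1 - s) = 1 &
    G b (b + 1) s <= b / m * v].
Proof.
move=> b1 s01; have /andP[s0 s1] := s01.
have b0 : 0 < b by lra.
pose V (y : R) := (1 - y) `^ (- (1 / 2)).
pose m := Num.sqrt (2 * b - 1).
have m0 : 0 < m by rewrite sqrtr_gt0; lra.
have m2 : m ^+ 2 = 2 * b - 1 by rewrite sqr_sqrtr//; lra.
have V0 y : y < 1 -> 0 < V y by move=> h; rewrite powR_gt0// subr_gt0.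
have V2 y : y < 1 -> V y ^+ 2 * (1 - y) = 1.
  move=> h; have u0 : 0 < 1 - y by lra.
  rewrite /V powRN div1r powR12_sqrt ?(ltW u0)// exprVn sqr_sqrtr ?(ltW u0)//.
  by rewrite mulVf// gt_eqF.
exists (V s), m; split => //; [exact: V0|exact: V2|].
pose C := b / m.
have C0 : 0 < C by rewrite divr_gt0.
have dV (y : R) : y < 1 -> is_derive y (1 : R) V (V y / (2 * (1 - y))).
  move=> h; have u0 : 0 < 1 - y by lra.
  have h1 : is_derive (1 - y) (1 : R) (fun z : R => z `^ (- (1 / 2)))
    (- (1 / 2) * (1 - y) `^ (- (1 / 2) - 1)) by exact: is_derive1_powR.
  apply: is_derive_eq_val (is_derive_compose
    (is_derive_sub (is_derive_const 1 y) (is_derive_ident y)) h1) _.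
  rewrite powRB ?(gt_eqF u0) ?implybT// powRr1 ?(ltW u0)// -/(V y).
  by field; rewrite gt_eqF.
pose W (y : R) := C * V y - G b (b + 1) y.
pose W1 (y : R) := (0 * V y + C * (V y / (2 * (1 - y)))) - hyp_d 1 b (b + 1) y.
have c0 : 0 < b + 1 by lra.
suff : 0 <= W s by rewrite /W subr_ge0.
apply: (@weighted_sign R W W1 b b s b0 s01) => y /andP[y0 y1].
  apply: is_derive_sub; last first.
    by apply: is_derive_hyp => //; apply: itv01_norm; rewrite y0 (le_lt_trans y1).
  by have := is_derive_mul (is_derive_const C y) (dV y (le_lt_trans y1 s1)).
have y11 : y < 1 by exact: lt_trans s1.
have y01 : 0 <= y < 1 by rewrite ltW.
have u0 : 0 < 1 - y by lra.
have := hyp1_ode b c0 (itv01_norm y01).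
have := V2 y y11; have := V0 y y11; rewrite /W1 /W.
move: (hyp_d _ _ _ _) (G _ _ _) (V y) => g1 g v v0 v2 ode.
have -> : y * (1 - y) * (0 * v + C * (v / (2 * (1 - y))) - g1) + (b - b * y) * (C * v - g)
  = C * v * (y / 2 + b * (1 - y)) - (y * (1 - y) * g1 + b * (1 - y) * g).
  by field; rewrite gt_eqF.
have -> : y * (1 - y) * g1 + b * (1 - y) * g = b by rewrite ode; ring.
(* The constant C = b / m is the one for which the residual is a perfect square, vanishing at v =
   m. *)
have e : v * (C * v * (y / 2 + b * (1 - y)) - b) = C / 2 * (v - m) ^+ 2.
  rewrite (_ : y / 2 + b * (1 - y) = (1 + m ^+ 2 * (1 - y)) / 2); last by rewrite m2; field.
  rewrite (_ : v * _ = C / 2 * (v ^+ 2 + m ^+ 2 * (v ^+ 2 * (1 - y))) - b * v); last by field.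
  by rewrite v2 /C; field; rewrite gt_eqF.
by rewrite -(pmulr_rge0 _ v0) e mulr_ge0 ?sqr_ge0// divr_ge0// ltW.
Qed.

(** With u = 1 - s0 and G <= (b / m) u^(-1/2), squaring reduces the claim to (1 - 2 u)^2 <= 4 (2 b -
    1) u, that is 1 + 4 u^2 <= 8 b u. *)
Lemma core_last b s0 : 3 <= b -> 0 < s0 < 1 -> F b (b + 1) s0 = 0 ->
  G b (b + 1) s0 * (2 * s0 - 1) <= 2 * (b + 1) - 2.
Proof.
move=> b3 s01 e; have /andP[s00 s01'] := s01.
have b1 : 1 <= b by lra.
have hu := hyp_zero_bound_last b3 s01 e.
have G1 : 1 <= G b (b + 1) s0 by apply: hyp_gt0; rewrite ?(ltW s00)//; lra.
have [h|h] := lerP (2 * s0 - 1) 0.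
  have : G b (b + 1) s0 * (2 * s0 - 1) <= 0 by rewrite mulr_ge0_le0//; lra.
  by lra.
have [v [m [v0 m0 m2 v2 Gle]]] := hyp1_le_invsqrt b1 s01.
have b0 : 0 < b by lra.
apply: (@le_trans _ _ (b / m * v * (2 * s0 - 1))); first by rewrite ler_pM2r.
rewrite (_ : 2 * (b + 1) - 2 = b / m * (2 * m)); last by field; rewrite gt_eqF.
rewrite -mulrA ler_pM2l ?divr_gt0//.
have [u eu] : exists u, u = 1 - s0 by exists (1 - s0).
rewrite -eu in hu v2.
have u0 : 0 < u by rewrite eu; lra.
have key : 1 + 4 * u ^+ 2 <= 8 * b * u.
  have h1 : 1 <= u * (8 * b - 1) by rewrite -ler_pdivrMr ?div1r//; lra.
  have [u4|u4] := lerP u (1 / 4).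
    have : 0 <= u * (1 / 4 - u) by rewrite mulr_ge0 ?subr_ge0// ltW.
    by lra.
  have : 0 <= (b - 3) * u by rewrite mulr_ge0 ?subr_ge0// ltW.
  have : 0 <= (u - 1 / 4) * (1 - u) by rewrite mulr_ge0//; rewrite eu; lra.
  by lra.
rewrite -(@ler_pXn2r _ 2)// ?nnegrE ?mulr_ge0 ?(ltW v0) ?(ltW h) ?(ltW m0)//.
rewrite !exprMn m2 -(ler_pM2r u0).
rewrite (_ : v ^+ 2 * (2 * s0 - 1) ^+ 2 * u = v ^+ 2 * u * (1 - 2 * u) ^+ 2); last first.
  by rewrite eu; ring.
by rewrite v2; lra.
Qed.

(** The right side is negative, so G (1 - 2 s0) >= 1 has to be shown. The coefficients of G are at
    least their values 1, 3, 5, 7 at b = 3/2, and s0 <= 2/7, the bound 2k / (n + k - 1) at n = 7. *)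
Lemma core_first b s0 : 3 / 2 <= b -> 0 < s0 < 1 -> F b (1 / 2) s0 = 0 ->
  G b (1 / 2) s0 * (2 * s0 - 1) <= -1.
Proof.
move=> b32 s01 e; have /andP[s00 s01'] := s01.
have c0 : 0 < 1 / 2 :> R by lra.
have hs : s0 <= 2 / 7.
  have := @hyp_zero_bound R (b + 3 / 2) (1 / 2) s0 c0; rewrite e => /(_ _ s01 erefl) h.
  have {}h : s0 <= 2 * (1 / 2) / (b + 3 / 2 + 1 / 2) by apply: h; lra.
  have p0 : 0 < b + 3 / 2 + 1 / 2 by lra.
  rewrite ler_pdivlMr// in h.
  have : 0 <= s0 * (b - 3 / 2) by rewrite mulr_ge0 ?subr_ge0// ltW.
  by lra.
have b0 : 0 < b by lra.
have z01 : 0 <= s0 < 1 by rewrite ltW.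
have := @psum_ge_partial R _ s0 4 (hyp_unit_radius 1 b c0) z01
  (fun m _ => ltW (hyp_coef_gt0 m ltr01 b0 c0)).
rewrite -hyp2F1E !big_nat_recr ?big_geq//= add0r hyp_coef0 expr0 expr1 mulr1.
have := hyp_coefS 1 b 0 c0; have := hyp_coefS 1 b 1 c0; have := hyp_coefS 1 b 2 c0.
rewrite hyp_coef0 !addr0 !mul1r !mulr1.
move: (hyp_coef _ _ _ 1) (hyp_coef _ _ _ 2) (hyp_coef _ _ _ 3) => h1 h2 h3 e3 e2 e1.
have h1b : h1 = 2 * b by lra.
have h13 : 3 <= h1 by lra.
have h2b : h2 = h1 * (b + 1) * (2 / 3) by lra.
have h25 : 5 <= h2 by rewrite h2b; nra.
have h3b : h3 = h2 * (b + 2) * (2 / 5) by lra.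
have h37 : 7 <= h3 by rewrite h3b; nra.
move=> hG; set g := G _ _ _ in hG *.
have hG2 : 1 + 3 * s0 + 5 * s0 ^+ 2 + 7 * s0 ^+ 3 <= g.
  apply: le_trans hG; have s2 : 0 <= s0 ^+ 2 by rewrite sqr_ge0.
  have s3 : 0 <= s0 ^+ 3 by rewrite exprn_ge0// ltW.
  rewrite !lerD// ler_wpM2r// ltW//.
clear -hG2 hs s00.
have : (1 + 3 * s0 + 5 * s0 ^+ 2 + 7 * s0 ^+ 3) * (1 - 2 * s0) <= g * (1 - 2 * s0).
  by rewrite ler_pM2r//; lra.
suff : 0 <= s0 * (1 - s0 - 3 * s0 ^+ 2 - 14 * s0 ^+ 3) by lra.
apply: mulr_ge0 (ltW s00) _.
have q2 : s0 ^+ 2 <= 2 / 7 * s0 by rewrite expr2 ler_pM2r.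
have q3 : s0 ^+ 3 <= 2 / 7 * s0 ^+ 2 by rewrite exprS ler_wpM2r ?sqr_ge0.
by lra.
Qed.

End CoreSmallCases.

(** * Certified evaluation of the series with binary integers *)

Module BN := BinNat.N.

Section NumericalCheck.

(* bb = n - 4, k2 = k - 2, and p / r is the point of evaluation. Invariant: the partial
   sum up to index m is S / d and the next term is t / d; the tail is bounded by the
   geometric series of ratio A' / B. *)
Fixpoint hyp1_check (fuel : nat) (bb k2 p r m S t d : BinNums.N) : bool :=
  let C := BN.add (BN.succ (BN.succ k2)) (BN.double m) in
  let B := BN.mul C r in
  let A := BN.mul (BN.add bb (BN.double m)) p in
  let A' := BN.mul (BN.max (BN.add bb (BN.double m)) C) p in
  if BN.ltb A' B && BN.leb
      (BN.mul (BN.add (BN.mul S (BN.sub B A')) (BN.mul t B)) (BN.sub (BN.double p) r))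
      (BN.mul (BN.mul (BN.mul k2 r) d) (BN.sub B A')) then true
  else if fuel is f.+1 then
    hyp1_check f bb k2 p r (BN.succ m) (BN.mul (BN.add S t) B) (BN.mul t A) (BN.mul d B)
  else false.

(* S / d is minus the sum of the terms of index 1, ..., m, and t / d is minus the
   next term. *)
Fixpoint hyp_half_check (fuel : nat) (bb k2 p r m S t d : BinNums.N) : bool :=
  if BN.leb d S then true else if fuel is f.+1 then
    let m2 := BN.double m in
    let B := BN.mul (BN.mul (BN.add (BN.succ (BN.succ (BN.succ (BN.succ k2)))) m2)
                            (BN.double (BN.succ (BN.succ m)))) r in
    let A := BN.mul (BN.mul (BN.add bb (BN.succ (BN.double (BN.succ (BN.succ m)))))
                            (BN.succ m2)) p in
    hyp_half_check f bb k2 p r (BN.succ m) (BN.mul (BN.add S t) B) (BN.mul t A) (BN.mul d B)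
  else false.

Variable R : realType.
Implicit Types x y : BinNums.N.

Definition NR x : R := (BN.to_nat x)%:R.

Lemma NR_add x y : NR (BN.add x y) = NR x + NR y.
Proof. by rewrite /NR Nnat.N2Nat.inj_add -natrD. Qed.

Lemma NR_mul x y : NR (BN.mul x y) = NR x * NR y.
Proof. by rewrite /NR Nnat.N2Nat.inj_mul -natrM. Qed.

Lemma NR_double x : NR (BN.double x) = 2 * NR x.
Proof. by rewrite BN.double_spec NR_mul. Qed.

Lemma NR_succ x : NR (BN.succ x) = NR x + 1.
Proof. by rewrite /NR Nnat.N2Nat.inj_succ natr1. Qed.

Lemma NR_ge0 x : 0 <= NR x.
Proof. by []. Qed.

Lemma NR_sub x y : BN.leb y x -> NR (BN.sub x y) = NR x - NR y.
Proof. by move=> /BN.leb_le/BN.sub_add e; rewrite -[in RHS]e NR_add addrK. Qed.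

Lemma NR_le x y : BN.leb x y -> NR x <= NR y.
Proof. by move=> /NR_sub h; rewrite -subr_ge0 -h. Qed.

Lemma NR_lt x y : BN.ltb x y -> NR x < NR y.
Proof.
move=> /BN.ltb_lt/BN.le_succ_l/BN.leb_le/NR_le; rewrite NR_succ.
by apply: lt_le_trans; rewrite ltrDl.
Qed.

Lemma NR_max x y : NR (BN.max x y) = Num.max (NR x) (NR y).
Proof.
case: (BN.max_spec x y) => -[h ->].
- by rewrite max_r//; apply/NR_le/BN.leb_le/BN.lt_le_incl.
- by rewrite max_l//; apply/NR_le/BN.leb_le.
Qed.

Lemma hyp1_coefS (b c : R) j : 0 < c ->
  hyp_coef 1 b c j.+1 * (c + j%:R) = hyp_coef 1 b c j * (b + j%:R).
Proof.
move=> c0; apply: (@mulIf _ j.+1%:R); first by rewrite pnatr_eq0.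
by rewrite -mulrA hyp_coefS// -natr1; ring.
Qed.

(** For j >= m the ratio (b + j) / (c + j) is at most 1 if b <= c, and otherwise decreases in j; in
    both cases it is at most M / (c + m), which gives a geometric tail. *)
Lemma hyp1_tail_le (b c z M : R) m : 0 < b -> 0 < c -> 0 <= z < 1 ->
  b + m%:R <= M -> c + m%:R <= M -> M * z < c + m%:R ->
  hyp2F1 1 b c z <= \sum_(0 <= i < m) hyp_coef 1 b c i * z ^+ i +
    hyp_coef 1 b c m * z ^+ m / (1 - M * z / (c + m%:R)).
Proof.
move=> b0 c0 z01 bM cM hM; have /andP[z0 z1] := z01.
have cm : 0 < c + m%:R by rewrite ltr_wpDr.
have M0 : 0 < M by exact: lt_le_trans cM.
apply: (@psum_le_tail _ (hyp_coef 1 b c)) => //.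
- exact: hyp_unit_radius.
- by rewrite divr_ge0 ?mulr_ge0 ?(ltW M0) ?(ltW cm)//= ltr_pdivrMr// mul1r.
- by move=> j; rewrite ltW// hyp_coef_gt0.
move=> j mj; have cj : 0 < c + j%:R by rewrite ltr_wpDr.
have hj := hyp_coef_gt0 j ltr01 b0 c0.
have e := hyp1_coefS b j c0.
have -> : hyp_coef 1 b c j.+1 = hyp_coef 1 b c j * ((b + j%:R) / (c + j%:R)).
  by apply: (@mulIf _ (c + j%:R)); [rewrite gt_eqF|rewrite e; field; rewrite gt_eqF].
rewrite -mulrA [leRHS]mulrC ler_pM2l// [M * z / _]mulrAC ler_wpM2r//.
rewrite ler_pdivrMr// mulrAC ler_pdivlMr//.
have mj' : m%:R <= j%:R :> R by rewrite ler_nat.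
have [bc|bc] := lerP b c.
  apply: (@le_trans _ _ ((c + j%:R) * (c + m%:R))).
    by rewrite ler_pM2r// lerD2r.
  by rewrite mulrC ler_pM2r.
apply: (@le_trans _ _ ((b + m%:R) * (c + j%:R))); last by rewrite ler_pM2r.
have : 0 <= (b - c) * (j%:R - m%:R) by rewrite mulr_ge0 ?subr_ge0// ltW.
by lra.
Qed.

Section Soundness.
Variables (bb k2 p r : BinNums.N) (b c z : R).
Hypotheses (eb : NR bb = 2 * b) (ek : NR k2 = 2 * c - 2) (b0 : 0 < b) (c1 : 1 <= c).
Hypotheses (r0 : 0 < NR r) (ez : z * NR r = NR p) (z01 : 0 <= z < 1).

Let c0 : 0 < c. Proof. exact: lt_le_trans c1. Qed.
Let C (m : BinNums.N) := BN.add (BN.succ (BN.succ k2)) (BN.double m).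
Let A (m : BinNums.N) := BN.mul (BN.add bb (BN.double m)) p.
Let B (m : BinNums.N) := BN.mul (C m) r.
Let A' (m : BinNums.N) := BN.mul (BN.max (BN.add bb (BN.double m)) (C m)) p.

Let eC m : NR (C m) = 2 * (c + NR m).
Proof. by rewrite /C NR_add !NR_succ ek NR_double; ring. Qed.

Let eB m : NR (B m) = 2 * (c + NR m) * NR r.
Proof. by rewrite /B NR_mul eC. Qed.

Let eA m : NR (A m) = 2 * (b + NR m) * (z * NR r).
Proof. by rewrite /A NR_mul NR_add eb NR_double -ez -mulrDr. Qed.

Let eA' m : NR (A' m) = 2 * Num.max (b + NR m) (c + NR m) * (z * NR r).
Proof. by rewrite /A' NR_mul NR_max NR_add eC eb NR_double -ez -mulrDr maxr_pMr. Qed.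

Let B0 m : 0 < NR (B m).
Proof. by rewrite eB !mulr_gt0// ltr_wpDr// NR_ge0. Qed.

Let check_base m S t d : 0 < NR d ->
  NR S / NR d = \sum_(0 <= i < BN.to_nat m) hyp_coef 1 b c i * z ^+ i ->
  NR t / NR d = hyp_coef 1 b c (BN.to_nat m) * z ^+ (BN.to_nat m) ->
  BN.ltb (A' m) (B m) && BN.leb
      (BN.mul (BN.add (BN.mul S (BN.sub (B m) (A' m))) (BN.mul t (B m)))
              (BN.sub (BN.double p) r))
      (BN.mul (BN.mul (BN.mul k2 r) d) (BN.sub (B m) (A' m))) ->
  hyp2F1 1 b c z * (2 * z - 1) <= 2 * c - 2.
Proof.
move=> d0 eS et /andP[AB]; have AB' := NR_lt AB.
have AB'' : BN.leb (A' m) (B m) by apply/BN.leb_le/BN.lt_le_incl/BN.ltb_lt.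
move/NR_le; rewrite !NR_mul NR_add !NR_mul NR_sub// ek.
have G1 : 1 <= hyp2F1 1 b c z by exact: hyp_gt0.
(* The truncated subtraction 2 p - r loses its sign when 2 z < 1; for 2 z <= 1 the left side is
   nonpositive while c >= 1. *)
have [h|h] := lerP (2 * z - 1) 0.
  move=> _; have : hyp2F1 1 b c z * (2 * z - 1) <= 0.
    by rewrite mulr_ge0_le0// (le_trans _ G1).
  by move/le_trans; apply; move: c1; lra.
have pr : BN.leb r (BN.double p).
  apply/BN.leb_le/BN.nlt_ge => /BN.ltb_lt/NR_lt; rewrite NR_double -ez ltNge.
  by rewrite mulrA ler_peMl ?(ltW r0)//; lra.
rewrite NR_sub// NR_double -ez.
have tl := @hyp1_tail_le b c z (Num.max (b + NR m) (c + NR m)) (BN.to_nat m) b0 c0 z01.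
move: AB'; rewrite eA' eB => AB'.
have cm : 0 < c + NR m by rewrite ltr_wpDr// NR_ge0.
have {}AB' : Num.max (b + NR m) (c + NR m) * z < c + NR m.
  by rewrite -(ltr_pM2r r0) -(@ltr_pM2l _ 2)// !mulrA; move: AB'; rewrite !mulrA.
have := tl _ _ AB'; rewrite -eS -et -/(NR m) !le_max !lexx orbT => /(_ isT isT).
move: AB'; move: (Num.max _ _) => M AB' hG hc.
have D0 : 0 < c + NR m - M * z by rewrite subr_gt0.
have e1 : NR S / NR d + NR t / NR d / (1 - M * z / (c + NR m)) =
  (NR S * (2 * (c + NR m) * NR r - 2 * M * (z * NR r)) + NR t * (2 * (c + NR m) * NR r))
   / (NR d * (2 * (c + NR m) * NR r - 2 * M * (z * NR r))).
  have -> : 2 * (c + NR m) * NR r - 2 * M * (z * NR r) = 2 * NR r * (c + NR m - M * z) by ring.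
  have -> : 1 - M * z / (c + NR m) = (c + NR m - M * z) / (c + NR m).
    by rewrite mulrBl divff// gt_eqF.
  by field; rewrite !gt_eqF.
rewrite e1 in hG.
have D0' : 0 < NR d * (2 * (c + NR m) * NR r - 2 * M * (z * NR r)).
  have -> : 2 * (c + NR m) * NR r - 2 * M * (z * NR r) = 2 * NR r * (c + NR m - M * z) by ring.
  by rewrite !mulr_gt0.
rewrite ler_pdivlMr// in hG.
rewrite -(ler_pM2r D0') -(ler_pM2r r0).
rewrite eC in hc; move: hc hG D0'.
set X := 2 * (c + NR m) * NR r - 2 * M * (z * NR r) => hc hG D0'.
have pos : 0 <= 2 * (z * NR r) - NR r.
  rewrite (_ : _ - _ = (2 * z - 1) * NR r); last by ring.
  by rewrite mulr_ge0 ?(ltW r0) ?(ltW h).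
rewrite (_ : _ * (2 * z - 1) * _ * _ = hyp2F1 1 b c z * (NR d * X) * (2 * (z * NR r) - NR r)); last by ring.
rewrite (_ : (2 * c - 2) * _ * _ = (2 * c - 2) * NR r * NR d * X); last by ring.
exact: le_trans (ler_wpM2r pos hG) hc.
Qed.

Lemma hyp1_check_sound fuel m S t d : 0 < NR d ->
  NR S / NR d = \sum_(0 <= i < BN.to_nat m) hyp_coef 1 b c i * z ^+ i ->
  NR t / NR d = hyp_coef 1 b c (BN.to_nat m) * z ^+ (BN.to_nat m) ->
  hyp1_check fuel bb k2 p r m S t d ->
  hyp2F1 1 b c z * (2 * z - 1) <= 2 * c - 2.
Proof.
elim: fuel m S t d => [|f IH] m S t d d0 eS et /=; case: ifP => h // h'.
- exact: check_base d0 eS et h.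
- exact: check_base d0 eS et h.
move: h'; apply: (IH (BN.succ m)); rewrite -/(C m) -/(B m) -/(A m).
- by rewrite NR_mul mulr_gt0// B0.
- rewrite (NR_mul d) (NR_mul (BN.add S t)) NR_add Nnat.N2Nat.inj_succ big_nat_recr//= -eS -et.
  by have := B0 m; move: (NR (B m)) => X X0; field; rewrite !gt_eqF.
- rewrite (NR_mul t) (NR_mul d) Nnat.N2Nat.inj_succ exprS.
  have cm : 0 < c + NR m by rewrite ltr_wpDr// NR_ge0.
  have e : hyp_coef 1 b c (BN.to_nat m).+1 =
      hyp_coef 1 b c (BN.to_nat m) * ((b + NR m) / (c + NR m)).
    apply: (@mulIf _ (c + NR m)); first by rewrite gt_eqF.
    by rewrite (hyp1_coefS b (BN.to_nat m) c0) -[RHS]mulrA divfK// gt_eqF.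
  rewrite e (_ : _ * _ * (z * _) = NR t / NR d * ((b + NR m) / (c + NR m) * z)).
    by rewrite eA eB; field; rewrite !gt_eqF.
  by rewrite et; ring.
Qed.

(** The omitted terms are all nonpositive, so no tail estimate is required. *)
Lemma hyp_half_le_partial (a : R) m : 0 < a ->
  hyp2F1 a (- (1 / 2)) c z <= \sum_(0 <= i < m.+1) hyp_coef a (- (1 / 2)) c i * z ^+ i.
Proof.
move=> a0; have hr := hyp_unit_radius a (- (1 / 2)) c0.
have := @psum_ge_partial R _ z m.+1 (@unit_radiusZ _ (-1) _ hr) z01.
rewrite -psumZ//; last exact: itv01_norm.
rewrite -hyp2F1E mulN1r => h; rewrite -lerN2 -sumrN.
apply: le_trans (h _); last first.
  by case=> // j _; rewrite mulN1r oppr_ge0 ltW// hyp_coef_half_lt0.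
by rewrite le_eqVlt; apply/orP; left; apply/eqP; apply: eq_bigr => i _; rewrite mulN1r mulNr.
Qed.

Let D (m : BinNums.N) :=
  BN.mul (BN.mul (BN.add (BN.succ (BN.succ (BN.succ (BN.succ k2)))) (BN.double m))
                 (BN.double (BN.succ (BN.succ m)))) r.
Let E (m : BinNums.N) :=
  BN.mul (BN.mul (BN.add bb (BN.succ (BN.double (BN.succ (BN.succ m)))))
                 (BN.succ (BN.double m))) p.

Let eD m : NR (D m) = 4 * (c + (NR m + 1)) * (NR m + 2) * NR r.
Proof. by rewrite /D !NR_mul NR_add !NR_double !NR_succ ek; ring. Qed.

Let eE m : NR (E m) = (2 * b + 2 * NR m + 5) * (2 * NR m + 1) * (z * NR r).
Proof. by rewrite /E !NR_mul NR_add !NR_succ !NR_double !NR_succ eb -ez; ring. Qed.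

(** The stopping test S >= d says that a partial sum, which bounds F from above, is nonpositive. *)
Lemma hyp_half_check_sound fuel m S t d : 0 < NR d ->
  NR S / NR d = 1 - \sum_(0 <= i < (BN.to_nat m).+1) hyp_coef (b + 3 / 2) (- (1 / 2)) c i * z ^+ i ->
  NR t / NR d = - (hyp_coef (b + 3 / 2) (- (1 / 2)) c (BN.to_nat m).+1 * z ^+ (BN.to_nat m).+1) ->
  hyp_half_check fuel bb k2 p r m S t d -> hyp2F1 (b + 3 / 2) (- (1 / 2)) c z <= 0.
Proof.
have a0 : 0 < b + 3 / 2 by rewrite addr_gt0// divr_gt0.
have fin m' S' d' : 0 < NR d' -> NR S' / NR d' =
    1 - \sum_(0 <= i < (BN.to_nat m').+1) hyp_coef (b + 3 / 2) (- (1 / 2)) c i * z ^+ i ->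
    BN.leb d' S' -> hyp2F1 (b + 3 / 2) (- (1 / 2)) c z <= 0.
  move=> d0 eS /NR_le dS; apply: le_trans (hyp_half_le_partial (BN.to_nat m') a0) _.
  have : 1 <= NR S' / NR d' by rewrite ler_pdivlMr// mul1r.
  by rewrite eS lerBrDr -lerBrDl subrr.
elim: fuel m S t d => [|f IH] m S t d d0 eS et /=; case: ifP => h // h'.
- exact: fin d0 eS h.
- exact: fin d0 eS h.
move: h'; apply: (IH (BN.succ m)); rewrite -/(D m) -/(E m).
all: have m0 := NR_ge0 m.
all: have D0 : 0 < NR (D m) by rewrite eD; do ?apply: mulr_gt0 => //; move: m0 c0; lra.
- by rewrite NR_mul mulr_gt0.
- rewrite (NR_mul d) (NR_mul (BN.add S t)) NR_add Nnat.N2Nat.inj_succ.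
  rewrite big_nat_recr//= opprD addrA -eS -et.
  by move: (NR (D m)) D0 => X X0; field; rewrite !gt_eqF.
- rewrite (NR_mul t) (NR_mul d) Nnat.N2Nat.inj_succ exprS.
  have := hyp_coefS (b + 3 / 2) (- (1 / 2)) (BN.to_nat m).+1 c0.
  rewrite -(natr1 (BN.to_nat m).+1) -(natr1 (BN.to_nat m)) -/(NR m) => e0.
  have q1 : 0 < c + (NR m + 1) by move: m0 c0; lra.
  have q2 : 0 < NR m + 1 + 1 by move: m0; lra.
  have e : hyp_coef (b + 3 / 2) (- (1 / 2)) c (BN.to_nat m).+2 =
    hyp_coef (b + 3 / 2) (- (1 / 2)) c (BN.to_nat m).+1 *
     ((b + 3 / 2 + (NR m + 1)) * (- (1 / 2) + (NR m + 1)) / ((c + (NR m + 1)) * (NR m + 1 + 1))).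
    apply: (@mulIf _ ((c + (NR m + 1)) * (NR m + 1 + 1))); first by rewrite gt_eqF// mulr_gt0.
    by rewrite e0 -[RHS]mulrA divfK// gt_eqF// mulr_gt0.
  rewrite e [RHS](_ : _ = NR t / NR d * ((b + 3 / 2 + (NR m + 1)) * (- (1 / 2) + (NR m + 1))
      / ((c + (NR m + 1)) * (NR m + 1 + 1)) * z)); last by rewrite et; ring.
  have q3 : 0 < NR m + 2 by move: m0; lra.
  by rewrite eE eD; field; rewrite !gt_eqF.
Qed.

End Soundness.

End NumericalCheck.

(** * The inequality at the zero of F in all cases *)

Section CoreInequality.

(** Runs over 7 <= n <= 43 and 3 <= k <= n - 3 with n <= 3k, at the point 2k / (n + k - 1). Values k
    <= 2 do not occur, since n <= 3k and n >= 7 force k >= 3. *)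
Definition small_check : bool :=
  all (fun n => all (fun k => if (3 * k < n)%N then true else
    hyp1_check 40 (BN.of_nat (n - 4)) (BN.of_nat (k - 2)) (BN.of_nat (2 * k))
      (BN.of_nat (n + k - 1)) BN.zero BN.zero BN.one BN.one) (iota 3 (n - 5))) (iota 7 37).

Lemma small_checkE : small_check.
Proof. vm_cast_no_check (erefl true). Qed.

Lemma small_checkP n k : (7 <= n < 44)%N -> (3 <= k)%N -> (k + 3 <= n)%N -> (n <= 3 * k)%N ->
  hyp1_check 40 (BN.of_nat (n - 4)) (BN.of_nat (k - 2)) (BN.of_nat (2 * k))
      (BN.of_nat (n + k - 1)) BN.zero BN.zero BN.one BN.one.
Proof.
move=> n7 k3 kn nk; have /allP h := small_checkE.
have {h} /allP h : _ := h n ltac:(rewrite mem_iota; lia).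
by have := h k ltac:(rewrite mem_iota; lia); case: ifP => //; lia.
Qed.

Variable R : realType.
Implicit Types (b c s : R).

Local Notation F b c := (hyp2F1 (b + 3 / 2) (- (1 / 2)) c).
Local Notation G b c := (hyp2F1 1 b c).

Lemma NR_of_nat m : NR R (BN.of_nat m) = m%:R.
Proof. by rewrite /NR Nnat.Nat2N.id. Qed.

(** Where 2 s > 1 the left side is a product of two positive increasing factors; elsewhere it is
    nonpositive and c >= 1. *)
Lemma core_le b c s sigma : 0 < b -> 1 <= c -> 0 <= s <= sigma -> sigma < 1 ->
  G b c sigma * (2 * sigma - 1) <= 2 * c - 2 -> G b c s * (2 * s - 1) <= 2 * c - 2.
Proof.
move=> b0 c1 /andP[s0 ss] sg1 h; have c0 : 0 < c by lra.
have G1 : 1 <= G b c s by apply: hyp_gt0 => //; rewrite s0 (le_lt_trans ss).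
have [h1|h1] := lerP (2 * s - 1) 0.
  have : G b c s * (2 * s - 1) <= 0 by rewrite mulr_ge0_le0//; lra.
  by lra.
apply: le_trans h; apply: ler_pM; [lra|lra| |lra].
by apply: hyp1_le => //; rewrite s0.
Qed.

Lemma core_check (bb k2 p r : BinNums.N) fuel b c s sigma : NR R bb = 2 * b ->
  NR R k2 = 2 * c - 2 -> 0 < b -> 1 <= c -> 0 < NR R r -> sigma * NR R r = NR R p ->
  0 <= s <= sigma -> sigma < 1 ->
  hyp1_check fuel bb k2 p r BN.zero BN.zero BN.one BN.one ->
  G b c s * (2 * s - 1) <= 2 * c - 2.
Proof.
move=> eb ek b0 c1 r0 ez ss sg1 chk; apply: (@core_le b c s sigma) => //.
have /andP[s0 s1] := ss.
have z01 : 0 <= sigma < 1 by rewrite (le_trans s0).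
apply: (hyp1_check_sound eb ek b0 c1 r0 ez z01 _ _ _ chk).
- by rewrite /NR /= ltr01.
- by rewrite /NR /= mul0r big_nil.
- by rewrite /NR /= hyp_coef0 expr0 !mulr1 divr1.
Qed.

Lemma half_check (bb k2 p r t d : BinNums.N) fuel b c sigma : NR R bb = 2 * b ->
  NR R k2 = 2 * c - 2 -> 0 < b -> 1 <= c -> 0 < NR R r -> sigma * NR R r = NR R p ->
  0 <= sigma < 1 -> 0 < NR R d -> NR R t / NR R d = (b + 3 / 2) / (2 * c) * sigma ->
  hyp_half_check fuel bb k2 p r BN.zero BN.zero t d -> F b c sigma <= 0.
Proof.
move=> eb ek b0 c1 r0 ez z01 d0 et chk.
apply: (hyp_half_check_sound eb ek b0 c1 r0 ez z01 d0 _ _ chk).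
- by rewrite /NR /= mul0r big_nat1 hyp_coef0 expr0 mulr1 subrr.
- have c0 : 0 < c by lra.
  rewrite et /= expr1; have := hyp_coefS (b + 3 / 2) (- (1 / 2)) 0 c0.
  rewrite hyp_coef0 !addr0 mulr1 => e.
  have -> : hyp_coef (b + 3 / 2) (- (1 / 2)) c 1 = (b + 3 / 2) * - (1 / 2) / c.
    by rewrite -[X in X / c](mul1r) -e mulfK// gt_eqF.
  by field; rewrite gt_eqF.
Qed.

(* k = n - 2, n = 7, 8, 9; the points sigma were found numerically. *)
Lemma core_last_small (fuel n p r : nat) s : (6 < n < 10)%N -> (0 < p < r)%N ->
  hyp_half_check fuel (BN.of_nat (n - 4)) (BN.of_nat (n - 4)) (BN.of_nat p) (BN.of_nat r)
     BN.zero BN.zero (BN.of_nat ((n - 1) * p)) (BN.of_nat (2 * (n - 2) * r)) ->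
  hyp1_check fuel (BN.of_nat (n - 4)) (BN.of_nat (n - 4)) (BN.of_nat p) (BN.of_nat r)
     BN.zero BN.zero BN.one BN.one ->
  let b := (n%:R - 4) / 2 in 0 < s < 1 -> F b (b + 1) s = 0 ->
  G b (b + 1) s * (2 * s - 1) <= 2 * (b + 1) - 2.
Proof.
move=> /andP[n7 n9] /andP[p0 pr] ch1 ch2 b s01 e; have /andP[s0 s1] := s01.
have n7' : 7 <= n%:R :> R by rewrite ler_nat.
have b0 : 0 < b by rewrite /b; lra.
have c1 : 1 <= b + 1 by lra.
have c0 : 0 < b + 1 by lra.
have p0' : 0 < p%:R :> R by rewrite ltr0n.
have r0' : 0 < r%:R :> R by rewrite ltr0n (leq_trans _ pr).
have eb : NR R (BN.of_nat (n - 4)) = 2 * b.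
  by rewrite NR_of_nat natrB ?(leq_trans _ n7)// /b; field.
have ek : NR R (BN.of_nat (n - 4)) = 2 * (b + 1) - 2 by rewrite eb; ring.
have er : 0 < NR R (BN.of_nat r) by rewrite NR_of_nat.
have ez : p%:R / r%:R * NR R (BN.of_nat r) = NR R (BN.of_nat p).
  by rewrite !NR_of_nat divfK// gt_eqF.
have sg1 : p%:R / r%:R < 1 :> R by rewrite ltr_pdivrMr// mul1r ltr_nat.
have sg0 : 0 < p%:R / r%:R :> R by rewrite divr_gt0.
have hF : F b (b + 1) (p%:R / r%:R) <= 0.
  apply: (half_check eb ek b0 c1 er ez _ _ _ ch1).
  - by rewrite ltW.
  - by rewrite NR_of_nat ltr0n !muln_gt0 (leq_trans _ pr)//= subn_gt0 (leq_trans _ n7).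
  - rewrite !NR_of_nat !natrM !natrB ?(leq_trans _ n7)// /b.
    by field; rewrite ?gt_eqF//; lra.
apply: (core_check (sigma := p%:R / r%:R) eb ek b0 c1 er ez _ sg1 ch2).
rewrite ltW//=; apply: (hyp_zero_le _ c0 s01 e) => //; first by lra.
by rewrite sg0.
Qed.

Lemma core_inequality (n k : nat) s : (7 <= n)%N -> (1 <= k)%N -> (k <= n - 2)%N ->
  0 < s < 1 -> hyp2F1 ((n%:R - 1) / 2) (- (1 / 2)) (k%:R / 2) s = 0 ->
  hyp2F1 1 ((n%:R - 4) / 2) (k%:R / 2) s * (2 * s - 1) <= k%:R - 2.
Proof.
move=> n7 k1 kn s01; have /andP[s0 s1] := s01.
have [b eb] : exists b, b = (n%:R - 4) / 2 :> R by exists ((n%:R - 4) / 2).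
have [c ec] : exists c, c = k%:R / 2 :> R by exists (k%:R / 2).
have -> : (n%:R - 1) / 2 = b + 3 / 2 by rewrite eb; field.
rewrite -eb -ec => Fs.
have n7' : 7 <= n%:R :> R by rewrite ler_nat.
have k1' : 1 <= k%:R :> R by rewrite ler1n.
have n2 : (n - 2)%:R = n%:R - 2 :> R by rewrite natrB// (leq_trans _ n7).
have -> : k%:R - 2 = 2 * c - 2 by rewrite ec; field.
have b32 : 3 / 2 <= b by rewrite eb; lra.
have b0 : 0 < b by lra.
have c0 : 0 < c by rewrite ec; lra.
case: (ltngtP k 1) => k1s; first by case: k k1 k1s {ec k1' kn} => [|[|k]].
2: {
  have ec1 : c = 1 / 2 by rewrite ec k1s.
  rewrite ec1 in Fs *; have := core_first b32 s01 Fs; lra. }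
have k2' : 2 <= k%:R :> R by rewrite ler_nat.
have c1 : 1 <= c by rewrite ec; lra.
have [kn2|kn2] := eqVneq k (n - 2)%N.
  have ecb : c = b + 1 by rewrite ec eb kn2 n2; field.
  rewrite ecb in Fs *.
  have [n10|] := leqP 10 n.
    have : 10 <= n%:R :> R by rewrite ler_nat.
    by move=> h; apply: core_last => //; rewrite eb; lra.
  move=> n9; rewrite eb in Fs *.
  have : n \in [:: 7; 8; 9]%N.
    by move: n7 n9; clear; case: n => [|[|[|[|[|[|[|[|[|[|n]]]]]]]]]].
  rewrite !inE => /or3P[] /eqP en; rewrite en in Fs *.
  - by apply: (@core_last_small 60 7 13 14 s) => //; vm_compute.
  - by apply: (@core_last_small 60 8 33 35 s) => //; vm_compute.
  - by apply: (@core_last_small 60 9 20 21 s) => //; vm_compute.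
have kn3 : (k + 3 <= n)%N.
  by move: kn kn2; clear; lia.
have kn3' : k%:R + 3 <= n%:R :> R by rewrite -natrD ler_nat.
have ca : c + 1 <= b + 3 / 2 by rewrite ec eb; lra.
have hs := hyp_zero_bound c0 ca s01 Fs.
have den : 0 < b + 3 / 2 + c by lra.
(* 3k <= n - 1 is exactly the condition for 2k / (n + k - 1) <= 1/2. *)
have [k3n|k3n] := ltnP (3 * k) n.
  have : (3 * k).+1%:R <= n%:R :> R by rewrite ler_nat.
  rewrite -natr1 natrM => h3.
  have sh : 2 * s - 1 <= 0.
    rewrite ler_pdivlMr// in hs.
    have : s * (b + 3 / 2 + c) <= (1 / 2) * (b + 3 / 2 + c).
      by apply: le_trans hs _; rewrite ec eb; lra.
    by rewrite ler_pM2r//; lra.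
  have G1 : 1 <= G b c s by apply: hyp_gt0 => //; rewrite ltW.
  have : G b c s * (2 * s - 1) <= 0 by rewrite mulr_ge0_le0//; lra.
  by lra.
have k3n' : n%:R <= 3 * k%:R :> R by rewrite -natrM ler_nat.
have [n44|n43] := leqP 44 n.
  have : 44 <= n%:R :> R by rewrite ler_nat.
  move=> h; apply: core_log => //; rewrite ?ec eb; lra.
have k3 : (3 <= k)%N by move: k3n n7; clear; lia.
have n743 : (7 <= n < 44)%N by rewrite n7.
have chk := small_checkP n743 k3 kn3 k3n.
have r0 : 0 < NR R (BN.of_nat (n + k - 1)).
  by rewrite NR_of_nat ltr0n; move: n7; clear; lia.
apply: (core_check (sigma := 2 * c / (b + 3 / 2 + c)) _ _ b0 c1 r0 _ _ _ chk).
- by rewrite NR_of_nat natrB ?(leq_trans _ n7)// eb; field.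
- by rewrite NR_of_nat natrB ?(ltnW k3)// ec; field.
- rewrite !NR_of_nat natrM natrB ?natrD; last by rewrite (leq_trans _ (leq_addl _ _)).
  by rewrite ec eb; field; lra.
- by rewrite ltW.
- by rewrite ltr_pdivrMr// mul1r; lra.
Qed.

End CoreInequality.

(** * Directional derivatives of functions of a row vector *)

Section VectorDerivatives.
Variables (R : realType) (d : nat).
Implicit Types (phi psi : 'rV[R]_d -> R) (p v u : 'rV[R]_d) (O : set 'rV[R]_d).

(** Restricting to the line through p in direction v transfers the one-variable rules to directional
    derivatives. *)
Lemma is_derive_line phi p v (l : R) :
  is_derive p v phi l <-> is_derive (0 : R) (1 : R) (fun t : R => phi (t *: v + p)) l.
Proof.
have E : (fun h : R => h^-1 *: (phi (h *: v + p) - phi p)) =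
  (fun h : R => h^-1 *: (phi ((h *: (1 : R) + 0) *: v + p) - phi ((0 : R) *: v + p))).
  apply/funext => h; rewrite scale0r add0r addr0.
  by rewrite -[h *: 1]/(h * 1) mulr1.
split=> -[h1 h2]; split.
- by rewrite /derivable -E.
- by rewrite /derive -E.
- by rewrite /derivable E.
- by rewrite /derive E.
Qed.

Lemma is_derive_vmul phi psi p v (l m : R) : is_derive p v phi l -> is_derive p v psi m ->
  is_derive p v (fun q => phi q * psi q) (l * psi p + phi p * m).
Proof.
move=> /is_derive_line h1 /is_derive_line h2; apply/is_derive_line.
by have := is_derive_mul h1 h2; rewrite scale0r add0r.
Qed.

Lemma is_derive_vadd phi psi p v (l m : R) : is_derive p v phi l -> is_derive p v psi m ->
  is_derive p v (fun q => phi q + psi q) (l + m).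
Proof.
move=> /is_derive_line h1 /is_derive_line h2.
exact: (proj2 (is_derive_line _ _ _ _) (is_derive_add h1 h2)).
Qed.

Lemma is_derive_vconst (k : R) p v : is_derive p v (fun=> k) 0.
Proof. by apply/is_derive_line; exact: is_derive_const. Qed.

Lemma is_derive_vcomp phi (h : R -> R) p v (l m : R) : is_derive p v phi l ->
  is_derive (phi p) (1 : R) h m -> is_derive p v (fun q => h (phi q)) (m * l).
Proof.
move=> /is_derive_line h1 h2; apply/is_derive_line.
by apply: (is_derive_compose h1); rewrite scale0r add0r.
Qed.

Lemma is_derive_coord (i : 'I_d) p v : is_derive p v (fun q => q ord0 i) (v ord0 i).
Proof.
apply/is_derive_line.
have := is_derive_add (is_derive_mul (is_derive_ident (0 : R)) (is_derive_const (v ord0 i) 0))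
  (is_derive_const (p ord0 i) 0).
rewrite mul0r addr0 addr0 mul1r => h.
by apply: is_derive_ext h _ => t; rewrite !mxE.
Qed.

Lemma is_derive_veq phi p v (l m : R) : is_derive p v phi l -> l = m -> is_derive p v phi m.
Proof. by move=> h <-. Qed.

Lemma is_derive_vsum (I : finType) (f : I -> 'rV[R]_d -> R) p v (l : I -> R) :
  (forall i, is_derive p v (f i) (l i)) ->
  is_derive p v (fun q => \sum_i f i q) (\sum_i l i).
Proof.
move=> h; rewrite -![index_enum I]/(index_enum I); elim: (index_enum I) => [|i s IH].
  rewrite big_nil; have := is_derive_vconst 0 p v; congr is_derive.
  by apply/funext => q; rewrite big_nil.
rewrite big_cons; have := is_derive_vadd (h i) IH; congr is_derive.
by apply/funext => q; rewrite big_cons.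
Qed.

Lemma open_near_eq O phi psi p : open O -> O p -> (forall q, O q -> phi q = psi q) ->
  \near p, phi p = psi p.
Proof.
by move=> oO Op h; near=> q; apply: h; near: q; exact: open_nbhs_nbhs.
Unshelve. all: by end_near. Qed.

Lemma is_derive_local O phi psi p v (l : R) : open O -> O p ->
  (forall q, O q -> phi q = psi q) -> is_derive p v phi l -> is_derive p v psi l.
Proof.
move=> oO Op h; apply: near_eq_is_derive.
exact: open_near_eq oO Op h.
Qed.

Lemma continuous_local O phi psi p : open O -> O p -> (forall q, O q -> phi q = psi q) ->
  {for p, continuous phi} -> {for p, continuous psi}.
Proof.
move=> oO Op h cp.
suff hs : psi x @[x --> nbhs p] --> psi p by exact: hs.
apply/cvgrPdist_le => e e0.
have h1 : \forall q \near nbhs p, O q by exact: open_nbhs_nbhs.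
have /cvgrPdist_le/(_ e e0) h2 := cp.
by apply: filterS2 h1 h2 => q Oq; rewrite !h.
Qed.

End VectorDerivatives.

(** * Closure properties of C^N functions *)

Section SmoothClosure.
Variables (R : realType) (d : nat) (O : set 'rV[R]_d).
Hypothesis oO : open O.
Implicit Types (phi psi : 'rV[R]_d -> R) (p v : 'rV[R]_d).

(* Same as Ck_on, but peeling off the innermost derivative first. *)
Fixpoint Ck_rec (N : nat) phi : Prop :=
  (forall p, O p -> {for p, continuous phi}) /\
  (if N is M.+1 then
     (forall p v, O p -> derivable phi p v) /\ forall v, Ck_rec M (fun p => 'D_v phi p)
   else True).

Lemma Ck_rec_on N phi : Ck_rec N phi -> Ck_on N O phi.
Proof.
elim: N phi => [|N IH] phi [hc hd] vs.
  by rewrite leqn0 size_eq0 => /eqP -> p Op; split; first exact: hc.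
case: hd => hd1 hd2; case/lastP: vs => [|vs v] sz p Op.
  by split; [exact: hc|move=> _ v; exact: hd1].
rewrite size_rcons ltnS in sz *.
rewrite /iter_derive foldr_rcons -/(iter_derive vs (fun q => 'D_v phi q)).
exact: IH (hd2 v) vs sz p Op.
Qed.

Lemma Ck_rec_continuous N phi : Ck_rec N phi -> forall p, O p -> {for p, continuous phi}.
Proof. by case: N => [|N] []. Qed.

Lemma Ck_recW N phi : Ck_rec N.+1 phi -> Ck_rec N phi.
Proof.
elim: N phi => [|N IH] phi [h1 [h2 h3]]; first by split.
by split => //; split => // v; exact: IH (h3 v).
Qed.

Lemma Ck_rec_eq N phi psi : (forall p, O p -> phi p = psi p) -> Ck_rec N phi -> Ck_rec N psi.
Proof.
elim: N phi psi => [|N IH] phi psi e [h1 h2].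
  by split => // p Op; apply: (continuous_local oO Op e); exact: h1.
split; first by move=> p Op; apply: (continuous_local oO Op e); exact: h1.
case: h2 => h2 h3.
have D p v : O p -> is_derive p v psi ('D_v phi p).
  move=> Op; apply: (is_derive_local oO Op e); apply: DeriveDef => //.
  exact: h2.
split; first by move=> p v Op; have [] := D p v Op.
by move=> v; apply: IH (h3 v) => p Op; have [_ ->] := D p v Op.
Qed.

Lemma Ck_recS N phi (dphi : 'rV[R]_d -> 'rV[R]_d -> R) :
  (forall p, O p -> {for p, continuous phi}) ->
  (forall p v, O p -> is_derive p v phi (dphi v p)) ->
  (forall v, Ck_rec N (dphi v)) -> Ck_rec N.+1 phi.
Proof.
move=> h1 h2 h3; split => //; split; first by move=> p v Op; have [] := h2 p v Op.
by move=> v; apply: Ck_rec_eq (h3 v) => p Op; have [_ ->] := h2 p v Op.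
Qed.

Lemma Ck_rec_derive N phi p v : Ck_rec N.+1 phi -> O p -> is_derive p v phi ('D_v phi p).
Proof. by move=> [_ [h _]] Op; apply: DeriveDef => //; exact: h. Qed.

Lemma Ck_rec_D N phi v : Ck_rec N.+1 phi -> Ck_rec N (fun p => 'D_v phi p).
Proof. by move=> [_ [_ h]]; exact: h. Qed.

Lemma Ck_rec_const N (k : R) : Ck_rec N (fun=> k).
Proof.
elim: N k => [|N IH] k; first by split => // p _; exact: cst_continuous.
apply: (@Ck_recS _ _ (fun _ _ => 0)) => //; by move=> p _; exact: cst_continuous.
Qed.

Lemma Ck_rec_coord N (i : 'I_d) : Ck_rec N (fun p => p ord0 i).
Proof.
case: N => [|N]; first by split => // p _; exact: coord_continuous.
apply: (@Ck_recS _ _ (fun v _ => v ord0 i)).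
- by move=> p _; exact: coord_continuous.
- by move=> p v _; exact: is_derive_coord.
- by move=> v; exact: Ck_rec_const.
Qed.

Lemma Ck_rec_add N phi psi : Ck_rec N phi -> Ck_rec N psi ->
  Ck_rec N (fun p => phi p + psi p).
Proof.
elim: N phi psi => [|N IH] phi psi h1 h2.
  by split => // p Op; exact: (cvgD (@Ck_rec_continuous _ _ h1 p Op) (@Ck_rec_continuous _ _ h2 p Op)).
apply: (@Ck_recS _ _ (fun v p => 'D_v phi p + 'D_v psi p)).
- by move=> p Op; exact: (cvgD (@Ck_rec_continuous _ _ h1 p Op) (@Ck_rec_continuous _ _ h2 p Op)).
- by move=> p v Op; apply: is_derive_vadd; [exact: Ck_rec_derive h1 Op|exact: Ck_rec_derive h2 Op].
- by move=> v; apply: IH; [exact: Ck_rec_D h1|exact: Ck_rec_D h2].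
Qed.

Lemma Ck_rec_mul N phi psi : Ck_rec N phi -> Ck_rec N psi ->
  Ck_rec N (fun p => phi p * psi p).
Proof.
elim: N phi psi => [|N IH] phi psi h1 h2.
  by split => // p Op; exact: (cvgM (@Ck_rec_continuous _ _ h1 p Op) (@Ck_rec_continuous _ _ h2 p Op)).
apply: (@Ck_recS _ _ (fun v p => 'D_v phi p * psi p + phi p * 'D_v psi p)).
- by move=> p Op; exact: (cvgM (@Ck_rec_continuous _ _ h1 p Op) (@Ck_rec_continuous _ _ h2 p Op)).
- by move=> p v Op; apply: is_derive_vmul; [exact: Ck_rec_derive h1 Op|exact: Ck_rec_derive h2 Op].
- move=> v; apply: Ck_rec_add; apply: IH.
  + exact: Ck_rec_D h1.
  + exact: Ck_recW h2.
  + exact: Ck_recW h1.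
  + exact: Ck_rec_D h2.
Qed.

Lemma Ck_rec_sum N (I : finType) (f : I -> 'rV[R]_d -> R) :
  (forall i, Ck_rec N (f i)) -> Ck_rec N (fun p => \sum_i f i p).
Proof.
move=> h; rewrite -[index_enum I]/(index_enum I); elim: (index_enum I) => [|i s IH].
  by apply: Ck_rec_eq (Ck_rec_const N 0) => p _; rewrite big_nil.
by apply: Ck_rec_eq (Ck_rec_add (h i) IH) => p _; rewrite big_cons.
Qed.

(** [h] lists the successive derivatives of [h 0]. The statement covers all of them at once because
    the chain rule passes from [h j] to [h j.+1] in the induction on N. *)
Lemma Ck_rec_comp N phi (h : nat -> R -> R) (J : set R) :
  (forall j y, J y -> is_derive y (1 : R) (h j) (h j.+1 y)) ->
  (forall p, O p -> J (phi p)) -> Ck_rec N phi -> forall j, Ck_rec N (fun p => h j (phi p)).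
Proof.
move=> dh hJ; elim: N => [|N IH] hp j.
  split => // p Op; apply: continuous_comp; first exact: (@Ck_rec_continuous _ _ hp p Op).
  exact: is_derive_continuous (dh j _ (hJ p Op)).
apply: (@Ck_recS _ _ (fun v p => h j.+1 (phi p) * 'D_v phi p)).
- move=> p Op; apply: continuous_comp; first exact: (@Ck_rec_continuous _ _ hp p Op).
  exact: is_derive_continuous (dh j _ (hJ p Op)).
- by move=> p v Op; apply: is_derive_vcomp; [exact: Ck_rec_derive hp Op|exact/dh/hJ].
- by move=> v; apply: Ck_rec_mul; [exact/IH/Ck_recW|exact: Ck_rec_D hp].
Qed.

Definition smooth_rec phi := forall N, Ck_rec N phi.

Lemma smooth_rec_on phi : smooth_rec phi -> smooth_on O phi.
Proof. by move=> h N; exact: Ck_rec_on. Qed.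

End SmoothClosure.

(** * Linearity of the directional derivative of a C^1 function *)

Section DirectionalLinearity.
Variables (R : realType) (d : nat) (O : set 'rV[R]_d) (psi : 'rV[R]_d -> R).
Hypotheses (oO : open O) (C1 : Ck_on 1 O psi).
Implicit Types (p u v : 'rV[R]_d).

Let der p v : O p -> derivable psi p v.
Proof. by move=> Op; exact: (C1 (vs := [::]) isT Op).2. Qed.

Let cont v p : O p -> {for p, continuous (fun q => 'D_v psi q)}.
Proof. by move=> Op; exact: (C1 (vs := [:: v]) isT Op).1. Qed.

Lemma derive_dirZ p v (a : R) : O p -> 'D_(a *: v) psi p = a * 'D_v psi p.
Proof.
move=> Op; have /is_derive_line h : is_derive p v psi ('D_v psi p).
  by apply: DeriveDef => //; exact: der.
suff [_ ->] : is_derive p (a *: v) psi (a * 'D_v psi p) by [].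
apply/is_derive_line.
have e : is_derive (0 : R) (1 : R) (fun t : R => t * a) a.
  apply: is_derive_eq_val (is_derive_mul (is_derive_ident 0) (is_derive_const a 0)) _.
  by rewrite mul1r mul0r addr0.
have h' : is_derive (0 * a) (1 : R) (fun t : R => psi (t *: v + p)) ('D_v psi p).
  by rewrite mul0r.
have := is_derive_compose e h'; rewrite mulrC => h2.
by apply: is_derive_ext h2 _ => t /=; rewrite scalerA.
Qed.

(* Mean value theorem along the second leg of the path p -> p + h u -> p + h (u + v). *)
Lemma derive_dirD p u v : O p -> 'D_(u + v) psi p = 'D_u psi p + 'D_v psi p.
Proof.
move=> Op.
have hu : h^-1 *: (psi (h *: u + p) - psi p) @[h --> 0^'] --> 'D_u psi p by exact: der.
suff hv : h^-1 *: (psi (h *: (u + v) + p) - psi (h *: u + p)) @[h --> 0^'] --> 'D_v psi p.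
  have hs : h^-1 *: (psi (h *: (u + v) + p) - psi p) @[h --> 0^'] -->
      'D_u psi p + 'D_v psi p.
    rewrite (_ : (fun h : R => h^-1 *: (psi (h *: (u + v) + p) - psi p)) =
      (fun h => h^-1 *: (psi (h *: u + p) - psi p) +
        h^-1 *: (psi (h *: (u + v) + p) - psi (h *: u + p)))); first exact: cvgD hu hv.
    by apply/funext => h; rewrite -scalerDr [_ - psi p + _]addrC subrKA.
  exact: cvg_lim hs.
apply/cvgrPdist_le => e e0.
have [dl dl0 hd] : exists2 dl : R, 0 < dl & forall q, `|p - q| < dl ->
    O q /\ `|'D_v psi p - 'D_v psi q| <= e.
  have h1 : \forall q \near p, O q by exact: open_nbhs_nbhs.
  have /cvgrPdist_le/(_ e e0) h2 := @cont v p Op.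
  have [dl dl0 hd] := proj1 (nbhs_normP p _) (filterI h1 h2); by exists dl.
near=> h.
have h0 : h != 0 by near: h; exact: nbhs_dnbhs_neq.
have K0 : 0 < `|u| + `|v| + 1 by rewrite ltr_wpDl// addr_ge0.
have hh : `|h| * (`|u| + `|v| + 1) < dl.
  by rewrite -ltr_pdivlMr//; near: h; apply: dnbhs0_lt; rewrite divr_gt0.
pose q (t : R) := (t * h) *: v + (h *: u + p).
have hq (t : R) : 0 <= t <= 1 -> O (q t) /\ `|'D_v psi p - 'D_v psi (q t)| <= e.
  move=> /andP[t0 t1]; apply: hd; rewrite /q addrA opprD addrCA subrr addr0 normrN.
  have hn : t * `|h| <= `|h| by rewrite ler_piMl.
  apply: le_lt_trans hh; apply: (le_trans (ler_normD _ _)); rewrite !normrZ (ger0_norm t0).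
  apply: (@le_trans _ _ (`|h| * `|v| + `|h| * `|u|)); first by rewrite lerD2r ler_wpM2r.
  by have := normr_ge0 h; lra.
have dq (t : R) : is_derive t (1 : R) (fun y => psi (q y)) ('D_v psi (q t) * h) \/ ~ O (q t).
  have [Oq|nOq] := pselect (O (q t)); [left|by right].
  have /is_derive_line h1 := DeriveDef (@der (q t) v Oq) erefl.
  have e1 : is_derive t (1 : R) (fun y : R => (y - t) * h) h.
    apply: is_derive_eq_val (is_derive_mul (is_derive_sub (is_derive_ident t)
      (is_derive_const t t)) (is_derive_const h t)) _.
    by rewrite subr0 mul1r mulr0 addr0.
  have h2 : is_derive ((t - t) * h) (1 : R) (fun y : R => psi (y *: v + q t)) ('D_v psi (q t)).
    by rewrite subrr mul0r.
  apply: is_derive_ext (is_derive_compose e1 h2) _ => y /=.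
  by congr psi; rewrite /q addrA -scalerDl -mulrDl subrK.
have dq' (t : R) : 0 <= t <= 1 -> is_derive t (1 : R) (fun y => psi (q y)) ('D_v psi (q t) * h).
  by move=> /hq[Oq _]; case: (dq t).
have [||c c01 e1] := @MVT_segment _ (fun y => psi (q y)) (fun y => 'D_v psi (q y) * h) 0 1 ler01.
- by move=> y; rewrite in_itv /= => /andP[y0 y1]; apply: dq'; rewrite !ltW.
- by apply: derivable_within_continuous => y; rewrite in_itv /= => /dq'[].
have [_] := hq c c01; congr (_ <= _); congr (`|_ - _|).
have -> : psi (h *: (u + v) + p) = psi (q 1).
  by congr psi; rewrite /q mul1r scalerDr addrA [h *: v + _]addrC.
have -> : psi (h *: u + p) = psi (q 0) by rewrite /q mul0r scale0r add0r.
by rewrite e1 subr0 mulr1 -[RHS]/(_ * _) mulrC mulfK.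
Unshelve. all: by end_near. Qed.

(** [Ck_on] speaks only of separate directional derivatives, while the uniqueness of the normal
    needs the derivative in an arbitrary direction in terms of [grad]. *)
Lemma derive_dir_grad p v : O p ->
  'D_v psi p = \sum_i grad psi p ord0 i * v ord0 i.
Proof.
move=> Op.
have D0 : 'D_(0 : 'rV[R]_d) psi p = 0.
  by have := derive_dirZ 0 0 Op; rewrite scale0r mul0r.
rewrite [X in 'D_X psi p]row_sum_delta.
elim/big_ind2 : _ => //; first by move=> ? ? ? ? <- <-; exact: derive_dirD.
by move=> i _; rewrite derive_dirZ// mxE mulrC.
Qed.

End DirectionalLinearity.

(** * Smoothness and harmonicity of V *)

Section Potential.
Variables (R : realType) (n k : nat).
Hypotheses (k1 : (1 <= k)%N) (kn : (k <= n)%N).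
Local Notation E := ('rV[R]_(n - k + k)).
Local Notation J := ('I_(n - k + k)).
Implicit Types (p q v : E) (w : J -> R).

Definition ycoord (i : J) : R := (n - k <= i)%N%:R.

(** |p|^2, |y|^2 and the function defining the cone are all diagonal quadratic forms, so one
    derivative rule serves for the three. *)
Definition diag_form w p v : R := \sum_i w i * (p ord0 i * v ord0 i).

Definition sqnorm p : R := diag_form (fun=> 1) p p.
Definition ysqnorm p : R := diag_form ycoord p p.

Lemma ycoord_idem i : ycoord i * ycoord i = ycoord i.
Proof. by rewrite /ycoord; case: (_ <= _)%N; rewrite ?mulr1 ?mulr0. Qed.

Lemma ycoord_sum : \sum_i ycoord i = k%:R.
Proof.
rewrite big_split_ord /= big1 ?add0r; last first.
  by move=> i _; rewrite /ycoord /= leqNgt ltn_ord.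
rewrite (eq_bigr (fun=> 1)); last by move=> i _; rewrite /ycoord /= leq_addr.
by rewrite sumr_const card_ord.
Qed.

Lemma ynormE p : ynorm p ^+ 2 = ysqnorm p.
Proof.
rewrite /ynorm /enorm sqr_sqrtr; last by apply: sumr_ge0 => i _; exact: sqr_ge0.
rewrite /ysqnorm /diag_form big_split_ord /= [X in _ = X + _]big1 ?add0r; last first.
  by move=> i _; rewrite /ycoord /= leqNgt ltn_ord mul0r.
by apply: eq_bigr => i _; rewrite /ycoord /= leq_addr mul1r mxE expr2.
Qed.

Lemma xynormE p : xnorm p ^+ 2 + ynorm p ^+ 2 = sqnorm p.
Proof.
rewrite ynormE /xnorm /enorm sqr_sqrtr; last by apply: sumr_ge0 => i _; exact: sqr_ge0.
rewrite /ysqnorm /sqnorm /diag_form !big_split_ord /= [X in _ + (X + _) = _]big1 ?add0r.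
  congr (_ + _); apply: eq_bigr => i _; first by rewrite mxE mul1r expr2.
  by rewrite /ycoord /= leq_addr.
by move=> i _; rewrite /ycoord /= leqNgt ltn_ord mul0r.
Qed.

Lemma ysqnorm_ge0 p : 0 <= ysqnorm p.
Proof. by rewrite -ynormE sqr_ge0. Qed.

Lemma sqnorm_ge0 p : 0 <= sqnorm p.
Proof. by rewrite -xynormE addr_ge0// sqr_ge0. Qed.

Lemma sqnorm_gt0 p : p != 0 -> 0 < sqnorm p.
Proof.
move=> p0; rewrite lt_neqAle sqnorm_ge0 andbT eq_sym; apply: contra_neq p0 => h.
have h0 i : 0 <= 1 * (p ord0 i * p ord0 i) by rewrite mul1r -expr2 sqr_ge0.
apply/rowP => i; rewrite mxE; apply/eqP.
have /eqP := h; rewrite /sqnorm /diag_form psumr_eq0// => /allP/(_ i).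
by rewrite mem_index_enum mul1r mulf_eq0 orbb => /(_ isT).
Qed.

Lemma is_derive_diag w p v :
  is_derive p v (fun q => diag_form w q q) (2 * diag_form w p v).
Proof.
have h i := is_derive_vmul (is_derive_vconst (w i) p v)
  (is_derive_vmul (is_derive_coord i p v) (is_derive_coord i p v)).
apply: is_derive_veq (is_derive_vsum h) _.
by rewrite /diag_form mulr_sumr; apply: eq_bigr => i _; ring.
Qed.

Lemma diag_form_delta w p i : diag_form w p (delta_mx ord0 i) = w i * p ord0 i.
Proof.
rewrite /diag_form (bigD1 i)//= big1 ?addr0.
  by rewrite mxE !eqxx mulr1.
by move=> j ji; rewrite mxE eqxx /= (negbTE ji) !mulr0.
Qed.

(** The complement of x = 0, where |y|^2 / |p|^2 < 1 and the series of G converges. It contains the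
    cone and its boundary away from the origin. *)
Definition off_axis : set E := [set p | ysqnorm p < sqnorm p].

Lemma diag_form_smooth w (O : set E) N : open O -> Ck_rec O N (fun q => diag_form w q q).
Proof.
move=> oO; apply: Ck_rec_sum => // i.
apply: Ck_rec_mul => //; first exact: Ck_rec_const.
by apply: Ck_rec_mul => //; exact: Ck_rec_coord.
Qed.

Lemma diag_form_continuous w p : {for p, continuous (fun q => diag_form w q q)}.
Proof.
have := @diag_form_smooth w setT 0 openT => h.
exact: (@Ck_rec_continuous _ _ _ _ _ h p I).
Qed.

Lemma open_lt_diag w w' : open [set p : E | diag_form w p p < diag_form w' p p].
Proof.
rewrite (_ : [set p | _] = (fun p : E => diag_form w' p p - diag_form w p p) @^-1` [set x | 0 < x]).
  apply: open_comp; last exact: open_gt.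
  move=> p _; exact: (cvgB (@diag_form_continuous w' p) (@diag_form_continuous w p)).
by apply/seteqP; split => p /=; rewrite subr_gt0.
Qed.

Lemma open_off_axis : open off_axis.
Proof. exact: open_lt_diag. Qed.

Lemma off_axis_gt0 p : off_axis p -> 0 < sqnorm p.
Proof. by apply: le_lt_trans; exact: ysqnorm_ge0. Qed.

Definition sratio p : R := ysqnorm p / sqnorm p.

Lemma sratio_itv p : off_axis p -> 0 <= sratio p < 1.
Proof.
move=> h; have r0 := off_axis_gt0 h.
by rewrite /sratio divr_ge0 ?ysqnorm_ge0 ?(ltW r0)//= ltr_pdivrMr// mul1r.
Qed.

Let b : R := (n%:R - 4) / 2.
Let c : R := k%:R / 2.
Let c0 : 0 < c. Proof. by rewrite divr_gt0// ltr0n. Qed.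
Let G := hyp2F1 1 b c.
Let G1 := hyp_d 1 b c.
Let G2 := hyp_dd 1 b c.

Lemma V_nkE p : V_nk n k p = sqnorm p `^ (- b) * G (sratio p).
Proof.
rewrite /V_nk xynormE /g_nk; congr (_ `^ _ * _); first by rewrite /b; field.
rewrite /G /b /c /sratio exprMn ynormE exprVn sqr_sqrtr//; exact: sqnorm_ge0.
Qed.

Lemma powR_smooth e (phi : E -> R) (O : set E) N : open O -> (forall p, O p -> 0 < phi p) ->
  Ck_rec O N phi -> Ck_rec O N (fun p => phi p `^ e).
Proof.
move=> oO h0 hp.
(* The j-th derivative of y^e, as required by [Ck_rec_comp]. *)
pose h (j : nat) (y : R) := (\prod_(i < j) (e - i%:R)) * y `^ (e - j%:R).
have dh (j : nat) (y : R) : 0 < y -> is_derive y (1 : R) (h j) (h j.+1 y).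
  move=> y0; have h1 : is_derive y (1 : R) (fun z : R => z `^ (e - j%:R))
    ((e - j%:R) * y `^ (e - j%:R - 1)) by exact: is_derive1_powR.
  apply: is_derive_eq_val (is_derive_mul (is_derive_const _ y) h1) _.
  by rewrite /h big_ord_recr /= mul0r add0r mulrA -natr1 opprD addrA.
have := @Ck_rec_comp R _ O oO N phi h [set y | 0 < y] dh h0 hp 0%N.
apply: Ck_rec_eq => // p Op.
by rewrite /h big_ord0 mul1r subr0.
Qed.

Lemma V_smooth : smooth_rec off_axis (V_nk n k).
Proof.
move=> N; have oO := open_off_axis.
have hr : Ck_rec off_axis N sqnorm by exact: diag_form_smooth.
have hB : Ck_rec off_axis N ysqnorm by exact: diag_form_smooth.
have hs : Ck_rec off_axis N sratio.
  have := Ck_rec_mul oO hB (powR_smooth (-1) oO off_axis_gt0 hr).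
  apply: Ck_rec_eq => // p /off_axis_gt0 h.
  by rewrite /sratio powR_inv1// ltW.
pose h (j : nat) := psum (iter j (@pseries_diffs R) (hyp_coef 1 b c)).
have rad j : unit_radius (iter j (@pseries_diffs R) (hyp_coef 1 b c)).
  by elim: j => [|j IH] /=; [exact: hyp_unit_radius|exact: unit_radius_diffs].
have dh (j : nat) (y : R) : `|y| < 1 -> is_derive y (1 : R) (h j) (h j.+1 y).
  by move=> y1; exact: psum_derive (rad j) y1.
have hG := @Ck_rec_comp R _ off_axis oO N sratio h [set y | `|y| < 1] dh
  (fun p hp => itv01_norm (sratio_itv hp)) hs 0%N.
have := Ck_rec_mul oO (powR_smooth (- b) oO off_axis_gt0 hr) hG.
by apply: Ck_rec_eq => // p _; rewrite V_nkE.
Qed.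

Lemma is_derive_sratio p v : off_axis p -> is_derive p v sratio
  (2 * (diag_form ycoord p v - sratio p * diag_form (fun=> 1) p v) / sqnorm p).
Proof.
move=> hp; have r0 := off_axis_gt0 hp.
have r0' : sqnorm p != 0 by rewrite gt_eqF.
have h1 := is_derive_inv (is_derive_ident (sqnorm p)) r0'.
have h2 := is_derive_vcomp (is_derive_diag (fun=> 1) p v) h1.
apply: is_derive_veq (is_derive_vmul (is_derive_diag ycoord p v) h2) _.
rewrite -/(ysqnorm p) -/(sqnorm p) /sratio.
by field.
Qed.

Lemma powRB1 (y e : R) : 0 < y -> y `^ (e - 1) = y `^ e / y.
Proof. by move=> y0; rewrite powRB ?powRr1 ?(ltW y0)// (gt_eqF y0) implybT. Qed.

Lemma is_derive_sqnorm_pow e p v : off_axis p -> is_derive p v (fun q => sqnorm q `^ e)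
  (e * (sqnorm p `^ e / sqnorm p) * (2 * diag_form (fun=> 1) p v)).
Proof.
move=> hp; have r0 := off_axis_gt0 hp.
have h1 : is_derive (sqnorm p) (1 : R) (fun z : R => z `^ e) (e * sqnorm p `^ (e - 1)).
  exact: is_derive1_powR.
apply: is_derive_veq (is_derive_vcomp (is_derive_diag (fun=> 1) p v) h1) _.
by rewrite powRB1.
Qed.

Lemma is_derive_V p v : off_axis p -> is_derive p v (V_nk n k)
  (2 * (sqnorm p `^ (- b) / sqnorm p) *
   (- b * G (sratio p) * diag_form (fun=> 1) p v +
    G1 (sratio p) * (diag_form ycoord p v - sratio p * diag_form (fun=> 1) p v))).
Proof.
move=> hp; have r0 := off_axis_gt0 hp; have hs := sratio_itv hp.
rewrite (_ : V_nk n k = (fun q => sqnorm q `^ (- b) * G (sratio q))); last first.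
  by apply/funext => q; rewrite V_nkE.
have hG := is_derive_vcomp (is_derive_sratio v hp) (is_derive_hyp 1 b c0 (itv01_norm hs)).
apply: is_derive_veq (is_derive_vmul (is_derive_sqnorm_pow (- b) v hp) hG) _.
by rewrite -/G -/G1; field; rewrite gt_eqF.
Qed.

(** The second partial derivatives are affine in [ycoord i], p_i^2 and [ycoord i] p_i^2. Summing
    over i produces n, k, |p|^2 and |y|^2 = s |p|^2, and the total is 4 K times the hypergeometric
    equation of G at s. *)
Lemma laplacian_V p : off_axis p -> laplacian (V_nk n k) p = 0.
Proof.
move=> hp; have r0 := off_axis_gt0 hp; have hs := sratio_itv hp.
pose K q := sqnorm q `^ (- b - 1).
pose D (i : J) q := 2 * (q ord0 i * (K q *
  (- b * G (sratio q) + (ycoord i - sratio q) * G1 (sratio q)))).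
have D1 (i : J) q : off_axis q -> 'D_(delta_mx ord0 i) (V_nk n k) q = D i q.
  move=> hq; have rq := off_axis_gt0 hq.
  have [_ ->] := is_derive_V (delta_mx ord0 i) hq.
  rewrite !diag_form_delta /D /K powRB1//; ring.
pose s := sratio p; pose g := G s; pose g1 := G1 s; pose g2 := G2 s.
pose r := sqnorm p.
pose h0 := - b * g - s * g1.
pose k0 := (b + 1) * (b * g + s * g1) + (b + 1) * s * g1 + s ^+ 2 * g2.
pose kk1 := - 2 * (b + 1) * g1 + (1 - 2 * s) * g2.
have D2 (i : J) : is_derive p (delta_mx ord0 i) (D i)
  (2 * K p * (h0 + ycoord i * g1) +
   4 * K p / r * ((1 * (p ord0 i * p ord0 i)) * k0 + (ycoord i * (p ord0 i * p ord0 i)) * kk1)).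
  pose e : E := delta_mx ord0 i.
  have ds := is_derive_sratio e hp.
  have dG := is_derive_vcomp ds (is_derive_hyp 1 b c0 (itv01_norm hs)).
  have dG1 := is_derive_vcomp ds (is_derive_hyp_d 1 b c0 (itv01_norm hs)).
  have dyc := is_derive_vadd (is_derive_vconst (ycoord i) p e)
    (is_derive_vmul (is_derive_vconst (-1) p e) ds).
  have dH := is_derive_vadd (is_derive_vmul (is_derive_vconst (- b) p e) dG)
    (is_derive_vmul dyc dG1).
  have := is_derive_vmul (is_derive_vconst 2 p e) (is_derive_vmul (is_derive_coord i p e)
    (is_derive_vmul (is_derive_sqnorm_pow (- b - 1) e hp) dH)).
  rewrite !diag_form_delta -/r -/s -/(K p) -/G -/G1 -/G2 -/g -/g1 -/g2.
  have -> : e ord0 i = 1 by rewrite mxE !eqxx.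
  have -> : D i = (fun q => 2 * (q ord0 i * (sqnorm q `^ (- b - 1) *
      (- b * G (sratio q) + (ycoord i + -1 * sratio q) * G1 (sratio q))))).
    by apply/funext => q; rewrite /D /K mulN1r.
  move=> h; apply: is_derive_veq h _; rewrite /h0 /k0 /kk1.
  have id := ycoord_idem i; move: (ycoord i) id => y id.
  have rn : r != 0 by rewrite gt_eqF.
  (* [ycoord i] is 0 or 1; adding this zero term lets [field] replace its square by itself. *)
  rewrite -[RHS]addr0 -[X in _ = _ + X](_ : 4 * K p / r * (p ord0 i * p ord0 i) * g2 * (y * y - y) = 0);
    last by rewrite id subrr mulr0.
  by field.
rewrite /laplacian.
transitivity (\sum_i (2 * K p * (h0 + ycoord i * g1) +
   4 * K p / r * ((1 * (p ord0 i * p ord0 i)) * k0 + (ycoord i * (p ord0 i * p ord0 i)) * kk1))).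
  apply: eq_bigr => i _.
  have [_ <-] := D2 i; apply: near_eq_derive.
  exact: (open_near_eq open_off_axis hp (fun q hq => D1 i q hq)).
have S1 (x y : R) : \sum_i (x + ycoord i * y) = n%:R * x + k%:R * y.
  by rewrite big_split /= -mulr_suml ycoord_sum sumr_const card_ord subnK// -[x *+ n]mulr_natl.
have S2 (x y : R) : \sum_i (1 * (p ord0 i * p ord0 i) * x + ycoord i * (p ord0 i * p ord0 i) * y) =
    r * x + ysqnorm p * y.
  by rewrite big_split /= -!mulr_suml.
rewrite big_split /= -!mulr_sumr S1 S2.
have eB : ysqnorm p = s * r by rewrite /s /sratio divfK// gt_eqF.
have ode := hyp_ode 1 b c0 (itv01_norm hs).
rewrite eB.
have -> : k%:R = 2 * c by rewrite /c; field.
have -> : n%:R = 2 * b + 4 by rewrite /b; field.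
have : s * (1 - s) * g2 + (c - (1 + b + 1) * s) * g1 - 1 * b * g = 0.
  by rewrite ode subrr.
move=> z; transitivity (4 * K p *
  (s * (1 - s) * g2 + (c - (1 + b + 1) * s) * g1 - 1 * b * g)); last by rewrite z mulr0.
by rewrite /h0 /k0 /kk1; field; rewrite gt_eqF.
Qed.

End Potential.

(** * Uniqueness of the inner unit normal *)

Section InnerNormal.
Variables (R : realType) (d : nat).
Implicit Types (phi psi : 'rV[R]_d -> R) (O W : set 'rV[R]_d) (p u v w : 'rV[R]_d).

Definition dot u v : R := \sum_i u ord0 i * v ord0 i.

Lemma dotC u v : dot u v = dot v u.
Proof. by apply: eq_bigr => i _; rewrite mulrC. Qed.

Lemma dotDl u v w : dot (u + v) w = dot u w + dot v w.
Proof. by rewrite /dot -big_split; apply: eq_bigr => i _; rewrite mxE mulrDl. Qed.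

Lemma dotZl (a : R) u v : dot (a *: u) v = a * dot u v.
Proof. by rewrite /dot mulr_sumr; apply: eq_bigr => i _; rewrite mxE mulrA. Qed.

Lemma dotDr u v w : dot w (u + v) = dot w u + dot w v.
Proof. by rewrite dotC dotDl !(dotC w). Qed.

Lemma dotZr (a : R) u v : dot u (a *: v) = a * dot u v.
Proof. by rewrite dotC dotZl dotC. Qed.

Lemma dot_ge0 u : 0 <= dot u u.
Proof. by apply: sumr_ge0 => i _; rewrite -expr2 sqr_ge0. Qed.

Lemma dot_eq0 u : dot u u = 0 -> u = 0.
Proof.
move=> /eqP; rewrite /dot psumr_eq0; last by move=> i _; rewrite -expr2 sqr_ge0.
move=> /allP h; apply/rowP => i; rewrite mxE; apply/eqP.
by have := h i; rewrite mem_index_enum mulf_eq0 orbb => /(_ isT).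
Qed.

Lemma dot_gt0 u : u != 0 -> 0 < dot u u.
Proof.
move=> u0; rewrite lt_neqAle dot_ge0 andbT eq_sym.
by apply: contra_neq u0 => /dot_eq0.
Qed.

Lemma enorm_dot u : enorm u = Num.sqrt (dot u u).
Proof. by rewrite /enorm; congr Num.sqrt; apply: eq_bigr => i _; rewrite expr2. Qed.

Lemma enormZ (a : R) u : 0 <= a -> enorm (a *: u) = a * enorm u.
Proof.
move=> a0; rewrite !enorm_dot dotZl dotZr mulrA -expr2 sqrtrM ?sqr_ge0//.
by rewrite sqrtr_sqr ger0_norm.
Qed.

(* Test the half-space inclusion on e w - v0 with e -> 0, where v0 is the component of
   w' orthogonal to w. *)
Lemma halfspace_normal w w' : w != 0 -> w' != 0 ->
  (forall v, 0 < dot w v -> 0 <= dot w' v) ->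
  (enorm w')^-1 *: w' = (enorm w)^-1 *: w.
Proof.
move=> w0 w0' h; have W0 := dot_gt0 w0; pose M := dot w' w.
have M0 : 0 <= M by exact: h.
pose a := M / dot w w; pose v0 := w' + (- a) *: w.
have e1 : dot w v0 = 0.
  by rewrite /v0 dotDr dotZr (dotC w w') -/M /a mulNr divfK ?subrr// gt_eqF.
have e2 : dot w' v0 = dot v0 v0.
  by rewrite {2}/v0 dotDl dotZl e1 mulr0 addr0.
have v00 : v0 = 0.
  apply: dot_eq0; apply/eqP; rewrite eq_le dot_ge0 andbT; apply: contraT; rewrite -ltNge => N0.
  pose N := dot v0 v0; pose e := N / (2 * (M + 1)).
  have M1 : 0 < M + 1 by rewrite ltr_wpDl.
  have e0 : 0 < e by rewrite divr_gt0// mulr_gt0.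
  have : 0 <= dot w' (e *: w + (-1) *: v0).
    by apply: h; rewrite dotDr !dotZr e1 mulr0 addr0 mulr_gt0.
  rewrite dotDr !dotZr e2 -/M -/N => h1.
  have h2 : e * (M + 1) * 2 = N by rewrite /e; field; rewrite gt_eqF.
  by have : 0 < N by []; nra.
have e3 : w' = a *: w.
  by apply/eqP; rewrite -subr_eq0 -scaleNr -/v0 v00.
have a0 : 0 < a.
  rewrite lt_neqAle divr_ge0 ?(ltW W0)// andbT eq_sym.
  by apply: contra_neq w0' => a0; rewrite e3 a0 scale0r.
rewrite e3 enormZ ?(ltW a0)// scalerA; congr (_ *: _).
have n0 : enorm w != 0 by rewrite enorm_dot gt_eqF// sqrtr_gt0.
by field; rewrite n0 gt_eqF.
Qed.

Lemma is_derive_right phi p v (l : R) : is_derive p v phi l ->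
  h^-1 * (phi (h *: v + p) - phi p) @[h --> (0 : R)^'+] --> l.
Proof.
move=> [h <-]; have h1 : h^-1 *: (phi (h *: v + p) - phi p) @[h --> (0 : R)^'] --> 'D_v phi p.
  exact: h.
exact: cvg_dnbhs_at_right h1.
Qed.

Lemma is_derive_normal phi p v (l : R) : is_derive p v phi l -> is_normal_derivative phi p v l.
Proof.
move=> /is_derive_right h; rewrite /is_normal_derivative.
rewrite (_ : (fun h : R => _) = (fun h : R => h^-1 * (phi (h *: v + p) - phi p)))//.
by apply/funext => x; rewrite [p + _]addrC.
Qed.

Lemma is_derive_gt0_right phi p v (l : R) : is_derive p v phi l -> phi p = 0 -> 0 < l ->
  \forall h \near (0 : R)^'+, 0 < phi (h *: v + p).
Proof.
move=> /is_derive_right h p0 l0.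
near=> x; have x0 : 0 < x by near: x; exact: nbhs_right_gt.
have : 0 < x^-1 * (phi (x *: v + p) - phi p) by near: x; exact: (cvgr_gt _ h).
by rewrite p0 subr0 pmulr_rgt0// invr_gt0.
Unshelve. all: by end_near. Qed.

Lemma is_derive_ge0_right phi p v (l : R) : is_derive p v phi l -> phi p = 0 ->
  (\forall h \near (0 : R)^'+, 0 < phi (h *: v + p)) -> 0 <= l.
Proof.
move=> /is_derive_right h p0 hn; rewrite leNgt; apply/negP => l0.
have h1 : \forall x \near (0 : R)^'+, x^-1 * (phi (x *: v + p) - phi p) < 0.
  exact: (cvgr_lt _ h).
have h2 : \forall x \near (0 : R)^'+, 0 < x by exact: nbhs_right_gt.
have [x [x1 [x2 x3]]] := filter_ex (filterI hn (filterI h1 h2)).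
by move: x2; rewrite p0 subr0 pmulr_rlt0 ?invr_gt0// ltNge ltW.
Qed.

Lemma open_right O p v : open O -> O p -> \forall h \near (0 : R)^'+, O (h *: v + p).
Proof.
move=> oO Op.
have h : (h *: v + p) @[h --> (0 : R)] --> p.
  rewrite -[X in _ --> X]add0r -(scale0r v); apply: cvgD; last exact: cvg_cst.
  by apply: cvgZr_tmp; exact: cvg_id.
apply: cvg_within; apply: h; exact: open_nbhs_nbhs.
Qed.

(** A direction in which one defining function increases strictly enters the set, so no other
    defining function can decrease along it. One half-space thus lies in the closure of the other,
    and the normalized gradients agree. *)
Lemma inner_unit_normal_unique O W psi p nu : open W -> W p -> smooth_on W psi -> psi p = 0 ->
  (forall q, W q -> (O q <-> 0 < psi q)) -> grad psi p != 0 ->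
  inner_unit_normal O p nu -> nu = (enorm (grad psi p))^-1 *: grad psi p.
Proof.
move=> oW Wp sm p0 hO g0 [W' [psi' [[oW' Wp' sm'] p0' hO' g0' ->]]].
apply: halfspace_normal => // v hv.
have D (X : set 'rV[R]_d) f : open X -> X p -> smooth_on X f -> is_derive p v f (dot (grad f p) v).
  move=> oX Xp sX; have e := derive_dir_grad oX (sX 1%N) v Xp.
  apply: DeriveDef; last exact: e.
  exact: (sX 1%N [::] isT p Xp).2.
have h1 := is_derive_gt0_right (D _ _ oW Wp sm) p0 hv.
apply: (is_derive_ge0_right (D _ _ oW' Wp' sm') p0').
have h2 := open_right v oW Wp; have h3 := open_right v oW' Wp'.
apply: filterS3 h1 h2 h3 => x x1 x2 x3.
by apply/(hO' _ x3)/(hO _ x2).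
Qed.

End InnerNormal.

(** * The cone, its boundary and its normal *)

Section ConeGeometry.
Variables (R : realType) (n k : nat) (t c : R).
Hypotheses (n2 : (2 <= n)%N) (k1 : (1 <= k)%N).
Hypotheses (ht : is_zero_nk n k t) (c0 : 0 < c).
Local Notation E := ('rV[R]_(n - k + k)).
Implicit Types (p q v : E).

Let t0 : 0 < t. Proof. by have [/andP[]] := ht. Qed.
Let t1 : t < 1. Proof. by have [/andP[]] := ht. Qed.
Let s0 : 0 < t ^+ 2. Proof. by rewrite exprn_gt0. Qed.
Let s1 : t ^+ 2 < 1. Proof. by rewrite exprn_ilt1// ltW. Qed.

Let O : set E := positivity_set (U_nk n k t c).

Lemma rhoE p : rho p = Num.sqrt (sqnorm p).
Proof. by rewrite /rho xynormE. Qed.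

Lemma tvar_ge0 p : 0 <= tvar p.
Proof. by rewrite /tvar divr_ge0// sqrtr_ge0. Qed.

Lemma tvar_sqr p : tvar p ^+ 2 = sratio p.
Proof. by rewrite /tvar rhoE exprMn ynormE exprVn sqr_sqrtr// sqnorm_ge0. Qed.

(** F decreases, hence is positive before its zero. At the origin [tvar] is 0 by the convention for
    division, which is below [t]; the factor [rho] excludes that point. *)
Lemma positivity_setE p : O p <-> ysqnorm p < t ^+ 2 * sqnorm p.
Proof.
have r0 : 0 <= sqnorm p := sqnorm_ge0 p.
have lt_t : (tvar p < t) = (sratio p < t ^+ 2).
  by rewrite -tvar_sqr ltr_pXn2r// nnegrE ?tvar_ge0// ltW.
rewrite /O /positivity_set /U_nk /= lt_t; split.
- case: ifP => [ht2 hU|]; last by rewrite ltxx.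
  have r1 : 0 < sqnorm p.
    rewrite lt_neqAle r0 andbT eq_sym; apply/eqP => e.
    by move: hU; rewrite rhoE e sqrtr0 mulr0 mul0r ltxx.
  by move: ht2; rewrite /sratio ltr_pdivrMr.
- move=> h; have r1 : 0 < sqnorm p.
    by rewrite -(pmulr_rgt0 _ s0); exact: le_lt_trans (ysqnorm_ge0 p) h.
  have h2 : sratio p < t ^+ 2 by rewrite /sratio ltr_pdivrMr.
  rewrite h2 mulr_gt0//; first by rewrite mulr_gt0// rhoE sqrtr_gt0.
  have [_ z] := ht; rewrite /f_nk tvar_sqr -z /f_nk; apply: hyp_half_decr => //.
  + by rewrite divr_gt0// subr_gt0 ltr1n.
  + by rewrite divr_gt0// ltr0n.
  + by rewrite h2 andbT /sratio divr_ge0// ysqnorm_ge0.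
Qed.

Definition cone_form (p : E) : R := diag_form (fun i => t ^+ 2 - ycoord R i) p p.

Lemma cone_formE p : cone_form p = t ^+ 2 * sqnorm p - ysqnorm p.
Proof.
rewrite /cone_form /sqnorm /ysqnorm /diag_form mulr_sumr -sumrB.
by apply: eq_bigr => i _; ring.
Qed.

Lemma positivity_set_cone_form p : O p <-> 0 < cone_form p.
Proof. by rewrite cone_formE subr_gt0; exact: positivity_setE. Qed.

Lemma open_positivity_set : open O.
Proof.
rewrite (_ : O = [set p : E | diag_form (fun=> 0) p p < cone_form p]).
  exact: open_lt_diag.
have z p : diag_form (fun=> 0) p p = 0 :> R by rewrite /diag_form big1// => i _; rewrite mul0r.
by apply/seteqP; split => p /=; rewrite z => /positivity_set_cone_form.
Qed.

Lemma positivity_set_off_axis p : O p -> off_axis p.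
Proof.
move=> /positivity_setE h; apply: (lt_le_trans h).
by rewrite ler_piMl ?sqnorm_ge0// ltW.
Qed.

Lemma punctured_boundaryE p : punctured_boundary O p -> p != 0 /\ ysqnorm p = t ^+ 2 * sqnorm p.
Proof.
move=> [[clO nO] p0]; split; first by apply/eqP.
have nOp : ~ O p by move=> Op; apply: nO; rewrite (proj1 (interior_id _) open_positivity_set).
have h1 : 0 <= cone_form p.
  have cl : closed [set q : E | 0 <= cone_form q].
    rewrite (_ : [set q | _] = ~` [set q : E | cone_form q < diag_form (fun=> 0) q q]).
      by apply: open_closedC; exact: open_lt_diag.
    have z q : diag_form (fun=> 0) q q = 0 :> R by rewrite /diag_form big1// => i _; rewrite mul0r.
    apply/seteqP; split => q /=; rewrite z; first by move=> h; apply/negP; rewrite -leNgt.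
    by move/negP; rewrite -leNgt.
  apply: cl; apply: closureS clO => q /positivity_set_cone_form; exact: ltW.
have h2 : ~~ (0 < cone_form p) by apply/negP => /positivity_set_cone_form.
move: h1 h2; rewrite -leNgt cone_formE => h1 h2.
by apply/eqP; rewrite eq_le; lra.
Qed.

Lemma punctured_boundary_off_axis p : punctured_boundary O p -> off_axis p.
Proof.
move=> /punctured_boundaryE[p0 e]; have r0 := sqnorm_gt0 p0.
by rewrite /off_axis /= e gtr_pMl.
Qed.

Lemma grad_cone_form p i : grad cone_form p ord0 i = 2 * ((t ^+ 2 - ycoord R i) * p ord0 i).
Proof.
rewrite mxE; have [_ ->] := is_derive_diag (fun i => t ^+ 2 - ycoord R i) p (delta_mx ord0 i).
by rewrite diag_form_delta.
Qed.

Lemma diag_form_grad w p : diag_form w p (grad cone_form p) =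
  2 * diag_form (fun i => w i * (t ^+ 2 - ycoord R i)) p p.
Proof.
rewrite /diag_form mulr_sumr; apply: eq_bigr => i _; rewrite grad_cone_form; ring.
Qed.

Lemma dot_grad_cone_form p : punctured_boundary O p ->
  dot (grad cone_form p) (grad cone_form p) = 4 * (sqnorm p * (t ^+ 2 * (1 - t ^+ 2))).
Proof.
move=> /punctured_boundaryE[_ e].
transitivity (4 * (t ^+ 4 * sqnorm p + (1 - 2 * t ^+ 2) * ysqnorm p)); last by rewrite e; ring.
rewrite /sqnorm /ysqnorm /diag_form !mulr_sumr -big_split mulr_sumr /=.
apply: eq_bigr => i _; rewrite grad_cone_form.
have := ycoord_idem R i; move: (ycoord R i) => y id.
transitivity (4 * (t ^+ 4 - 2 * t ^+ 2 * y + y * y) * (p ord0 i * p ord0 i)); first by ring.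
by rewrite id; ring.
Qed.

Lemma cone_form_smooth : smooth_on setT cone_form.
Proof. by apply: smooth_rec_on => // N; apply: diag_form_smooth; exact: openT. Qed.

Lemma grad_cone_form_neq0 p : punctured_boundary O p -> grad cone_form p != 0.
Proof.
move=> hp; have [p0 _] := punctured_boundaryE hp; apply/eqP => g0.
have := dot_grad_cone_form hp; rewrite g0 /dot big1 => [|i _]; last by rewrite mxE mul0r.
move=> /esym/eqP; rewrite gt_eqF// mulr_gt0// mulr_gt0 ?sqnorm_gt0// mulr_gt0//.
by rewrite subr_gt0.
Qed.

Lemma cone_normal_exists p : punctured_boundary O p -> exists nu, inner_unit_normal O p nu.
Proof.
move=> hp; have [_ e] := punctured_boundaryE hp.
exists ((enorm (grad cone_form p))^-1 *: grad cone_form p), setT, cone_form; split => //.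
- by split => //; [exact: openT|exact: cone_form_smooth].
- by rewrite cone_formE e subrr.
- by move=> q _; exact: positivity_set_cone_form.
- exact: grad_cone_form_neq0.
Qed.

Lemma cone_normalE p nu : punctured_boundary O p -> inner_unit_normal O p nu ->
  nu = (enorm (grad cone_form p))^-1 *: grad cone_form p.
Proof.
move=> hp; have [_ e] := punctured_boundaryE hp.
apply: (@inner_unit_normal_unique _ _ O setT) => //.
- exact: openT.
- exact: cone_form_smooth.
- by rewrite cone_formE e subrr.
- by move=> q _; exact: positivity_set_cone_form.
- exact: grad_cone_form_neq0.
Qed.

Lemma enorm_grad_cone_form p : punctured_boundary O p ->
  enorm (grad cone_form p) = 2 * (Num.sqrt (sqnorm p) * (t * Num.sqrt (1 - t ^+ 2))).
Proof.
move=> hp; rewrite enorm_dot dot_grad_cone_form//.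
have h : 0 <= 2 * (Num.sqrt (sqnorm p) * (t * Num.sqrt (1 - t ^+ 2))).
  by rewrite mulr_ge0// mulr_ge0 ?sqrtr_ge0// mulr_ge0 ?sqrtr_ge0// ltW.
rewrite -[RHS](ger0_norm h) -sqrtr_sqr; congr Num.sqrt.
rewrite !exprMn !sqr_sqrtr ?sqnorm_ge0//; first by rewrite -natrX.
by rewrite subr_ge0 ltW.
Qed.

Lemma diag_form_scale w p v (a : R) : diag_form w p (a *: v) = a * diag_form w p v.
Proof. by rewrite /diag_form mulr_sumr; apply: eq_bigr => i _; rewrite mxE; ring. Qed.

(** The normal of a cone is orthogonal to p, so the power of |p| contributes nothing and only the
    derivative of G remains. *)
Lemma is_derive_V_normal p nu : punctured_boundary O p -> inner_unit_normal O p nu ->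
  is_derive p nu (V_nk n k)
    (- 2 * sqnorm p `^ (- ((n%:R - 4) / 2)) *
     (t ^+ 2 * (1 - t ^+ 2) * hyp_d 1 ((n%:R - 4) / 2) (k%:R / 2) (t ^+ 2)) /
     (Num.sqrt (sqnorm p) * (t * Num.sqrt (1 - t ^+ 2)))).
Proof.
move=> hp /(cone_normalE hp) ->; have [p0 e] := punctured_boundaryE hp.
have r0 := sqnorm_gt0 p0.
have es : sratio p = t ^+ 2 by rewrite /sratio e mulfK// gt_eqF.
apply: is_derive_veq (is_derive_V k1 _ (punctured_boundary_off_axis hp)) _.
rewrite es !diag_form_scale !diag_form_grad enorm_grad_cone_form//.
have -> : diag_form (fun i => 1 * (t ^+ 2 - ycoord R i)) p p = 0.
  transitivity (cone_form p); last by rewrite cone_formE e subrr.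
  by apply: eq_bigr => i _; rewrite mul1r.
have -> : diag_form (fun i => ycoord R i * (t ^+ 2 - ycoord R i)) p p =
    (t ^+ 2 - 1) * (t ^+ 2 * sqnorm p).
  rewrite -e /ysqnorm /diag_form mulr_sumr; apply: eq_bigr => i _.
  by rewrite mulrBr ycoord_idem; ring.
have q0 : 0 < Num.sqrt (1 - t ^+ 2) by rewrite sqrtr_gt0 subr_gt0.
have d0 : 0 < Num.sqrt (sqnorm p) by rewrite sqrtr_gt0.
move: (Num.sqrt (sqnorm p)) (Num.sqrt (1 - t ^+ 2)) d0 q0 => D Q d0 q0.
by field; rewrite !gt_eqF.
Qed.

End ConeGeometry.

(** * Harmonicity, regularity and the boundary inequality for V *)

Theorem proposition1p2 (R : realType) (n k : nat)
  (hn : (7 <= n)%N) (hk1 : (1 <= k)%N) (hk2 : (k <= n - 2)%N)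
  (t c : R) (ht : is_zero_nk n k t) (hc : is_normalization_nk n k t c) :
  linearized_subsolution (positivity_set (U_nk n k t c))
    (mean_curvature_nk n k t) (V_nk n k).
Proof.
have [c0 _] := hc; have n2 : (2 <= n)%N by lia.
have kn : (k <= n)%N by lia.
have [/andP[t0 t1] z] := ht.
split.
- split.
    move=> vs sz p Op; have := Ck_rec_on (V_smooth R n hk1 2).
    by apply => //; exact: positivity_set_off_axis n2 hk1 ht c0 p Op.
  move=> p Op; apply: laplacian_V => //.
  exact: positivity_set_off_axis n2 hk1 ht c0 p Op.
(* V is smooth on the whole open set [off_axis], so it serves as its own extension across the
   boundary. *)
- move=> p hp; exists (@off_axis R n k), (V_nk n k); split => //.
  + exact: open_off_axis.
  + exact: punctured_boundary_off_axis n2 hk1 ht c0 p hp.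
  + exact: smooth_rec_on (V_smooth R n hk1).
- move=> p hp; split; first exact: cone_normal_exists n2 hk1 ht c0 p hp.
  move=> nu hnu; have hd := is_derive_V_normal n2 hk1 ht c0 hp hnu.
  have [p0 e] := punctured_boundaryE n2 hk1 ht c0 hp.
  have r0 := sqnorm_gt0 p0.
  have es : sratio p = t ^+ 2 by rewrite /sratio e mulfK// gt_eqF.
  have s01 : 0 < t ^+ 2 < 1 by rewrite exprn_gt0//= exprn_ilt1// ltW.
  have /andP[s0 s1] := s01.
  eexists; first exact: is_derive_normal hd.
  rewrite V_nkE es /mean_curvature_nk rhoE.
  have kc0 : 0 < k%:R / 2 :> R by rewrite divr_gt0// ltr0n.
  have ineq := core_inequality hn hk1 hk2 s01 z.
  have sn : `|t ^+ 2| < 1 by rewrite ger0_norm// ltW.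
  rewrite (hyp1_ode ((n%:R - 4) / 2) kc0 sn).
  move: (hyp2F1 1 _ _ _) ineq => g ineq.
  have q0 : 0 < Num.sqrt (1 - t ^+ 2) by rewrite sqrtr_gt0 subr_gt0.
  have d0 : 0 < Num.sqrt (sqnorm p) by rewrite sqrtr_gt0.
  have P0 : 0 < sqnorm p `^ (- ((n%:R - 4) / 2)) by rewrite powR_gt0.
  move: (Num.sqrt (sqnorm p)) (Num.sqrt (1 - t ^+ 2)) (sqnorm p `^ _) d0 q0 P0 => D Q P d0 q0 P0.
  (* With s = t^2, the normal derivative contributes (k - 2 - (n - 4) s) G - (k - 2) and the
     curvature ((n - 2) s - (k - 1)) G, up to a common positive factor; n and k cancel from the
     coefficient of G, leaving 2 s - 1. *)
  rewrite (_ : _ + _ = P / (D * (t * Q)) * (g * (2 * t ^+ 2 - 1) - (k%:R - 2))).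
    by rewrite pmulr_rle0 ?subr_le0// divr_gt0// mulr_gt0// mulr_gt0.
  by field; rewrite !gt_eqF.
Qed.
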